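(* For every $t_1,t_2>0$, $$\lim_{N\to\infty}\mathrm{Cov}\left[\sqrt{\frac{N}{\log N}}\;\mathcal{S}_{N,t_1}\,,\,\sqrt{\frac{N}{\log N}}\;\mathcal{S}_{N,t_2}\right]=2\,(t_1\wedge t_2).$$
   Context: Let $\eta$ be space-time white noise on $\mathbb{R}_+\times\mathbb{R}$ and $\boldsymbol{p}_t(x)=(2\pi t)^{-1/2}e^{-x^2/(2t)}$ for $t>0$, $x\in\mathbb{R}$. Let $u$ be the solution (in the sense of Walsh) of the parabolic Anderson model $\partial_t u=\tfrac12\partial_x^2u+u\,\eta$ on $(0,\infty)\times\mathbb{R}$ with initial condition $u(0)=\delta_0$; i.e. $u$ is the (unique up to modification) random field, adapted to the filtration generated by $\eta$, such that for every $T>0$, $\|u(t,x)\|_2\le c_T\,\boldsymbol{p}_t(x)$ for all $t\in(0,T]$, $x\in\mathbb{R}$ and some finite $c_T$, and $$u(t,x)=\boldsymbol{p}_t(x)+\int_{(0,t)\times\mathbb{R}}\boldsymbol{p}_{t-s}(x-y)u(s,y)\,\eta(ds\,dy)\quad\text{a.s.}$$ (Walsh integral). It has a version that is continuous on $(0,\infty)\times\mathbb{R}$, which is used. Define $U(t,x)=u(t,x)/\boldsymbol{p}_t(x)$ for $t>0$, and for $N>0$ let $\mathcal{S}_{N,t}=\frac1N\int_0^N[U(t,x)-1]\,dx$. *)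

(* Defs.v *)
From HB Require Import structures.
From mathcomp Require Import all_boot all_order all_algebra.
From mathcomp Require Import all_classical all_reals all_analysis.

Set Implicit Arguments.
Unset Strict Implicit.
Unset Printing Implicit Defensive.

Import Order.TTheory GRing.Theory Num.Theory.
Import numFieldNormedType.Exports.

Local Open Scope classical_set_scope.
Local Open Scope ring_scope.

Definition heat_kernel (R : realType) (t x : R) : R :=
  (Num.sqrt (2 * pi * t))^-1 * expR (- x ^+ 2 / (2 * t)).

(* [normal_prob] is indexed by the standard deviation, and is not a Dirac mass
   when this is 0 (see [normal_pdf]); hence the case distinction. *)
Definition centered_gaussian (R : realType) (v : R) (B : set R) : \bar R :=
  if v == 0 then \d_(0 : R) B else normal_prob 0 (Num.sqrt v) B.

Section white_noise.
Context {R : realType} {d : measure_display} {T : measurableType d}.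
Variable P : probability T R.

Definition spacetime_measure : set (R * R) -> \bar R :=
  (@lebesgue_measure R \x @lebesgue_measure R)%E.

(* In a pair [(s, y) : R * R], s is the time and y is the position. *)
Definition noise_set (A : set (R * R)) : Prop :=
  [/\ measurable A, A `<=` [set z | 0 <= z.1] &
      (spacetime_measure A < +oo)%E].

(* Independently scattered Gaussian random measure on R_+ x R whose control
   measure is Lebesgue measure.  The product rule below also covers
   subfamilies: take [B i = setT]. *)
Definition white_noise (eta : set (R * R) -> {RV P >-> R}) : Prop :=
  [/\ forall A, noise_set A -> forall B : set R, measurable B ->
        distribution P (eta A) B =
        centered_gaussian (fine (spacetime_measure A)) B,
      forall (n : nat) (A : 'I_n -> set (R * R)),
        (forall i, noise_set (A i)) -> trivIset setT A ->
        forall B : 'I_n -> set R, (forall i, measurable (B i)) ->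
        P [set w | forall i, B i (eta (A i) w)] =
        (\prod_(i < n) P [set w | B i (eta (A i) w)])%E
    & forall A B, noise_set A -> noise_set B -> A `&` B = set0 ->
        {ae P, forall w, eta (A `|` B) w = eta A w + eta B w}].

Variable eta : set (R * R) -> {RV P >-> R}.

Definition noise_sigma (t : R) : set (set T) :=
  <<s [set E | exists A : set (R * R), exists B : set R,
        [/\ noise_set A, A `<=` [set z | z.1 <= t], measurable B &
            E = eta A @^-1` B]] >>.

(* The filtration generated by the noise, augmented by the P-null events. *)
Definition noise_filtration (t : R) : set (set T) :=
  [set E | measurable E /\ exists2 F, noise_sigma t F & P (E `+` F) = 0%E].

Definition noise_measurable (t : R) (X : T -> R) : Prop :=
  forall B : set R, measurable B -> noise_filtration t (X @^-1` B).

(* The random field (s, y) |-> el_coef * 1_(el_start, el_end](s) * 1_el_space(y).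
*)
Record elementary := Elementary {
  el_coef : T -> R;
  el_start : R;
  el_end : R;
  el_space : set R;
  el_start_ge0 : 0 <= el_start;
  el_start_lt_end : el_start < el_end;
  el_space_measurable : measurable el_space;
  el_space_finite : (lebesgue_measure el_space < +oo)%E;
  el_coef_measurable : noise_measurable el_start el_coef;
  el_coef_bounded : exists M : R, forall w, `|el_coef w| <= M
}.

Definition el_support (e : elementary) : set (R * R) :=
  `]el_start e, el_end e] `*` el_space e.

Definition simple_field (phi : seq elementary) (z : T * (R * R)) : R :=
  \sum_(e <- phi) el_coef e z.1 * \1_(el_support e) z.2.

Definition simple_integral (phi : seq elementary) (w : T) : R :=
  \sum_(e <- phi) el_coef e w * eta (el_support e) w.

Definition predictable_sigma : set (set (T * (R * R))) :=
  <<s [set E | exists A a b (B : set R),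
        [/\ 0 <= a, a < b, noise_filtration a A, measurable B &
            E = A `*` (`]a, b] `*` B)]] >>.

Definition predictable (Phi : T * (R * R) -> R) : Prop :=
  forall B : set R, measurable B -> predictable_sigma (Phi @^-1` B).

(* I is (a version of) the Walsh integral over R_+ x R of the predictable
   field Phi: the L2-extension of the integral of simple fields. *)
Definition walsh_integral (Phi : T * (R * R) -> R) (I : {RV P >-> R}) : Prop :=
  predictable Phi /\
  exists phi : nat -> seq elementary,
  (\int[P \x (@lebesgue_measure R \x @lebesgue_measure R)]_z
     ((simple_field (phi n) z - Phi z) ^+ 2)%:E)%E @[n --> \oo] --> 0%E /\
  (\int[P]_w ((simple_integral (phi n) w - I w) ^+ 2)%:E)%E @[n --> \oo]
     --> 0%E.

(* Continuous version of the solution of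
     du/dt = 1/2 d^2u/dx^2 + u eta,  u(0) = delta_0;
   the values [u t x] with t <= 0 are irrelevant. *)
Definition pam_solution (u : R -> R -> T -> R) : Prop :=
  [/\ forall t x, 0 < t -> noise_measurable t (u t x),
      forall t0, 0 < t0 -> exists c : R, forall t x, 0 < t -> t <= t0 ->
        ('N[P]_2%:E[EFin \o u t x] <= (c * heat_kernel t x)%:E)%E,
      forall t x, 0 < t -> exists2 I : {RV P >-> R},
        walsh_integral (fun z => let: (w, (s, y)) := z in
          if (0 < s) && (s < t) then heat_kernel (t - s) (x - y) * u s y w
          else 0) I &
        {ae P, forall w, u t x w = heat_kernel t x + I w}
    & forall w (z : R * R), 0 < z.1 ->
        {for z, continuous (fun z' : R * R => u z'.1 z'.2 w)}].

End white_noise.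

Section spatial_average.
Context {R : realType} {d : measure_display} {T : measurableType d}.
Variable u : R -> R -> T -> R.

Definition normalized_field (t x : R) (w : T) : R := u t x w / heat_kernel t x.

Definition spatial_average (N t : R) (w : T) : R :=
  N^-1 * \int[lebesgue_measure]_(x in `[0, N]) (normalized_field t x w - 1).

End spatial_average.

(* Main.v *)
Require Import Defs.
From HB Require Import structures.
From mathcomp Require Import all_boot all_order all_algebra.
From mathcomp Require Import all_classical all_reals all_analysis.
From mathcomp Require Import measurable_realfun ring lra.

(* By the Walsh isometry, for [t1 <= t2],
     Cov (u (t1, x), u (t2, y))
       = \int_(0, t1) \int p_(t1 - s) (x - z) p_(t2 - s) (y - z) E [u (s, z) ^ 2] dz ds.
   Dividing by [p_t1 x * p_t2 y] turns each heat kernel, with one factor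
   [p_s z], into the transition density of a Brownian bridge, and leaves the
   relative second moment [E [u (s, z) ^ 2] / p_s z ^ 2], which lies in
   [[1, 1 + C sqrt s]].  Integrate over [x, y] in [[0, N]]: for
   [N ^- 2 <= s <= t1] the product of the two window functions of [z] has
   integral [t1 N / s + O (s ^ (- 3 / 2))], since the window function for [ti]
   is about [ti / s] on [[0, s N / ti]] and [0] elsewhere; for [s <= N ^- 2] the
   integral is [O (N ^ 2 / sqrt s)].  Integrating over [s] gives
   [2 t1 N ln N + O (N)]. *)

Set Implicit Arguments.
Unset Strict Implicit.
Unset Printing Implicit Defensive.

Import Order.TTheory GRing.Theory Num.Theory.
Import numFieldNormedType.Exports.

Local Open Scope classical_set_scope.
Local Open Scope ring_scope.

(** The axioms of the noise give independence over disjoint sets, whereas the coefficients of simple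
    fields are measurable for the augmented filtration. The isometry therefore rests on the
    independence of that filtration at time [t] from the noise after [t], obtained by splitting
    overlapping sets into disjoint atoms and passing from pi-systems to sigma-algebras.

    The bound [1 + C sqrt s] comes from the a priori bound in [pam_solution], inserted once into the
    isometry: the relative variance is then at most a constant times the space-time integral of a
    squared bridge density, which is of order [sqrt s].

    The cut [N ^- 2] is the time at which the two bounds [t1 N / s] and [N ^ 2 / sqrt s] have the
    same size. On either side of it everything is [O (N)] except the integral of [t1 N / s], and it
    is the lower limit [N ^- 2] of that integral that produces the factor 2 of the limit.

    Fubini needs joint measurability in the random parameter and space-time, while adaptedness
    speaks of one space-time point at a time. Joint measurability is read off the predictability of
    the Walsh integrand. *)

(** * Square-integrable functions and L2 continuity of products *)

Section square_integrable.
Context {d} {T : measurableType d} {R : realType}.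
Variable mu : {measure set T -> \bar R}.
Implicit Types f g : T -> R.

Definition square_integrable f :=
  measurable_fun setT f /\ mu.-integrable setT (EFin \o (fun x => f x ^+ 2)).

Lemma square_integrableP f : measurable_fun setT f ->
  (\int[mu]_x (f x ^+ 2)%:E < +oo)%E -> square_integrable f.
Proof.
move=> mf foo; split => //; apply/integrableP; split.
  by apply/measurable_EFinP; exact: measurable_funX.
by under eq_integral do rewrite /= ger0_norm ?sqr_ge0//.
Qed.

Lemma Rintegral_EFin f : mu.-integrable setT (EFin \o f) ->
  (\int[mu]_x (f x)%:E)%E = (\int[mu]_x f x)%:E.
Proof. by move=> fi; rewrite fineK//; exact: integrable_fin_num. Qed.

Lemma integrableM_sqr f g : square_integrable f -> square_integrable g ->
  mu.-integrable setT (EFin \o (fun x => f x * g x)).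
Proof.
move=> [mf fi] [mg gi].
apply: (@le_integrable _ _ _ mu setT _ _
  (EFin \o (fun x => f x ^+ 2 + g x ^+ 2))) => //.
- by apply/measurable_EFinP; exact: measurable_funM.
- move=> x _ /=; rewrite lee_fin [leRHS]ger0_norm ?addr_ge0 ?sqr_ge0//.
  rewrite normrM -(real_normK (num_real (f x))) -(real_normK (num_real (g x))).
  have := sqr_ge0 (`|f x| - `|g x|); have := normr_ge0 (f x).
  by have := normr_ge0 (g x); nra.
- have := integrableD measurableT fi gi.
  by apply: eq_integrable => // x _; rewrite /= EFinD.
Qed.

Lemma square_integrableZ (k : R) f : square_integrable f ->
  square_integrable (fun x => k * f x).
Proof.
move=> [mf fi]; split; first exact: measurable_funM.
have := integrableZl measurableT (k ^+ 2) fi.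
by apply: eq_integrable => // x _; rewrite /= exprMn EFinM.
Qed.

Lemma square_integrableD f g : square_integrable f -> square_integrable g ->
  square_integrable (fun x => f x + g x).
Proof.
move=> fs gs; have fgi := integrableM_sqr fs gs.
case: fs gs => mf fi [mg gi]; split; first exact: measurable_funD.
have := integrableD measurableT (integrableD measurableT fi gi)
  (integrableZl measurableT 2 fgi).
apply: eq_integrable => // x _ /=.
by rewrite -EFinM -!EFinD; congr EFin; ring.
Qed.

Lemma square_integrableB f g : square_integrable f -> square_integrable g ->
  square_integrable (fun x => f x - g x).
Proof.
move=> fs /(square_integrableZ (-1)) gs.
have := square_integrableD fs gs; congr (square_integrable _).
by apply/funext => x; rewrite mulN1r.
Qed.

Lemma square_integrable0 : square_integrable (fun=> 0).
Proof.
split; first exact: measurable_cst.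
have := integrable0 mu setT.
by apply: eq_integrable => // x _; rewrite /= expr0n.
Qed.

Lemma square_integrable_sum I (s : seq I) (F : I -> T -> R) :
  (forall i, square_integrable (F i)) ->
  square_integrable (fun x => \sum_(i <- s) F i x).
Proof.
move=> Fs; elim: s => [|i s IH].
  by under eq_fun do rewrite big_nil; exact: square_integrable0.
by under eq_fun do rewrite big_cons; exact: square_integrableD.
Qed.

Lemma eq_square_integrable f g : f =1 g -> square_integrable f ->
  square_integrable g.
Proof. by move=> /funext ->. Qed.

(* Discriminant of the quadratic [l |-> \int (f - l g)^2]. *)
Lemma Rintegral_cauchy_schwarz f g :
  square_integrable f -> square_integrable g ->
  (\int[mu]_x (f x * g x)) ^+ 2 <=
  (\int[mu]_x (f x ^+ 2)) * (\int[mu]_x (g x ^+ 2)).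
Proof.
move=> fs gs; have fgi := integrableM_sqr fs gs.
have [_ fi] := fs; have [_ gi] := gs.
set A := \int[mu]_x (f x ^+ 2); set B := \int[mu]_x (g x ^+ 2).
set C := \int[mu]_x (f x * g x).
have A0 : 0 <= A by apply: Rintegral_ge0 => x _; exact: sqr_ge0.
have B0 : 0 <= B by apply: Rintegral_ge0 => x _; exact: sqr_ge0.
have H l : 0 <= A - 2 * l * C + l ^+ 2 * B.
  have -> : A - 2 * l * C + l ^+ 2 * B = \int[mu]_x (f x - l * g x) ^+ 2.
    have ->: (fun x => (f x - l * g x) ^+ 2) =
      (fun x => (f x ^+ 2 - (2 * l) * (f x * g x)) + l ^+ 2 * g x ^+ 2).
      by apply/funext => x; ring.
    have i1 : mu.-integrable setT
        (EFin \o (fun x => 2 * l * (f x * g x))).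
      have := integrableZl measurableT (2 * l) fgi.
      by apply: eq_integrable => // x _; rewrite /= -EFinM.
    have i2 : mu.-integrable setT (EFin \o (fun x => l ^+ 2 * g x ^+ 2)).
      have := integrableZl measurableT (l ^+ 2) gi.
      by apply: eq_integrable => // x _; rewrite /= -EFinM.
    rewrite RintegralD//; last first.
      have := integrableB measurableT fi i1.
      by apply: eq_integrable => // x _; rewrite /= EFinB.
    by rewrite RintegralB// !RintegralZl.
  by apply: Rintegral_ge0 => x _; exact: sqr_ge0.
have [B_eq0|B_neq0] := eqVneq B 0.
  rewrite B_eq0 in H *; have [->|C_neq0] := eqVneq C 0.
    by rewrite expr0n/= mulr0.
  (* For [B = 0] the quadratic is affine in [l]; this [l] gives it the value [-1]. *)
  have := H ((A + 1) / (2 * C)).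
  rewrite mulr0 addr0 (_ : 2 * _ * C = A + 1); last first.
    by field; rewrite C_neq0.
  by lra.
have B_gt0 : 0 < B by rewrite lt_neqAle eq_sym B_neq0.
have := H (C / B).
rewrite (_ : _ + _ = (A * B - C ^+ 2) / B); last by field.
by rewrite pmulr_lge0 ?invr_gt0// subr_ge0.
Qed.

Lemma Rintegral_cauchy_schwarz_sqrt f g :
  square_integrable f -> square_integrable g ->
  `|\int[mu]_x (f x * g x)| <=
  Num.sqrt (\int[mu]_x (f x ^+ 2)) * Num.sqrt (\int[mu]_x (g x ^+ 2)).
Proof.
move=> fs gs; have h := Rintegral_cauchy_schwarz fs gs.
rewrite -sqrtr_sqr -sqrtrM ?ler_sqrt//.
  apply: mulr_ge0; apply: Rintegral_ge0 => x _; exact: sqr_ge0.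
by apply: Rintegral_ge0 => x _; exact: sqr_ge0.
Qed.

Lemma cvg_Rintegral_sqr (F : nat -> T -> R) f g :
  (forall n, square_integrable (F n)) -> square_integrable f ->
  square_integrable g ->
  (\int[mu]_x (F n x - f x) ^+ 2) @[n --> \oo] --> 0 ->
  (\int[mu]_x (F n x * g x)) @[n --> \oo] --> \int[mu]_x (f x * g x).
Proof.
move=> Fs fs gs Ff.
have Fr : (Num.sqrt (\int[mu]_x (F n x - f x) ^+ 2) *
   Num.sqrt (\int[mu]_x (g x ^+ 2))) @[n --> \oo] --> 0.
  rewrite -[X in _ --> X](mul0r (Num.sqrt (\int[mu]_x (g x ^+ 2)))).
  apply: cvgMr_tmp; rewrite -[X in _ --> X]sqrtr0.
  by apply: continuous_cvg => //; exact: sqrt_continuous.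
apply/subr_cvg0; apply/norm_cvg0P.
apply: squeeze_cvgr (cvg_cst 0) Fr; near=> n; rewrite normr_ge0/=.
rewrite -RintegralB//; last 2 first.
- exact: integrableM_sqr.
- exact: integrableM_sqr.
rewrite (_ : \int[mu]_x _ = \int[mu]_x ((F n x - f x) * g x)).
  by apply: Rintegral_cauchy_schwarz_sqrt => //; exact: square_integrableB.
by apply: eq_Rintegral => x _; rewrite mulrBl.
Unshelve. all: end_near. Qed.

Lemma cvg_Rintegral_sqr2 (F G : nat -> T -> R) f g :
  (forall n, square_integrable (F n)) -> square_integrable f ->
  (forall n, square_integrable (G n)) -> square_integrable g ->
  (\int[mu]_x (F n x - f x) ^+ 2) @[n --> \oo] --> 0 ->
  (\int[mu]_x (G n x - g x) ^+ 2) @[n --> \oo] --> 0 ->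
  (\int[mu]_x (F n x * G n x)) @[n --> \oo] --> \int[mu]_x (f x * g x).
Proof.
move=> Fs fs Gs gs Ff Gg.
have sqrt0 (H : nat -> R) : H n @[n --> \oo] --> 0 ->
    Num.sqrt (H n) @[n --> \oo] --> 0.
  rewrite -[X in _ -> _ --> X]sqrtr0 => h.
  by apply: continuous_cvg => //; exact: sqrt_continuous.
(* Two terms are linear in one sequence, and the remaining product of differences is small by
   Cauchy-Schwarz. *)
have e : (fun n => \int[mu]_x (F n x * G n x)) =
    (fun n => \int[mu]_x (F n x * g x) + (\int[mu]_x (G n x * f x) -
      \int[mu]_x (g x * f x)) + \int[mu]_x ((F n x - f x) * (G n x - g x))).
  apply/funext => n; rewrite -RintegralB//; last 2 first.
  - exact: integrableM_sqr.
  - exact: integrableM_sqr.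
  have i1 : mu.-integrable setT (EFin \o (fun x => F n x * g x)).
    exact: integrableM_sqr.
  have i2 : mu.-integrable setT (EFin \o (fun x => G n x * f x - g x * f x)).
    have := integrableM_sqr (square_integrableB (Gs n) gs) fs.
    by apply: eq_integrable => // x _ /=; rewrite mulrBl.
  have i3 : mu.-integrable setT (EFin \o (fun x => (F n x - f x) * (G n x - g x))).
    by apply: integrableM_sqr; exact: square_integrableB.
  rewrite -RintegralD// -RintegralD//.
    by apply: eq_Rintegral => x _; ring.
  have := integrableD measurableT i1 i2.
  by apply: eq_integrable => // x _; rewrite /= EFinD.
rewrite e -[X in _ --> X]addr0; apply: cvgD.
  rewrite -[X in _ --> X]addr0; apply: cvgD; first exact: cvg_Rintegral_sqr.
  by apply/subr_cvg0; exact: cvg_Rintegral_sqr.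
apply/norm_cvg0P.
have h : Num.sqrt (\int[mu]_x (F n x - f x) ^+ 2) *
  Num.sqrt (\int[mu]_x (G n x - g x) ^+ 2) @[n --> \oo] --> 0.
  by rewrite -[X in _ --> X](mulr0 0); apply: cvgM; exact: sqrt0.
apply: squeeze_cvgr (cvg_cst 0) h; near=> n; rewrite normr_ge0/=.
by apply: Rintegral_cauchy_schwarz_sqrt; exact: square_integrableB.
Unshelve. all: end_near. Qed.

End square_integrable.

(** * Independence and products of expectations *)

Section independence.
Context {d} {T : measurableType d} {R : realType}.
Variable P : probability T R.

(** The restriction of [P] to [F] and the multiple of [P] by [P F] are finite measures that agree on
    the pi-system [G], hence on the sigma-algebra it generates. *)
Lemma sigma_algebra_indep_event (G : set (set T)) (F : set T) :
  G `<=` measurable -> G setT -> setI_closed G -> measurable F ->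
  (forall E, G E -> P (E `&` F) = (P E * P F)%E) ->
  forall E, <<s G >> E -> P (E `&` F) = (P E * P F)%E.
Proof.
move=> Gm GT GI mF GF E sE.
have PF0 : 0 <= fine (P F) by rewrite fine_ge0.
have PFE : P F = (fine (P F))%:E by rewrite fineK// fin_num_measure.
pose m1 := mrestr P mF; pose m2 := mscale (NngNum PF0) P.
have m2E A : m2 A = (P A * P F)%E by rewrite /m2 /mscale/= -PFE muleC.
rewrite -m2E -/(m1 E).
apply: (@g_sigma_algebra_measure_unique _ _ _ G Gm (fun=> setT) (fun=> GT) _ m1 m2 GI _ _ E sE).
- by rewrite bigcup_const.
- by move=> A GA; apply: etrans (GF _ GA) _; exact/esym/m2E.
- move=> _; rewrite -ge0_fin_numE ?measure_ge0//.
  by rewrite /= /m1 /mrestr/= fin_num_measure//; exact: measurableI.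
Qed.

(** Independence makes the joint law the product of the two laws; integrability and factorisation
    are then Fubini for [z.1 * z.2] on the plane. *)
Lemma Rintegral_mul_indep (X Y : {RV P >-> R}) :
  P.-integrable setT (EFin \o X) -> P.-integrable setT (EFin \o Y) ->
  (forall A B, measurable A -> measurable B ->
    P (X @^-1` A `&` Y @^-1` B) = (P (X @^-1` A) * P (Y @^-1` B))%E) ->
  P.-integrable setT (EFin \o (fun w => X w * Y w)) /\
  \int[P]_w (X w * Y w) = (\int[P]_w X w) * (\int[P]_w Y w).
Proof.
move=> Xi Yi XY.
have mXY : measurable_fun setT (fun w => (X w, Y w)).
  exact: measurable_fun_pair.
pose mu := distribution P X; pose nu := distribution P Y.
pose XY' : {mfun T >-> (R * R)%type} := mfun_Sub (mem_set mXY).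
have joint A : measurable A -> (mu \x nu)%E A = distribution P XY' A.
  by move=> mA; apply: product_measure_unique => //= B C mB mC; exact: XY.
have mm : measurable_fun setT (fun z : R * R => (z.1 * z.2)%:E).
  by apply/measurable_EFinP; apply: measurable_funM.
have mE : measurable_fun setT (@EFin R) by exact: EFin_measurable.
have mabs : measurable_fun setT (fun x : R => `|x|%:E).
  by apply/measurable_EFinP; exact: normr_measurable.
have ab1 : (\int[mu]_x `|x|%:E = \int[P]_w `|X w|%:E)%E.
  by rewrite ge0_integral_distribution.
have ab2 : (\int[nu]_x `|x|%:E = \int[P]_w `|Y w|%:E)%E.
  by rewrite ge0_integral_distribution.
have [/integrableP[_ Xoo] /integrableP[_ Yoo]] := (Xi, Yi).
have fini : (mu \x nu)%E.-integrable setT (fun z : R * R => (z.1 * z.2)%:E).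
  apply/integrable12ltyP => //=.
  under eq_integral => x _.
    under eq_integral => y _ do rewrite normrM EFinM.
    rewrite ge0_integralZl//.
    rewrite ab2; over.
  rewrite ge0_integralZr//; last by apply: integral_ge0.
  rewrite ab1 lte_mul_pinfty//; first by apply: integral_ge0.
  by rewrite ge0_fin_numE//; apply: integral_ge0.
have jointi (f : R * R -> \bar R) :
    (\int[mu \x nu]_z f z = \int[distribution P XY']_z f z)%E.
  by apply: eq_measure_integral => A mA _; exact: joint.
have XYi : P.-integrable setT (EFin \o (fun w => X w * Y w)).
  apply/integrableP; split.
    by apply/measurable_EFinP; exact: measurable_funM.
  move/integrableP : fini => [_]; rewrite jointi.
  by rewrite ge0_integral_distribution//; exact: measurableT_comp.
split => //; rewrite /Rintegral.
have -> : (\int[P]_w (X w * Y w)%:E = \int[mu \x nu]_z (z.1 * z.2)%:E)%E.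
  by rewrite jointi integral_pushforward.
rewrite -integral12_prod_meas1//=.
have nui : nu.-integrable setT (EFin \o id).
  exact: integrable_pushforward.
have mui : mu.-integrable setT (EFin \o id).
  exact: integrable_pushforward.
have e2 : (\int[nu]_x x%:E = \int[P]_w (Y w)%:E)%E.
  by rewrite integral_pushforward.
have e1 : (\int[mu]_x x%:E = \int[P]_w (X w)%:E)%E.
  by rewrite integral_pushforward.
rewrite /fubini_F/=; under eq_integral => x _.
  under eq_integral => y _ do rewrite EFinM.
  rewrite integralZl// e2; over.
rewrite -(fineK (integrable_fin_num measurableT Yi)).
rewrite integralZr// e1 fineM//; exact: integrable_fin_num.
Qed.

End independence.

(** * Symmetries of Lebesgue measure and the Gaussian density *)

Section lebesgue_symmetries.
Context {R : realType}.
Local Notation mu := (@lebesgue_measure R).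

Lemma lebesgue_measure_shift (a : R) (A : set R) : measurable A ->
  pushforward mu ((fun x => x + a) : _ -> measurableTypeR R) A = mu A.
Proof.
move=> mA; apply/esym/lebesgue_measure_unique => //=.
  exact: measurable_funD.
move=> _ _ [[b c]] _ <-.
rewrite /pushforward/=.
have -> : (fun x => x + a) @^-1` `]b, c] = `]b - a, c - a]%classic.
  apply/seteqP; split => x /=; rewrite !in_itv/= => /andP[h1 h2].
    by rewrite ltrBlDr lerBrDr h1 h2.
  by rewrite -ltrBlDr -lerBrDr h1 h2.
rewrite !lebesgue_measure_itv/= !lte_fin ltrD2r.
by case: ifP => // _; rewrite -!EFinD; congr EFin; ring.
Qed.

Lemma ge0_integral_shift (f : R -> \bar R) (a : R) :
  measurable_fun [set: R] f -> (forall x, 0 <= f x)%E ->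
  (\int[mu]_x f (x + a)%R = \int[mu]_x f x)%E.
Proof.
move=> mf f0; pose g : R -> measurableTypeR R := fun x => x + a.
have mg : measurable_fun setT g by exact: measurable_funD.
transitivity (\int[pushforward mu g]_x f x)%E.
  by rewrite ge0_integral_pushforward.
by apply: eq_measure_integral => //= A mA _; exact: lebesgue_measure_shift.
Qed.

Lemma ge0_integralN (f : R -> \bar R) :
  measurable_fun [set: R] f -> (forall x, 0 <= f x)%E ->
  (\int[mu]_x f (- x)%R = \int[mu]_x f x)%E.
Proof.
move=> mf f0; pose g : R -> measurableTypeR R := -%R.
have mg : measurable_fun setT g by exact: oppr_measurable.
transitivity (\int[pushforward mu g]_x f x)%E.
  by rewrite ge0_integral_pushforward.
by apply: eq_measure_integral => //= A mA _; exact: lebesgue_measureN.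
Qed.

(** The Radon-Nikodym derivative of [normal_prob] equals [normal_pdf] almost everywhere, because the
    two have the same integral over every measurable set. *)
Lemma ge0_integral_normal_prob (m s : R) (f : R -> \bar R) :
  measurable_fun [set: R] f -> (forall x, 0 <= f x)%E ->
  (\int[normal_prob m s]_x f x = \int[mu]_x (f x * (normal_pdf m s x)%:E))%E.
Proof.
move=> mf f0; have dom := normal_prob_dominates m s.
rewrite -(Radon_Nikodym_SigmaFinite.change_of_variables dom)//=.
have fi := Radon_Nikodym_SigmaFinite.f_integrable dom.
apply: ae_eq_integral => //.
- by apply: emeasurable_funM => //; exact: measurable_int fi.
- apply: emeasurable_funM => //; apply/measurable_EFinP.
  exact: measurable_normal_pdf.
apply: ae_eqe_mul2l => /=; apply: integral_ae_eq => //=.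
- by apply/measurable_EFinP; exact: measurable_normal_pdf.
- by move=> E _ mE; rewrite -Radon_Nikodym_SigmaFinite.f_integral.
Qed.

End lebesgue_symmetries.

Lemma integral_if {d} {T : measurableType d} {R : realType}
    (mu : {measure set T -> \bar R}) (b : T -> bool) (f : T -> \bar R) :
  (\int[mu]_x (if b x then f x else 0) = \int[mu]_(x in [set x | b x]) f x)%E.
Proof.
rewrite [RHS]integral_mkcond; apply: eq_integral => x _.
by rewrite patchE mem_setE.
Qed.

Section measurable_inverse.
Context {d} {T : measurableType d} {R : realType}.

(* [x^-1 = x * exp (- ln (x ^ 2))] also at [0], where both sides are [0]. *)
Lemma measurable_funV_real (f : T -> R) : measurable_fun setT f ->
  measurable_fun setT (fun x => (f x)^-1).
Proof.
move=> mf; have -> : (fun x => (f x)^-1) =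
    (fun x => f x * expR (- ln (f x ^+ 2))).
  apply/funext => x; have [->|fx0] := eqVneq (f x) 0; first by rewrite invr0 mul0r.
  rewrite expRN lnK ?posrE ?exprn_even_gt0//.
  by field.
apply: measurable_funM => //; apply: measurableT_comp => //.
apply: measurableT_comp => //; apply: measurableT_comp; first exact: measurable_ln.
exact: measurable_funX.
Qed.

Lemma measurable_fun_sqrt (f : T -> R) : measurable_fun setT f ->
  measurable_fun setT (fun x => Num.sqrt (f x)).
Proof.
move=> mf; apply: measurableT_comp => //.
by apply: continuous_measurable_fun; exact: sqrt_continuous.
Qed.

End measurable_inverse.

(** * The heat kernel: derivative, mass and moments *)

Section heat_kernel_theory.
Context {R : realType}.
Local Notation mu := (@lebesgue_measure R).
Implicit Types v x : R.

Lemma heat_kernel_gt0 v x : 0 < v -> 0 < heat_kernel v x.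
Proof.
move=> v0; rewrite /heat_kernel mulr_gt0 ?expR_gt0//.
by rewrite invr_gt0 sqrtr_gt0 !mulr_gt0// pi_gt0.
Qed.

Lemma heat_kernel_ge0 v x : 0 <= heat_kernel v x.
Proof. by rewrite /heat_kernel mulr_ge0 ?expR_ge0// invr_ge0. Qed.

Lemma heat_kernelN v x : heat_kernel v (- x) = heat_kernel v x.
Proof. by rewrite /heat_kernel sqrrN. Qed.

Lemma heat_kernel_ub v x : 0 <= v -> heat_kernel v x <= (Num.sqrt (2 * pi * v))^-1.
Proof.
move=> v0; rewrite /heat_kernel ler_piMr ?invr_ge0//.
rewrite -[leRHS]expR0 ler_expR mulNr oppr_le0 divr_ge0 ?sqr_ge0//.
by rewrite mulr_ge0.
Qed.

Lemma heat_kernel_normal_pdf v m x : 0 < v ->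
  normal_pdf m (Num.sqrt v) x = heat_kernel v (m - x).
Proof.
move=> v0; rewrite normal_pdfE ?gt_eqF ?sqrtr_gt0//.
rewrite /normal_peak /normal_fun /heat_kernel sqr_sqrtr ?ltW//.
by congr ((Num.sqrt _)^-1 * expR _); [rewrite -mulr_natl; ring|
  rewrite -mulr_natl -(sqrrN (x - m)) opprB].
Qed.

Lemma measurable_heat_kernel v : measurable_fun setT (heat_kernel v).
Proof.
apply: measurable_funM => //; apply: measurableT_comp => //.
by apply: measurable_funM => //; apply: measurableT_comp => //; apply: measurable_funX.
Qed.

Lemma measurable_heat_kernel2 {d} {T : measurableType d} (f g : T -> R) :
  measurable_fun setT f -> measurable_fun setT g ->
  measurable_fun setT (fun w => heat_kernel (f w) (g w)).
Proof.
move=> mf mg; apply: measurable_funM; last first.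
  apply: measurableT_comp => //; apply: measurable_funM.
    by apply: measurableT_comp => //; exact: measurable_funX.
  by apply: measurable_funV_real; exact: measurable_funM.
apply: measurable_funV_real; apply: measurable_fun_sqrt.
exact: measurable_funM.
Qed.

Lemma integral_heat_kernel v x : 0 < v ->
  (\int[mu]_y (heat_kernel v (x - y))%:E = 1)%E.
Proof.
move=> v0; rewrite -(integral_normal_pdf x (Num.sqrt v)).
by apply: eq_integral => y _; rewrite heat_kernel_normal_pdf.
Qed.

Lemma integral_heat_kernel0 v : 0 < v -> (\int[mu]_y (heat_kernel v y)%:E = 1)%E.
Proof.
move=> v0; rewrite -(integral_heat_kernel 0 v0).
by apply: eq_integral => y _; rewrite sub0r heat_kernelN.
Qed.

Lemma is_derive_heat_kernel v x : 0 < v ->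
  is_derive x 1 (heat_kernel v) (- (x / v) * heat_kernel v x).
Proof.
move=> v0; set c := (Num.sqrt (2 * pi * v))^-1.
have -> : heat_kernel v = c \*: (expR \o ((- (2 * v)^-1) \*: (id ^+ 2))).
  apply/funext => y; rewrite /heat_kernel /= !fctE /GRing.scale/=.
  by congr (_ * expR _); rewrite mulrC mulNr mulrN.
apply: is_derive_eq; rewrite /GRing.scale/= !fctE /GRing.scale/=.
by field; lra.
Qed.

Lemma continuous_heat_kernel v : 0 < v -> continuous (heat_kernel v).
Proof.
move=> v0 x; apply/differentiable_continuous/derivable1_diffP.
by case: (is_derive_heat_kernel x v0).
Qed.

Lemma cvg_heat_kernel v : 0 < v -> heat_kernel v x @[x --> +oo] --> (0 : R).
Proof.
move=> v0; rewrite -(mulr0 (Num.sqrt (2 * pi * v))^-1).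
have s0 : 0 < (Num.sqrt (2 * v))^-1 by rewrite invr_gt0 sqrtr_gt0; lra.
have -> : heat_kernel v = fun x => (Num.sqrt (2 * pi * v))^-1 *
    gauss_fun (x * (Num.sqrt (2 * v))^-1).
  apply/funext => x; rewrite /heat_kernel /gauss_fun exprMn exprVn sqr_sqrtr.
    by rewrite mulNr.
  by lra.
apply: cvgMl_tmp; apply: cvg_comp (@cvg_gauss_fun R).
by apply: gt0_cvgMly => //; exact: cvg_id.
Qed.

(** The derivative of the kernel is [- (u / v)] times the kernel, so the integrand has a primitive
    that vanishes at infinity. *)
Lemma heat_kernel_tail v x : 0 < v -> 0 <= x ->
  (\int[mu]_(u in `[x, +oo[) (u / v * heat_kernel v u)%:E =
   (heat_kernel v x)%:E)%E.
Proof.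
move=> v0 x0.
have cM : continuous (fun u : R => u / v * heat_kernel v u).
  move=> u; apply: cvgM; last exact: continuous_heat_kernel.
  by apply: cvgMr_tmp; exact: cvg_id.
rewrite (@ge0_continuous_FTC2y _ _ (fun u => - heat_kernel v u) x 0).
- by rewrite sub0e EFinN oppeK.
- move=> u xu; rewrite mulr_ge0 ?heat_kernel_ge0// divr_ge0//; last exact: ltW.
  exact: le_trans xu.
- exact: continuous_subspaceT.
- by rewrite -oppr0; apply: cvgN; exact: cvg_heat_kernel.
- by move=> u _; have := is_derive_heat_kernel u v0; case => ? _; apply: derivableN.
- by apply: cvg_at_right_filter; apply: cvgN; exact: continuous_heat_kernel.
- move=> u _; rewrite derive1E; apply: derive_val.
  have := is_derive_heat_kernel u v0 => h.
  by apply: (is_derive_eq (is_deriveN h)); rewrite mulNr opprK.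
Qed.

(** Integration by parts in the guise of Tonelli: [y / v * heat_kernel v y] is integrated over the
    region [0 <= x <= y]. Integrating in [y] first gives half the mass of the kernel by
    [heat_kernel_tail]; integrating in [x] first gives half the second moment divided by [v]. *)
Lemma integral_sqr_heat_kernel v : 0 < v ->
  (\int[mu]_y (y ^+ 2 * heat_kernel v y)%:E = v%:E)%E.
Proof.
move=> v0.
have half (f : R -> R) : (forall x, 0 <= f x) -> continuous f ->
    (forall x, f (- x) = f x) ->
    (\int[mu]_x (f x)%:E = 2%:E * \int[mu]_(x in `[0%R, +oo[) (f x)%:E)%E.
  move=> f0 cf fN; rewrite ge0_symfun_integralT//; last first.
    by move=> x; rewrite /= fN.
  by congr (_ * integral _ _ _)%E; rewrite set_itvcy.
have ch := continuous_heat_kernel v0.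
have := integral_heat_kernel0 v0.
rewrite half; [|exact: heat_kernel_ge0|by []|exact: heat_kernelN].
rewrite half; last 3 first.
- by move=> x; rewrite mulr_ge0 ?sqr_ge0 ?heat_kernel_ge0.
- by move=> x; apply: cvgM; [exact: exprn_continuous|exact: ch].
- by move=> x; rewrite sqrrN heat_kernelN.
pose F (z : R * R) : \bar R := if (0 <= z.1) && (z.1 <= z.2) then
  (z.2 / v * heat_kernel v z.2)%:E else 0%E.
have F0 z : (0 <= F z)%E.
  rewrite /F; case: ifPn => // /andP[z0 zz]; rewrite lee_fin mulr_ge0//.
    by rewrite divr_ge0//; [exact: le_trans zz|exact: ltW].
  exact: heat_kernel_ge0.
have mF : measurable_fun setT F.
  apply: measurable_fun_ifT => //.
    apply: measurable_and; apply: measurable_fun_ler => //.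
  apply/measurable_EFinP; apply: measurable_funM; first exact: measurable_funM.
  by apply: measurableT_comp => //; exact: measurable_heat_kernel.
have Fx x : 0 <= x -> (\int[mu]_y F (x, y) = (heat_kernel v x)%:E)%E.
  move=> x0; rewrite -heat_kernel_tail// /F/= x0/= integral_if.
  by congr integral; rewrite set_itvcy.
have Fx0 x : ~~ (0 <= x) -> (\int[mu]_y F (x, y) = 0)%E.
  by move=> x0; rewrite /F/= (negbTE x0)/= integral0.
have Fy y : 0 <= y ->
    (\int[mu]_x F (x, y) = (v^-1 * (y ^+ 2 * heat_kernel v y))%:E)%E.
  move=> y0; rewrite /F/= integral_if/=.
  have -> : [set x | 0 <= x <= y] = `[0, y]%classic.
    by apply/seteqP; split => x /=; rewrite in_itv.
  rewrite integral_cst//=.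
  rewrite lebesgue_measure_itv/= lte_fin; case: ltP => y1.
    by rewrite oppr0 adde0 -EFinM; congr EFin; field; lra.
  have -> : y = 0 by lra.
  by rewrite mule0 expr0n/= mul0r mulr0.
have Fy0 y : ~~ (0 <= y) -> (\int[mu]_x F (x, y) = 0)%E.
  move=> y0; rewrite /F/=; apply: integral0_eq => x _; case: ifPn => // /andP[x0 xy].
  by rewrite (le_trans x0 xy) in y0.
have := @fubini_tonelli _ _ _ _ _ mu mu F mF F0.
have -> : (\int[mu]_x \int[mu]_y F (x, y) = \int[mu]_(x in `[0%R, +oo[) (heat_kernel v x)%:E)%E.
  rewrite [RHS]integral_mkcond; apply: eq_integral => x _.
  rewrite patchE set_itvcy mem_setE; case: ifPn => x0; first exact: Fx.
  exact: Fx0.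
have -> : (\int[mu]_y \int[mu]_x F (x, y) =
    (v^-1)%:E * \int[mu]_(y in `[0%R, +oo[) (y ^+ 2 * heat_kernel v y)%:E)%E.
  rewrite -ge0_integralZl//; last 3 first.
  - apply/measurable_EFinP/measurable_funTS; apply: measurable_funM => //.
    exact: measurable_heat_kernel.
  - by move=> y _; rewrite lee_fin mulr_ge0 ?sqr_ge0 ?heat_kernel_ge0.
  - by rewrite lee_fin invr_ge0 ltW.
  rewrite [RHS]integral_mkcond; apply: eq_integral => y _.
  rewrite patchE set_itvcy mem_setE; case: ifPn => y0; first exact: Fy.
  exact: Fy0.
move=> ->; rewrite muleCA => h.
move: h; set X := (2%:E * _)%E => h.
have := congr1 (fun z => v%:E * z)%E h.
by rewrite mule1 muleA -EFinM divff ?gt_eqF// mul1e => ->.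
Qed.

(** Integrate [|y| <= s / 2 + y ^ 2 / (2 s)] with [s = sqrt v], the choice for which both terms
    contribute [s / 2]. *)
Lemma integral_normr_heat_kernel v : 0 < v ->
  (\int[mu]_y (`|y| * heat_kernel v y)%:E <= (Num.sqrt v)%:E)%E.
Proof.
move=> v0; set s := Num.sqrt v; have s0 : 0 < s by rewrite sqrtr_gt0.
have sv : s ^+ 2 = v by rewrite sqr_sqrtr// ltW.
apply: (@le_trans _ _ (\int[mu]_y
    ((s / 2) * heat_kernel v y + (2 * s)^-1 * (y ^+ 2 * heat_kernel v y))%:E)%E).
  apply: ge0_le_integral => //.
  - by move=> y _; rewrite lee_fin mulr_ge0 ?heat_kernel_ge0.
  - apply/measurable_EFinP; apply: measurable_funM; last exact: measurable_heat_kernel.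
    exact: normr_measurable.
  - apply/measurable_EFinP; apply: measurable_funD; apply: measurable_funM => //.
      exact: measurable_heat_kernel.
    by apply: measurable_funM => //; exact: measurable_heat_kernel.
  - move=> y _; rewrite lee_fin [(2 * s)^-1 * _]mulrA -mulrDl ler_wpM2r ?heat_kernel_ge0//.
    rewrite -(real_normK (num_real y)).
    have -> : s / 2 + (2 * s)^-1 * `|y| ^+ 2 =
        `|y| + (2 * s)^-1 * (s - `|y|) ^+ 2 by field; lra.
    by rewrite lerDl mulr_ge0 ?sqr_ge0// invr_ge0; lra.
have f20 y : 0 <= y ^+ 2 * heat_kernel v y.
  by rewrite mulr_ge0 ?heat_kernel_ge0 ?sqr_ge0.
have s20 : 0 <= (2 * s)^-1 by rewrite invr_ge0; lra.
have m1 : measurable_fun setT (fun y : R => (heat_kernel v y)%:E).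
  by apply/measurable_EFinP; exact: measurable_heat_kernel.
have m2 : measurable_fun setT (fun y : R => (y ^+ 2 * heat_kernel v y)%:E).
  apply/measurable_EFinP; apply: measurable_funM => //.
  exact: measurable_heat_kernel.
under eq_integral do rewrite EFinD (EFinM (s / 2)) (EFinM (2 * s)^-1).
rewrite ge0_integralD//; last 4 first.
- by move=> y _; rewrite mule_ge0// lee_fin ?heat_kernel_ge0//; lra.
- exact: measurable_funeM.
- by move=> y _; rewrite mule_ge0// lee_fin.
- exact: measurable_funeM.
rewrite ge0_integralZl//; last 2 first.
- by move=> y _; rewrite lee_fin heat_kernel_ge0.
- by rewrite lee_fin; lra.
rewrite ge0_integralZl//; last by move=> y _; rewrite lee_fin.
rewrite integral_heat_kernel0// integral_sqr_heat_kernel// mule1 -EFinM -EFinD.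
by rewrite lee_fin -sv le_eqVlt; apply/orP; left; apply/eqP; field; lra.
Qed.

End heat_kernel_theory.

(** * Square-integrable random variables and Gaussian moments *)

Section probability_square_integrable.
Context {d} {T : measurableType d} {R : realType}.
Variable P : probability T R.

Lemma square_integrable_cst (k : R) : square_integrable P (cst k).
Proof.
apply: square_integrableP => //.
by have := integral_cst P measurableT (k ^+ 2)%:E => /= ->;
  rewrite probability_setT mule1 ltry.
Qed.

Lemma square_integrable_integrable (X : T -> R) :
  square_integrable P X -> P.-integrable setT (EFin \o X).
Proof.
move=> Xs; have := integrableM_sqr Xs (square_integrable_cst 1).
by apply: eq_integrable => // w _; rewrite /= mulr1.
Qed.

Lemma square_integrable_bounded (X : T -> R) (M : R) :
  measurable_fun setT X -> (forall w, `|X w| <= M) -> square_integrable P X.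
Proof.
move=> mX XM; apply: square_integrableP => //.
apply: (@le_lt_trans _ _ (\int[P]_w (M ^+ 2)%:E)%E).
  apply: ge0_le_integral => //.
  - by move=> w _; rewrite lee_fin sqr_ge0.
  - by apply/measurable_EFinP; exact: measurable_funX.
  - by move=> w _; rewrite lee_fin -real_normK ?num_real// lerXn2r ?nnegrE//
      (le_trans (normr_ge0 _) (XM w)).
by have := integral_cst P measurableT (M ^+ 2)%:E => /= ->;
  rewrite probability_setT mule1 ltry.
Qed.

Lemma square_integrable_bounded_mul (X Y : T -> R) (M : R) :
  measurable_fun setT X -> (forall w, `|X w| <= M) -> square_integrable P Y ->
  square_integrable P (fun w => X w * Y w).
Proof.
move=> mX XM [mY Yi]; split; first exact: measurable_funM.
have := integrableZl measurableT (M ^+ 2) Yi.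
apply: le_integrable => //.
  by apply/measurable_EFinP; apply: measurable_funX; exact: measurable_funM.
move=> w _; rewrite /= lee_fin (ger0_norm (sqr_ge0 _)).
rewrite (ger0_norm (mulr_ge0 (sqr_ge0 _) (sqr_ge0 _))) exprMn.
rewrite ler_wpM2r ?sqr_ge0// -real_normK ?num_real// lerXn2r ?nnegrE//.
by rewrite (le_trans (normr_ge0 _) (XM w)).
Qed.

Lemma ge0_integral_centered_gaussian (X : {RV P >-> R}) (v : R)
    (f : R -> \bar R) : 0 < v ->
  (forall B, measurable B -> distribution P X B = centered_gaussian v B) ->
  measurable_fun [set: R] f -> (forall x, 0 <= f x)%E ->
  (\int[P]_w f (X w) =
   \int[@lebesgue_measure R]_x (f x * (heat_kernel v x)%:E))%E.
Proof.
move=> v0 dX mf f0.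
pose X' : T -> measurableTypeR R := X.
have mX : measurable_fun setT X'.
  have mX0 : measurable_fun setT X by [].
  exact: mX0.
transitivity (\int[pushforward P X']_x f x)%E.
  by rewrite ge0_integral_pushforward.
transitivity (\int[normal_prob 0 (Num.sqrt v)]_x f x)%E.
  apply: eq_measure_integral => A mA _.
  by apply: etrans (dX A mA) _; rewrite /centered_gaussian gt_eqF.
rewrite ge0_integral_normal_prob//; apply: eq_integral => x _.
by rewrite heat_kernel_normal_pdf// sub0r heat_kernelN.
Qed.

Lemma centered_gaussian0 (X : {RV P >-> R}) (f : R -> \bar R) :
  (forall B, measurable B -> distribution P X B = centered_gaussian 0 B) ->
  measurable_fun [set: R] f -> (forall x, 0 <= f x)%E ->
  (\int[P]_w f (X w) = f 0%R)%E.
Proof.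
move=> dX mf f0.
transitivity (\int[distribution P X]_x f x)%E.
  by rewrite ge0_integral_distribution.
transitivity (\int[\d_(0%R : R)]_x f x)%E.
  apply: eq_measure_integral => A mA _.
  by apply: etrans (dX A mA) _; rewrite /centered_gaussian eqxx.
by rewrite integral_dirac// diracT mul1e.
Qed.

Lemma centered_gaussian_moments (X : {RV P >-> R}) (v : R) : 0 <= v ->
  (forall B, measurable B -> distribution P X B = centered_gaussian v B) ->
  [/\ square_integrable P X, \int[P]_w X w = 0 &
      \int[P]_w (X w ^+ 2) = v].
Proof.
move=> v0 dX.
have m2 : measurable_fun [set: R] (fun x : R => (x ^+ 2)%:E).
  by apply/measurable_EFinP; exact: measurable_funX.
have p2 (x : R) : (0 <= (x ^+ 2)%:E)%E by rewrite lee_fin sqr_ge0.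
have mp : measurable_fun [set: R] (fun x : R => (Num.max x 0)%:E).
  by apply/measurable_EFinP; exact: measurable_maxr.
have mn : measurable_fun [set: R] (fun x : R => (Num.max (- x) 0)%:E).
  by apply/measurable_EFinP; exact: measurable_maxr.
have pp (x : R) : (0 <= (Num.max x 0)%:E)%E by rewrite lee_fin le_max lexx orbT.
have pn (x : R) : (0 <= (Num.max (- x) 0)%:E)%E.
  by rewrite lee_fin le_max lexx orbT.
have E2 : (\int[P]_w (X w ^+ 2)%:E = v%:E)%E.
  have [v_eq0|v_neq0] := eqVneq v 0.
    by rewrite v_eq0 in dX *; rewrite (centered_gaussian0 dX m2 p2) expr0n.
  have vgt0 : 0 < v by rewrite lt_neqAle eq_sym v_neq0.
  rewrite (ge0_integral_centered_gaussian vgt0 dX m2 p2).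
  by rewrite -[RHS]integral_sqr_heat_kernel.
(* The law is symmetric, so the positive and negative parts have the same integral and the mean is
   their difference. The Dirac mass is treated apart, since it has no density. *)
have E1 : (\int[P]_w (Num.max (X w) 0)%:E = \int[P]_w (Num.max (- X w) 0)%:E)%E.
  have [v_eq0|v_neq0] := eqVneq v 0.
    rewrite v_eq0 in dX *; rewrite (centered_gaussian0 dX mp pp).
    by rewrite (centered_gaussian0 dX mn pn) oppr0.
  have vgt0 : 0 < v by rewrite lt_neqAle eq_sym v_neq0.
  rewrite (ge0_integral_centered_gaussian vgt0 dX mp pp).
  rewrite (ge0_integral_centered_gaussian vgt0 dX mn pn).
  rewrite -[LHS]ge0_integralN; last 2 first.
  - apply: emeasurable_funM => //; apply/measurable_EFinP.
    exact: measurable_heat_kernel.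
  - by move=> x; rewrite mule_ge0// lee_fin heat_kernel_ge0.
  by apply: eq_integral => x _; rewrite heat_kernelN.
have Xs : square_integrable P X.
  by apply: square_integrableP => //; rewrite E2 ltry.
split => //; last by rewrite /Rintegral E2.
have Xi := square_integrable_integrable Xs.
rewrite /Rintegral integralE.
have -> : (\int[P]_x ((fun w => (X w)%:E)^\+)%E x = \int[P]_w (Num.max (X w) 0)%:E)%E.
  by apply: eq_integral => w _; rewrite funeposE EFin_max.
have -> : (\int[P]_x ((fun w => (X w)%:E)^\-)%E x = \int[P]_w (Num.max (- X w) 0)%:E)%E.
  by apply: eq_integral => w _; rewrite funenegE EFin_max.
rewrite E1 subee//.
have := integrable_fin_num measurableT (integrable_funeneg measurableT Xi).
congr (is_true (_ \is a fin_num)).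
by apply: eq_integral => w _; rewrite funenegE EFin_max.
Qed.

End probability_square_integrable.

(** * Lebesgue measure on the space-time plane *)

Section plane_measure.
Context {R : realType}.
Local Notation mu := (@lebesgue_measure R).

Let plane_sigma_finite : sigma_finite setT (mu \x mu)%E.
Proof.
have /sigma_finiteP[F [FT ndF Foo]] := sigma_finiteT mu.
exists (fun n => F n `*` F n).
  rewrite -setXTT FT predeqE => -[x y]; split.
    move=> [/= [n _ Fnx] [k _ Gky]]; exists (maxn n k) => //; split.
    - by move: x Fnx; exact/subsetPset/ndF/leq_maxl.
    - by move: y Gky; exact/subsetPset/ndF/leq_maxr.
  by move=> [n _ []/= ? ?]; split; exists n.
move=> k; have [mF Fk] := Foo k.
split; first exact: measurableX.
by rewrite product_measure1E// lte_mul_pinfty// ge0_fin_numE.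
Qed.

(** Bundling sigma-finiteness with the product measure lets Fubini treat the whole plane as a single
    factor. *)
Definition plane_measure :
    {sigma_finite_measure set (measurableTypeR R * measurableTypeR R)%type -> \bar R} :=
  HB.pack (mu \x mu)%E
    (Measure_isSigmaFinite.Build _ _ _ (mu \x mu)%E plane_sigma_finite).

Lemma spacetime_measure_plane (A : set (R * R)) :
  spacetime_measure A = plane_measure A.
Proof. by []. Qed.

End plane_measure.

(** * Events up to null sets *)

Section ae_events.
Context {d} {T : measurableType d} {R : realType}.
Variable P : probability T R.

Lemma measure_ae_eq (E F : set T) : measurable E -> measurable F ->
  {ae P, forall w, E w <-> F w} -> P E = P F.
Proof.
move=> mE mF EF.
rewrite -[E]setIT -[F]setIT -!integral_indic//.
apply: ge0_ae_eq_integral => //.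
- by apply/measurable_EFinP; exact: measurable_indic.
- by apply/measurable_EFinP; exact: measurable_indic.
apply: filterS EF => w EFw _; rewrite !indicE; congr (_%:R%:E).
by congr nat_of_bool; apply/idP/idP; rewrite !inE => /EFw.
Qed.

Lemma ae_forall_finType (I : finType) (Q : I -> T -> Prop) :
  (forall i, {ae P, forall w, Q i w}) -> {ae P, forall w, forall i, Q i w}.
Proof.
move=> QP.
have : {ae P, forall w, forall n, forall i, enum_rank i = n :> nat -> Q i w}.
  apply: ae_foralln => n.
  have [nI|nI] := ltnP n #|I|.
    apply: filterS (QP (enum_val (Ordinal nI))) => w Qw i ri.
    by rewrite -(enum_rankK i); move: Qw; congr (Q (enum_val _) w);
      apply: val_inj.
  apply: aeW => w i ri; have := ltn_ord (enum_rank i).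
  by rewrite ri ltnNge nI.
by apply: filterS => w h i; exact: (h (enum_rank i)).
Qed.

Lemma ae_symdiff0 (E F : set T) : measurable E -> measurable F ->
  P (E `+` F) = 0%E -> {ae P, forall w, E w <-> F w}.
Proof.
move=> mE mF EF0; exists (E `+` F); split => //.
  by apply: measurableU; exact: measurableD.
move=> w; rewrite /setY/= /setD/= => h.
have [Ew|nEw] := pselect (E w); have [Fw|nFw] := pselect (F w); tauto.
Qed.

Lemma symdiff0_ae (E F : set T) : measurable E -> measurable F ->
  {ae P, forall w, E w <-> F w} -> P (E `+` F) = 0%E.
Proof.
move=> mE mF EF; rewrite -[RHS](measure0 P); apply: measure_ae_eq => //.
  by apply: measurableU; exact: measurableD.
by apply: filterS EF => w h /=; rewrite /setY/= /setD/=; tauto.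
Qed.

End ae_events.

(** * White noise on finite disjoint families *)

Section white_noise_independence.
Context {R : realType} {d : measure_display} {T : measurableType d}.
Variable P : probability T R.
Variable eta : set (R * R) -> {RV P >-> R}.
Hypothesis heta : white_noise eta.

Lemma noise_moments (A : set (R * R)) : noise_set A ->
  [/\ square_integrable P (eta A), \int[P]_w eta A w = 0 &
      \int[P]_w (eta A w ^+ 2) = fine (spacetime_measure A)].
Proof.
case: heta => gauss _ _ nA.
apply: centered_gaussian_moments; last by move=> B; exact: gauss.
by rewrite fine_ge0// spacetime_measure_plane.
Qed.

Lemma noise_set0 : noise_set (@set0 (R * R)).
Proof. by split => //; rewrite spacetime_measure_plane measure0. Qed.

Lemma noise_setS (A B : set (R * R)) : measurable A -> A `<=` B ->
  noise_set B -> noise_set A.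
Proof.
move=> mA AB [mB B0 Boo]; split => //; first exact: subset_trans B0.
apply: le_lt_trans Boo; rewrite !spacetime_measure_plane.
by apply: le_measure => //; rewrite inE.
Qed.

Lemma noise_setU (A B : set (R * R)) : noise_set A -> noise_set B ->
  noise_set (A `|` B).
Proof.
move=> [mA A0 Aoo] [mB B0 Boo]; split.
- exact: measurableU.
- by move=> z [/A0|/B0].
- rewrite spacetime_measure_plane.
  apply: (@le_lt_trans _ _ (plane_measure A + plane_measure B)%E).
    exact: measureU2.
  exact: lte_add_pinfty.
Qed.

Lemma noise_product_rule (I : finType) (A : I -> set (R * R)) (B : I -> set R) :
  (forall i, noise_set (A i)) -> (forall i j, i != j -> A i `&` A j = set0) ->
  (forall i, measurable (B i)) ->
  P [set w | forall i, B i (eta (A i) w)] =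
  (\prod_(i : I) P [set w | B i (eta (A i) w)])%E.
Proof.
case: heta => _ rule _ nA dA mB.
have tA : trivIset setT (A \o (@enum_val I predT)).
  apply/trivIsetP => i j _ _ ij; apply: dA.
  by apply: contra ij => /eqP/enum_val_inj ->.
have := rule #|I| _ (fun i => nA _) tA (B \o enum_val) (fun i => mB _).
rewrite (reindex (@enum_val I predT))/=; last first.
  by apply: onW_bij; exact: enum_val_bij.
move=> <-; congr (P _); apply/seteqP; split => w /= h i //.
by have := h (enum_rank i); rewrite enum_rankK.
Qed.

(** The empty set is disjoint from itself, so additivity reads [x = x + x] almost surely. *)
Lemma noise_set0_ae : {ae P, forall w, eta set0 w = 0}.
Proof.
case: heta => _ _ /(_ set0 set0 noise_set0 noise_set0).
rewrite setI0 setU0 => /(_ erefl); apply: filterS => w.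
by move/eqP; rewrite -[X in X == _]addr0 (inj_eq (addrI _)) => /eqP.
Qed.

Lemma noise_bigsetU (I : eqType) (s : seq I) (A : I -> set (R * R)) :
  uniq s -> (forall i, noise_set (A i)) ->
  (forall i j, i != j -> A i `&` A j = set0) ->
  noise_set (\big[setU/set0]_(i <- s) A i) /\
  {ae P, forall w, eta (\big[setU/set0]_(i <- s) A i) w =
    \sum_(i <- s) eta (A i) w}.
Proof.
move=> + nA dA; elim: s => [_|i s IH /= /andP[iNs us]].
  split; first by rewrite big_nil; exact: noise_set0.
  by apply: filterS noise_set0_ae => w; rewrite !big_nil.
have [ns aes] := IH us; split; first by rewrite big_cons; exact: noise_setU.
case: heta => _ _ /(_ (A i) _ (nA i) ns) add.
have : {ae P, forall w, eta (A i `|` \big[setU/set0]_(j <- s) A j) w =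
    eta (A i) w + eta (\big[setU/set0]_(j <- s) A j) w}.
  apply: add; rewrite big_distrr/= big_seq big1// => j js.
  by apply: dA; apply: contraNneq iNs => ->.
apply: filterS2 aes => w h1 h2; rewrite !big_cons.
by rewrite h2 h1.
Qed.

End white_noise_independence.

(** * Independence of the future noise from the past filtration *)

Section filtration_independence.
Context {R : realType} {d : measure_display} {T : measurableType d}.
Variable P : probability T R.
Variable eta : set (R * R) -> {RV P >-> R}.
Hypothesis heta : white_noise eta.

Section atoms.
Variables (I : finType) (A : I -> set (R * R)).
Hypothesis nA : forall i, noise_set (A i).

(** The product rule concerns disjoint sets, so the possibly overlapping [A i] are refined into
    atoms: the points with a given membership pattern. The region outside every [A i] is not a
    [noise_set]; the condition on [s] replaces its atom by the empty set. *)
Let code z : {set I} := [set i | `[< A i z >]]%SET.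

Let atom (s : {set I}) : set (R * R) := [set z | code z = s /\ s != finset.set0].

Let code_in i z : (i \in code z) = `[< A i z >].
Proof. by rewrite inE. Qed.

Let atom_disjoint s s' : s != s' -> atom s `&` atom s' = set0.
Proof.
move=> /eqP ss'; rewrite -subset0 => z [[e1 _] [e2 _]].
by apply: ss'; rewrite -e1 -e2.
Qed.

Let atom_sub s z : atom s z -> exists i, A i z.
Proof.
by move=> [<-] /set0Pn[i]; rewrite code_in => /asboolP; exists i.
Qed.

Let measurable_atom s : measurable (atom s).
Proof.
have [->|s0] := eqVneq s finset.set0.
  by rewrite (_ : atom _ = set0) // -subset0 => z [_]; rewrite eqxx.
have -> : atom s = \bigcap_(i in [set: I])
    (if i \in s then A i else ~` A i).
  apply/seteqP; split => [z [<- _] i _|z h].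
    by rewrite code_in; case: asboolP.
  split => //; apply/setP => i; rewrite code_in; apply/asboolP.
  by have := h i Logic.I; case: (i \in s).
apply: fin_bigcap_measurable => // i _.
by have [mA _ _] := nA i; case: (i \in s) => //; exact: measurableC.
Qed.

Let noise_atom s : noise_set (atom s).
Proof.
have [->|/set0Pn[i si]] := eqVneq s finset.set0.
  rewrite (_ : atom _ = set0); first exact: noise_set0.
  by rewrite -subset0 => z [_]; rewrite eqxx.
apply: noise_setS (nA i) => // z [zs _].
by move: si; rewrite -zs code_in => /asboolP.
Qed.

Let atom_cover i : A i = \big[setU/set0]_(s <- enum [set s : {set I} | i \in s]%SET) atom s.
Proof.
rewrite -bigcup_seq; apply/seteqP; split => [z Aiz|z [s /=]].
  have iz : i \in code z by rewrite code_in; apply/asboolP.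
  exists (code z) => /=; first by rewrite mem_enum inE.
  by split => //; apply/set0Pn; exists i.
by rewrite mem_enum inE => si [zs _]; move: si; rewrite -zs code_in => /asboolP.
Qed.

Let noise_atom_sum : {ae P, forall w, forall i,
  eta (A i) w = \sum_(s <- enum [set s : {set I} | i \in s]%SET) eta (atom s) w}.
Proof.
apply: ae_forall_finType => i.
have [_] := noise_bigsetU heta (enum_uniq [set s : {set I} | i \in s]%SET)
  noise_atom atom_disjoint.
by rewrite -atom_cover.
Qed.

Variable D : set (R * R).
Hypothesis nD : noise_set D.
Hypothesis AD : forall i, A i `&` D = set0.

Let cylinder := [set E : set T | exists B : {set I} -> set R,
  (forall s, measurable (B s)) /\
  E = [set w | forall s, B s (eta (atom s) w)]].

Let measurable_cylinder : cylinder `<=` measurable.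
Proof.
move=> _ [B [mB ->]].
have -> : [set w | forall s, B s (eta (atom s) w)] =
    \bigcap_(s in [set: {set I}]) (eta (atom s) @^-1` B s).
  by apply/seteqP; split => w h s; [move=> _; exact: h|exact: (h s Logic.I)].
apply: fin_bigcap_measurable => // s _.
by rewrite -[X in measurable X]setTI; exact: measurable_funP.
Qed.

(** [D] is disjoint from every atom, so it joins the family as the extra index [None]. Imposing
    [setT] at that index recovers the law of the atoms alone. *)
Let atom_product (B : {set I} -> set R) (C : set R) :
  (forall s, measurable (B s)) -> measurable C ->
  P ([set w | forall s, B s (eta (atom s) w)] `&` eta D @^-1` C) =
  (P [set w | forall s, B s (eta (atom s) w)] * P (eta D @^-1` C))%E.
Proof.
move=> mB mC.
pose A' (o : option {set I}) := if o is Some s then atom s else D.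
pose B' C' (o : option {set I}) := if o is Some s then B s else C'.
have nA' o : noise_set (A' o) by case: o.
have dA' o o' : o != o' -> A' o `&` A' o' = set0.
  case: o o' => [s|] [s'|] //= ss'.
  - exact: atom_disjoint.
  - rewrite -subset0 => z [/atom_sub[i Aiz] Dz].
    by rewrite -(AD i); split.
  - rewrite -subset0 => z [Dz /atom_sub[i Aiz]].
    by rewrite -(AD i); split.
have mB' C' : measurable C' -> forall o, measurable (B' C' o) by move=> ? [].
rewrite (_ : _ `&` _ = [set w | forall o, B' C o (eta (A' o) w)]); last first.
  apply/seteqP; split => w /= => [[h1 h2] [s|]|h] //.
  by split => [s|]; [exact: (h (Some s))|exact: (h None)].
rewrite (noise_product_rule heta nA' dA' (mB' _ mC)).
rewrite (_ : [set w | forall s, B s (eta (atom s) w)] =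
    [set w | forall o, B' setT o (eta (A' o) w)]); last first.
  apply/seteqP; split => w /= => [h1 [s|]|h s] //.
  exact: (h (Some s)).
rewrite (noise_product_rule heta nA' dA' (mB' _ measurableT)).
rewrite (bigD1 None)//= [X in _ = (X * _)%E](bigD1 None)//=.
have -> : P [set w | setT (eta D w)] = 1%E by rewrite -(probability_setT P).
rewrite mul1e muleC; congr (_ * _)%E.
by apply: eq_bigr; case.
Qed.

(** Almost surely each [eta (A i)] is the sum of the noises of the atoms inside [A i]. The event
    thus agrees, up to a null set, with one in the sigma-algebra of the atom cylinders, a pi-system
    on which [atom_product] gives independence. *)
Lemma noise_indep_finite (B : I -> set R) (C : set R) :
  (forall i, measurable (B i)) -> measurable C ->
  P ([set w | forall i, B i (eta (A i) w)] `&` eta D @^-1` C) =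
  (P [set w | forall i, B i (eta (A i) w)] * P (eta D @^-1` C))%E.
Proof.
move=> mB mC.
have mEC : measurable (eta D @^-1` C).
  by rewrite -[X in measurable X]setTI; exact: measurable_funP.
pose S i w := \sum_(s <- enum [set s : {set I} | i \in s]%SET) eta (atom s) w.
pose E := [set w | forall i, B i (S i w)].
have atom_meas s : measurable_fun setT
    (eta (atom s) : g_sigma_algebraType cylinder -> R).
  move=> _ Y mY; rewrite setTI; apply: sub_sigma_algebra.
  exists (fun s' => if s' == s then Y else setT); split.
    by move=> s'; case: ifP.
  apply/seteqP; split => w /= => [h s'|/(_ s)]; last by rewrite eqxx.
  by case: eqP => // ->.
have S_meas i : measurable_fun setT (S i : g_sigma_algebraType cylinder -> R).
  exact: measurable_sum.
have sE : <<s cylinder >> E.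
  have -> : E = \bigcap_(i in [set: I]) (S i @^-1` B i).
    by apply/seteqP; split => w h s; [move=> _; exact: h|exact: (h s Logic.I)].
  have := @fin_bigcap_measurable _ (g_sigma_algebraType cylinder) I setT
    (fun i => S i @^-1` B i); apply => // i _.
  by have := S_meas i measurableT (B i) (mB i); rewrite setTI.
have mE : measurable E.
  exact: (smallest_sub (@sigma_algebra_measurable _ T) measurable_cylinder).
have mE' : measurable [set w | forall i, B i (eta (A i) w)].
  have -> : [set w | forall i, B i (eta (A i) w)] =
      \bigcap_(s in [set: I]) (eta (A s) @^-1` B s).
    by apply/seteqP; split => w h s; [move=> _; exact: h|exact: (h s Logic.I)].
  apply: fin_bigcap_measurable => // s _.
  by rewrite -[X in measurable X]setTI; exact: measurable_funP.
have EE' : {ae P, forall w, [set w | forall i, B i (eta (A i) w)] w <-> E w}.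
  by apply: filterS noise_atom_sum => w h; split => /= h' i;
    have := h' i; rewrite /S h.
rewrite (measure_ae_eq mE' mE EE').
rewrite (@measure_ae_eq _ _ _ P _ (E `&` eta D @^-1` C)); last 3 first.
- exact: measurableI.
- exact: measurableI.
- by apply: filterS EE' => w h; split => -[/h].
apply: (sigma_algebra_indep_event measurable_cylinder) => //.
- by exists (fun=> setT); split => //; apply/seteqP; split.
- move=> _ _ [B1 [mB1 ->]] [B2 [mB2 ->]].
  exists (fun s => B1 s `&` B2 s); split => [s|]; first exact: measurableI.
  by apply/seteqP; split => w /= => [[h1 h2] s|h]; split => // s; case: (h s).
- by move=> _ [B1 [mB1 ->]]; exact: atom_product.
Qed.

End atoms.

Section filtration.
Variables (t : R) (D : set (R * R)) (C : set R).
Hypotheses (nD : noise_set D) (Dt : D `<=` [set z | t < z.1]).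
Hypothesis mC : measurable C.

Let mDC : measurable (eta D @^-1` C).
Proof. by rewrite -[X in measurable X]setTI; exact: measurable_funP. Qed.

Lemma noise_sigma_measurable : noise_sigma eta t `<=` measurable.
Proof.
apply: smallest_sub; first exact: sigma_algebra_measurable.
move=> _ [A [B [nA _ mB ->]]].
by rewrite -[X in measurable X]setTI; exact: measurable_funP.
Qed.

(** The events about finitely many past noise variables form a generating pi-system [G]. Arbitrary
    finite index types make this immediate: a sum type gives intersections and [void] gives the
    whole space. *)
Lemma noise_sigma_indep (E : set T) : noise_sigma eta t E ->
  P (E `&` eta D @^-1` C) = (P E * P (eta D @^-1` C))%E.
Proof.
pose G := [set E : set T | exists (I : finType) (A : I -> set (R * R))
  (B : I -> set R), [/\ forall i, noise_set (A i),
    forall i, A i `<=` [set z | z.1 <= t], forall i, measurable (B i) &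
    E = [set w | forall i, B i (eta (A i) w)]]].
have Gm : G `<=` measurable.
  move=> _ [I [A [B [nA At mB ->]]]].
  have -> : [set w | forall i, B i (eta (A i) w)] =
      \bigcap_(s in [set: I]) (eta (A s) @^-1` B s).
    by apply/seteqP; split => w h s; [move=> _; exact: h|exact: (h s Logic.I)].
  apply: fin_bigcap_measurable => // s _.
  by rewrite -[X in measurable X]setTI; exact: measurable_funP.
move=> sE; apply: (sigma_algebra_indep_event Gm) => //.
- exists void, (fun=> set0), (fun=> set0); split; try by case.
  by apply/seteqP; split => // w _ [].
- move=> _ _ [I1 [A1 [B1 [nA1 At1 mB1 ->]]]] [I2 [A2 [B2 [nA2 At2 mB2 ->]]]].
  exists (I1 + I2)%type, (fun i => match i with inl i => A1 i | inr i => A2 i end),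
    (fun i => match i with inl i => B1 i | inr i => B2 i end).
  split; try by case.
  apply/seteqP; split => w /= => [[h1 h2] [i|i]|h]; [exact: h1|exact: h2|].
  by split => i; [exact: (h (inl i))|exact: (h (inr i))].
- move=> _ [I [A [B [nA At mB ->]]]]; apply: noise_indep_finite => // i.
  rewrite -subset0 => z [/(At i)/= zt /Dt/=]; by rewrite ltNge zt.
- move: E sE; apply: smallest_sub; first exact: smallest_sigma_algebra.
  move=> _ [A [B [nA At mB ->]]].
  apply: sub_sigma_algebra; exists unit, (fun=> A), (fun=> B); split => //.
  by apply/seteqP; split => w /= => [h _|/(_ tt)].
Qed.

Lemma noise_filtration_indep (E : set T) : noise_filtration eta t E ->
  P (E `&` eta D @^-1` C) = (P E * P (eta D @^-1` C))%E.
Proof.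
move=> [mE [F sF EF]]; have mF := noise_sigma_measurable sF.
have EF' := ae_symdiff0 mE mF EF.
rewrite (measure_ae_eq mE mF EF') -noise_sigma_indep//.
apply: measure_ae_eq; [exact: measurableI|exact: measurableI|].
by apply: filterS EF' => w h; split => -[/h].
Qed.

Lemma noise_filtration_setI : setI_closed (noise_filtration eta t).
Proof.
move=> E1 E2 [mE1 [F1 sF1 EF1]] [mE2 [F2 sF2 EF2]].
have mF1 := noise_sigma_measurable sF1; have mF2 := noise_sigma_measurable sF2.
split; first exact: measurableI.
exists (F1 `&` F2).
  have := @measurableI _ (g_sigma_algebraType [set E | exists A : set (R * R),
    exists B : set R, [/\ noise_set A, A `<=` [set z | z.1 <= t], measurable B &
            E = eta A @^-1` B]]) F1 F2; exact.
apply: symdiff0_ae; [exact: measurableI|exact: measurableI|].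
have := ae_symdiff0 mE1 mF1 EF1; have := ae_symdiff0 mE2 mF2 EF2.
by apply: filterS2 => w h1 h2; split => -[/h2 ? /h1 ?].
Qed.

Lemma noise_filtration_setT : noise_filtration eta t setT.
Proof.
split => //; exists setT; last by rewrite setYK measure0.
by have := @measurableT _ (g_sigma_algebraType [set E | exists A : set (R * R),
    exists B : set R, [/\ noise_set A, A `<=` [set z | z.1 <= t], measurable B &
            E = eta A @^-1` B]]).
Qed.

(** The augmented events contain the whole space and are closed under intersection, so they are
    themselves a pi-system from which independence extends. *)
Lemma sigma_noise_filtration_indep (E : set T) :
  <<s noise_filtration eta t >> E ->
  P (E `&` eta D @^-1` C) = (P E * P (eta D @^-1` C))%E.
Proof.
apply: sigma_algebra_indep_event => //.
- by move=> ? [].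
- exact: noise_filtration_setT.
- exact: noise_filtration_setI.
- exact: noise_filtration_indep.
Qed.

End filtration.

End filtration_independence.

(** * Adapted variables against future noise *)

Section adapted.
Context {R : realType} {d : measure_display} {T : measurableType d}.
Variable P : probability T R.
Variable eta : set (R * R) -> {RV P >-> R}.
Hypothesis heta : white_noise eta.

(** Stating this over a generated sigma-algebra makes the closure properties of measurable functions
    available for adapted variables. *)
Definition adapted (t : R) (X : T -> R) := measurable_fun setT
  (X : g_sigma_algebraType (noise_filtration eta t) -> R).

Lemma noise_measurable_adapted t X : noise_measurable eta t X -> adapted t X.
Proof.
by move=> mX _ B mB; rewrite setTI; apply: sub_sigma_algebra; exact: mX.
Qed.

Lemma adapted_measurable t X : adapted t X -> measurable_fun setT X.
Proof.
move=> aX _ B mB; rewrite setTI.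
have := aX measurableT B mB; rewrite setTI.
apply: smallest_sub; first exact: sigma_algebra_measurable.
by move=> E [].
Qed.

Lemma noise_filtrationS s t : s <= t ->
  noise_filtration eta s `<=` noise_filtration eta t.
Proof.
move=> st E [mE [F sF EF]]; split => //; exists F => //.
move: F sF {EF}; apply: sub_sigma_algebra2 => _ [A [B [nA As mB ->]]].
by exists A, B; split => // z /As/= zs; exact: le_trans st.
Qed.

Lemma adaptedS s t X : s <= t -> adapted s X -> adapted t X.
Proof.
move=> st aX _ B mB; rewrite setTI.
have := aX measurableT B mB; rewrite setTI.
by apply: sub_sigma_algebra2; exact: noise_filtrationS.
Qed.

Lemma adaptedM t X Y : adapted t X -> adapted t Y ->
  adapted t (fun w => X w * Y w).
Proof. exact: measurable_funM. Qed.

Lemma adapted_noise t D : noise_set D -> D `<=` [set z | z.1 <= t] ->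
  adapted t (eta D).
Proof.
move=> nD Dt; apply: noise_measurable_adapted => B mB.
split; first by rewrite -[X in measurable X]setTI; exact: measurable_funP.
exists (eta D @^-1` B); last by rewrite setYK measure0.
by apply: sub_sigma_algebra; exists D, B.
Qed.

(** [g] will be the identity, for means, and the square, for variances. *)
Lemma adapted_mul_indep t (X : T -> R) D (g : R -> R) :
  adapted t X -> P.-integrable setT (EFin \o X) ->
  noise_set D -> D `<=` [set z | t < z.1] -> measurable_fun setT g ->
  P.-integrable setT (EFin \o (fun w => g (eta D w))) ->
  P.-integrable setT (EFin \o (fun w => X w * g (eta D w))) /\
  \int[P]_w (X w * g (eta D w)) = (\int[P]_w X w) * (\int[P]_w g (eta D w)).
Proof.
move=> aX iX nD Dt mg ig.
have mgD : measurable_fun setT (fun w => g (eta D w)).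
  exact: measurableT_comp.
have := @Rintegral_mul_indep _ _ _ P (mfun_Sub (mem_set (adapted_measurable aX)))
  (mfun_Sub (mem_set mgD)) iX ig; apply => A B mA mB /=.
have := @sigma_noise_filtration_indep _ _ _ _ _ heta t D (g @^-1` B) nD Dt _
  (X @^-1` A); apply.
  by have := mg measurableT B mB; rewrite setTI.
by have := aX measurableT A mA; rewrite setTI.
Qed.

Lemma adapted_mul_noise t (X : T -> R) D :
  adapted t X -> P.-integrable setT (EFin \o X) ->
  noise_set D -> D `<=` [set z | t < z.1] ->
  \int[P]_w (X w * eta D w) = 0.
Proof.
move=> aX iX nD Dt; have [sD ED _] := noise_moments heta nD.
have [_ ->] := @adapted_mul_indep t X D id aX iX nD Dt (@measurable_id _ _ _)
  (square_integrable_integrable sD).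
by rewrite ED mulr0.
Qed.

Lemma adapted_mul_noise_sqr t (X : T -> R) D :
  adapted t X -> P.-integrable setT (EFin \o X) ->
  noise_set D -> D `<=` [set z | t < z.1] ->
  P.-integrable setT (EFin \o (fun w => X w * eta D w ^+ 2)) /\
  \int[P]_w (X w * eta D w ^+ 2) =
    (\int[P]_w X w) * fine (spacetime_measure D).
Proof.
move=> aX iX nD Dt; have [[_ iD] _ <-] := noise_moments heta nD.
by apply: (@adapted_mul_indep t X D (fun x => x ^+ 2) aX iX nD Dt).
Qed.

(** Polarisation reduces the product to squares of single noise variables. With the disjoint pieces
    [p], [q], [r] of [D] and [D'], and [a], [b], [c] their noises, [2 (a + b) (b + c) = (a + b + c)
    ^ 2 + b ^ 2 - a ^ 2 - c ^ 2]; in expectation only the measure of [q], the intersection,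
    survives. *)
Lemma adapted_mul_noise2 t (X : T -> R) D D' :
  adapted t X -> P.-integrable setT (EFin \o X) ->
  noise_set D -> D `<=` [set z | t < z.1] ->
  noise_set D' -> D' `<=` [set z | t < z.1] ->
  \int[P]_w (X w * (eta D w * eta D' w)) =
    (\int[P]_w X w) * fine (spacetime_measure (D `&` D')).
Proof.
move=> aX iX nD Dt nD' Dt'.
have [mD D0 Doo] := nD; have [mD' D'0 D'oo] := nD'.
pose p := D `\` D'; pose q := D `&` D'; pose r := D' `\` D.
have np : noise_set p.
  by apply: noise_setS nD; [exact: measurableD|exact: subDsetl].
have nq : noise_set q.
  by apply: noise_setS nD; [exact: measurableI|exact: subIsetl].
have nr : noise_set r.
  by apply: noise_setS nD'; [exact: measurableD|exact: subDsetl].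
have Dpq : D = p `|` q by rewrite setUC setUIDK.
have D'qr : D' = q `|` r by rewrite /q /r setIC setUIDK.
have pq0 : p `&` q = set0.
  by rewrite -subset0 => z [[_ ?] [_ ?]].
have qr0 : q `&` r = set0.
  by rewrite -subset0 => z [[? _] [_ ?]].
have pqr0 : (p `|` q) `&` r = set0.
  by rewrite -Dpq -subset0 => z [? [_ ?]].
have nU : noise_set (D `|` r) by exact: noise_setU.
have Ut : D `|` r `<=` [set z | t < z.1] by move=> z [/Dt|[/Dt']].
have pt : p `<=` [set z | t < z.1] by move=> z [/Dt].
have qt : q `<=` [set z | t < z.1] by move=> z [/Dt].
have rt : r `<=` [set z | t < z.1] by move=> z [/Dt'].
case: (heta) => _ _ add.
have e1 := add _ _ np nq pq0; have e2 := add _ _ nq nr qr0.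
have e3 := add _ _ nD nr (etrans (congr1 (setI^~ r) Dpq) pqr0).
rewrite -Dpq in e1; rewrite -D'qr in e2.
have [iU EU] := adapted_mul_noise_sqr aX iX nU Ut.
have [ip Ep] := adapted_mul_noise_sqr aX iX np pt.
have [iq Eq] := adapted_mul_noise_sqr aX iX nq qt.
have [ir Er] := adapted_mul_noise_sqr aX iX nr rt.
have iUq : P.-integrable setT
    (EFin \o (fun w => X w * eta (D `|` r) w ^+ 2 + X w * eta q w ^+ 2)).
  by have := integrableD measurableT iU iq; apply: eq_integrable.
have ipr : P.-integrable setT
    (EFin \o (fun w => X w * eta p w ^+ 2 + X w * eta r w ^+ 2)).
  by have := integrableD measurableT ip ir; apply: eq_integrable.
have iall : P.-integrable setT (EFin \o (fun w =>
    (X w * eta (D `|` r) w ^+ 2 + X w * eta q w ^+ 2) -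
    (X w * eta p w ^+ 2 + X w * eta r w ^+ 2))).
  by have := integrableB measurableT iUq ipr; apply: eq_integrable.
have mX := adapted_measurable aX.
transitivity (\int[P]_w (2^-1 * (
    (X w * eta (D `|` r) w ^+ 2 + X w * eta q w ^+ 2) -
    (X w * eta p w ^+ 2 + X w * eta r w ^+ 2)))).
  congr fine; apply: ae_eq_integral => //.
  - by apply/measurable_EFinP; apply: measurable_funM => //; exact: measurable_funM.
  - apply/measurable_EFinP; apply: measurable_funM => //; apply/measurable_EFinP.
    by case/integrableP : iall.
  move: e3; apply: filterS3 e1 e2 => w /= -> -> -> _.
  by congr EFin; field.
rewrite (RintegralZl _ measurableT iall) (RintegralB measurableT iUq ipr).
rewrite (RintegralD measurableT iU iq) (RintegralD measurableT ip ir) EU Ep Eq Er.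
have fin A : noise_set A -> plane_measure A \is a fin_num.
  by move=> [_ _ Aoo]; rewrite ge0_fin_numE.
have vD : fine (spacetime_measure D) =
    fine (spacetime_measure p) + fine (spacetime_measure q).
  rewrite -fineD ?fin// -measureU//; first by rewrite -Dpq.
    by case: np.
  by case: nq.
have vU : fine (spacetime_measure (D `|` r)) =
    fine (spacetime_measure D) + fine (spacetime_measure r).
  rewrite -fineD ?fin// -measureU//.
    by case: nr.
  by rewrite Dpq.
rewrite vU vD; move: (fine _) (fine _) (fine _) => a b c.
by move: (\int[P]_w X w) => EX; field.
Qed.

End adapted.

(** * Isometry for elementary fields *)

Section elementary_isometry.
Context {R : realType} {d : measure_display} {T : measurableType d}.
Variable P : probability T R.
Variable eta : set (R * R) -> {RV P >-> R}.
Hypothesis heta : white_noise eta.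
Implicit Types e f : elementary eta.

Lemma noise_el_support e : noise_set (el_support e).
Proof.
case: e => X a b S a0 ab mS Soo mX bX; rewrite /el_support/=; split.
- exact: measurableX.
- by move=> [s y] [/=]; rewrite in_itv/= => /andP[/ltW/(le_trans a0)].
- rewrite /spacetime_measure product_measure1E// lte_mul_pinfty//.
  have h : lebesgue_measure (`]a, b]%classic : set R) = (b - a)%:E.
    by rewrite lebesgue_measure_itv/= lte_fin ab -EFinD.
  by rewrite [X in X \is a fin_num]h.
Qed.

Lemma el_support_gt e : el_support e `<=` [set z | el_start e < z.1].
Proof. by move=> z [/=]; rewrite in_itv/= => /andP[]. Qed.

Lemma el_coef_adapted e : adapted eta (el_start e) (el_coef e).
Proof. exact: noise_measurable_adapted (@el_coef_measurable _ _ _ _ _ e). Qed.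

Lemma el_coef_square_integrable e : square_integrable P (el_coef e).
Proof.
have [M XM] := el_coef_bounded e.
apply: (square_integrable_bounded _ _ XM).
exact: adapted_measurable (@el_coef_adapted e).
Qed.

Lemma el_integral_square_integrable e :
  square_integrable P (fun w => el_coef e w * eta (el_support e) w).
Proof.
have [M XM] := el_coef_bounded e.
apply: (square_integrable_bounded_mul _ XM).
  exact: adapted_measurable (@el_coef_adapted e).
by have [] := noise_moments heta (noise_el_support e).
Qed.

Lemma el_integral_mean e :
  \int[P]_w (el_coef e w * eta (el_support e) w) = 0.
Proof.
apply: (adapted_mul_noise heta (@el_coef_adapted e)).
- exact/square_integrable_integrable/el_coef_square_integrable.
- exact: noise_el_support.
- exact: el_support_gt.
Qed.

(* The support of the field that starts first is cut at the time at which the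
   other one starts. *)
Let el_isometry_le e f : el_start e <= el_start f ->
  \int[P]_w ((el_coef e w * eta (el_support e) w) *
             (el_coef f w * eta (el_support f) w)) =
  (\int[P]_w (el_coef e w * el_coef f w)) *
    fine (spacetime_measure (el_support e `&` el_support f)).
Proof.
set t := el_start f => st.
pose A := el_support e `&` [set z | z.1 <= t].
pose B := el_support e `&` [set z | t < z.1].
have mle : measurable [set z : R * R | z.1 <= t].
  have -> : [set z : R * R | z.1 <= t] = `]-oo, t]%classic `*` setT.
    by apply/seteqP; split => z /=; rewrite in_itv/=; [|case].
  exact: measurableX.
have mgt : measurable [set z : R * R | t < z.1].
  have -> : [set z : R * R | t < z.1] = `]t, +oo[%classic `*` setT.
    by apply/seteqP; split => z /=; rewrite in_itv/= andbT; [|case].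
  exact: measurableX.
have ne := noise_el_support e; have nf := noise_el_support f.
have [me _ _] := ne.
have nA : noise_set A.
  by apply: noise_setS ne; [exact: measurableI|exact: subIsetl].
have nB : noise_set B.
  by apply: noise_setS ne; [exact: measurableI|exact: subIsetl].
have AB0 : A `&` B = set0.
  by rewrite -subset0 => z [[_ /= h1] [_ /=]]; rewrite ltNge h1.
have eAB : el_support e = A `|` B.
  apply/seteqP; split => [z ez|z [[]|[]]//].
  by case: (leP z.1 t) => zt; [left|right].
case: (heta) => _ _ /(_ _ _ nA nB AB0); rewrite -eAB => add.
have ae := adaptedS st (@el_coef_adapted e).
have af : adapted eta t (el_coef f) by exact: (@el_coef_adapted f).
have [Me eM] := el_coef_bounded e; have [Mf fM] := el_coef_bounded f.
have sA : square_integrable P (eta A) by have [] := noise_moments heta nA.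
have sB : square_integrable P (eta B) by have [] := noise_moments heta nB.
have sf : square_integrable P (eta (el_support f)).
  by have [] := noise_moments heta nf.
have me' := adapted_measurable ae; have mf' := adapted_measurable af.
have sef : square_integrable P (fun w => el_coef e w * el_coef f w).
  exact: (square_integrable_bounded_mul me' eM (el_coef_square_integrable f)).
have efM w : `|el_coef e w * el_coef f w| <= Me * Mf.
  by rewrite normrM ler_pM.
have mef : measurable_fun setT (fun w => el_coef e w * el_coef f w).
  exact: measurable_funM.
have sefA : square_integrable P (fun w => (el_coef e w * el_coef f w) * eta A w).
  exact: (square_integrable_bounded_mul mef efM sA).
have sefB : square_integrable P (fun w => (el_coef e w * el_coef f w) * eta B w).
  exact: (square_integrable_bounded_mul mef efM sB).
have i1 := integrableM_sqr sefA sf.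
have i2 : P.-integrable setT (EFin \o (fun w =>
    (el_coef e w * el_coef f w) * (eta B w * eta (el_support f) w))).
  have := integrableM_sqr sefB sf.
  by apply: eq_integrable => // w _ /=; rewrite mulrA.
transitivity (\int[P]_w (((el_coef e w * el_coef f w) * eta A w) *
    eta (el_support f) w +
    (el_coef e w * el_coef f w) * (eta B w * eta (el_support f) w))).
  congr fine; apply: ae_eq_integral => //.
  - apply/measurable_EFinP.
    by apply: measurable_funM => //; exact: measurable_funM.
  - apply/measurable_EFinP; apply: measurable_funD.
      by apply: measurable_funM => //; exact: measurable_funM.
    by apply: measurable_funM => //; exact: measurable_funM.
  - by apply: filterS add => w -> _; congr EFin; ring.
rewrite RintegralD//.
(* The early part [A] contributes nothing: both coefficients and [eta A] are known at time [t], and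
   the noise of [f] lives after [t] and has mean zero. *)
rewrite (adapted_mul_noise heta (adaptedM (adaptedM ae af) _)); last 4 first.
- by apply: adapted_noise => // z [].
- exact: square_integrable_integrable.
- exact: nf.
- exact: el_support_gt.
rewrite add0r (adapted_mul_noise2 heta (adaptedM ae af)); last 5 first.
- exact: square_integrable_integrable.
- exact: nB.
- by move=> z [].
- exact: nf.
- exact: el_support_gt.
congr (_ * fine (spacetime_measure _)); rewrite /B -setIA.
by congr (_ `&` _); rewrite setIidr//; exact: el_support_gt.
Qed.

Lemma el_isometry e f :
  \int[P]_w ((el_coef e w * eta (el_support e) w) *
             (el_coef f w * eta (el_support f) w)) =
  (\int[P]_w (el_coef e w * el_coef f w)) *
    fine (spacetime_measure (el_support e `&` el_support f)).
Proof.
have [ef|/ltW fe] := leP (el_start e) (el_start f); first exact: el_isometry_le.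
have := el_isometry_le fe; rewrite setIC.
rewrite [X in _ = X * _ -> _](_ : _ = \int[P]_w (el_coef e w * el_coef f w)).
  by move=> <-; apply: eq_Rintegral => w _; rewrite mulrC.
by apply: eq_Rintegral => w _; rewrite mulrC.
Qed.

End elementary_isometry.

(** * The Walsh isometry *)

Section walsh_isometry.
Context {R : realType} {d : measure_display} {T : measurableType d}.
Variable P : probability T R.
Local Notation PP := (P \x @plane_measure R)%E.

Lemma Rintegral_sum {d'} {T' : measurableType d'}
    (mu : {measure set T' -> \bar R}) (I : Type) (s : seq I) (F : I -> T' -> R) :
  (forall i, mu.-integrable setT (EFin \o F i)) ->
  mu.-integrable setT (EFin \o (fun x => \sum_(i <- s) F i x)) /\
  \int[mu]_x (\sum_(i <- s) F i x) = \sum_(i <- s) \int[mu]_x F i x.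
Proof.
move=> Fi; elim: s => [|i s [IHi IHs]].
  split; first by under eq_fun do rewrite big_nil; exact: integrable0.
  under eq_Rintegral do rewrite big_nil.
  by rewrite big_nil /Rintegral integral0.
split.
  under eq_fun do rewrite big_cons.
  by have := integrableD measurableT (Fi i) IHi; apply: eq_integrable.
under eq_Rintegral do rewrite big_cons.
by rewrite big_cons (RintegralD measurableT (Fi i) IHi) IHs.
Qed.

Lemma Rintegral_prod_indic (X : T -> R) (D : set (R * R)) :
  P.-integrable setT (EFin \o X) -> measurable D ->
  (plane_measure D < +oo)%E ->
  PP.-integrable setT (EFin \o (fun z => X z.1 * \1_D z.2)) /\
  \int[PP]_z (X z.1 * \1_D z.2) = (\int[P]_w X w) * fine (plane_measure D).
Proof.
move=> iX mD Doo.
have mX : measurable_fun setT X by apply/measurable_EFinP; case/integrableP : iX.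
have Dfin : plane_measure D \is a fin_num by rewrite ge0_fin_numE.
have mXD : measurable_fun setT (fun z : T * (R * R) => X z.1 * \1_D z.2).
  by apply: measurable_funM; apply: measurableT_comp.
have ED : (\int[@plane_measure R]_z (\1_D z)%:E = plane_measure D)%E.
  by rewrite integral_indic// setIT.
have iD : (@plane_measure R).-integrable setT (fun z : R * R => (\1_D z)%:E).
  apply/integrableP; split; first exact/measurable_EFinP.
  under eq_integral do rewrite /= ger0_norm//.
  by rewrite ED.
have i : PP.-integrable setT (EFin \o (fun z => X z.1 * \1_D z.2)).
  apply/integrable12ltyP; first exact/measurable_EFinP.
  under eq_integral => w _.
    under eq_integral => z _.
      rewrite /= normrM (ger0_norm (_ : 0 <= \1_D z))// EFinM; over.
    rewrite ge0_integralZl//; last exact/measurable_EFinP.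
    rewrite ED; over.
  rewrite ge0_integralZr//.
    rewrite lte_mul_pinfty//; first by apply: integral_ge0.
      exact: integrable_fin_num (integrable_norm iX).
  by apply/measurable_EFinP; exact: measurableT_comp.
split => //; rewrite /Rintegral -integral12_prod_meas1//= /fubini_F/=.
under eq_integral => w _.
  under eq_integral do rewrite EFinM.
  rewrite integralZl// ED; over.
rewrite -(fineK Dfin) integralZr// fineM//.
exact: integrable_fin_num.
Qed.

Variable eta : set (R * R) -> {RV P >-> R}.
Hypothesis heta : white_noise eta.

Lemma el_field_square_integrable (e : elementary eta) :
  square_integrable PP (fun z => el_coef e z.1 * \1_(el_support e) z.2).
Proof.
have [mD _ Doo] := noise_el_support e.
have [mX iX] := el_coef_square_integrable e; split.
  by apply: measurable_funM; apply: measurableT_comp.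
have [+ _] := Rintegral_prod_indic iX mD Doo.
apply: eq_integrable => // z _ /=.
by rewrite exprMn indicE; case: (_ \in _); rewrite /= ?expr1n ?expr0n.
Qed.

Lemma simple_field_square_integrable (phi : seq (elementary eta)) :
  square_integrable PP (simple_field phi).
Proof. by apply: square_integrable_sum => e; exact: el_field_square_integrable. Qed.

Lemma simple_integral_square_integrable (phi : seq (elementary eta)) :
  square_integrable P (simple_integral phi).
Proof. by apply: square_integrable_sum => e; exact: el_integral_square_integrable. Qed.

Lemma simple_isometry (phi psi : seq (elementary eta)) :
  \int[P]_w (simple_integral phi w * simple_integral psi w) =
  \int[PP]_z (simple_field phi z * simple_field psi z).
Proof.
rewrite /simple_integral /simple_field.
under eq_Rintegral => w _.
  rewrite big_distrlr/=; over.
under [RHS]eq_Rintegral => z _.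
  rewrite big_distrlr/=; over.
have il (e f : elementary eta) : P.-integrable setT (EFin \o (fun w =>
    (el_coef e w * eta (el_support e) w) * (el_coef f w * eta (el_support f) w))).
  by apply: integrableM_sqr; exact: el_integral_square_integrable.
have ir (e f : elementary eta) : PP.-integrable setT (EFin \o (fun z =>
    (el_coef e z.1 * \1_(el_support e) z.2) *
    (el_coef f z.1 * \1_(el_support f) z.2))).
  by apply: integrableM_sqr; exact: el_field_square_integrable.
have il' e := Rintegral_sum psi (il e); have ir' e := Rintegral_sum psi (ir e).
have [_ ->] := Rintegral_sum phi (fun e => (il' e).1).
have [_ ->] := Rintegral_sum phi (fun e => (ir' e).1).
apply: eq_bigr => e _; rewrite (il' e).2 (ir' e).2; apply: eq_bigr => f _.
rewrite el_isometry//.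
have [me _ eoo] := noise_el_support e; have [mf _ foo] := noise_el_support f.
have ief := integrableM_sqr (el_coef_square_integrable e)
  (el_coef_square_integrable f).
have mef := measurableI _ _ me mf.
have efoo : (plane_measure (el_support e `&` el_support f) < +oo)%E.
  by apply: le_lt_trans eoo; apply: le_measure; rewrite ?inE//; exact: subIsetl.
have [_ <-] := Rintegral_prod_indic ief mef efoo.
by apply: eq_Rintegral => z _; rewrite indicI/=; ring.
Qed.

Lemma simple_mean (phi : seq (elementary eta)) :
  \int[P]_w simple_integral phi w = 0.
Proof.
rewrite /simple_integral.
have il (e : elementary eta) := square_integrable_integrable
  (el_integral_square_integrable heta e).
have [_ ->] := Rintegral_sum phi il.
by rewrite big1// => e _; exact: el_integral_mean.
Qed.

Lemma predictable_measurable (Phi : T * (R * R) -> R) :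
  predictable eta Phi -> measurable_fun setT Phi.
Proof.
move=> pPhi _ B mB; rewrite setTI; have := pPhi B mB.
apply: smallest_sub; first exact: sigma_algebra_measurable.
move=> _ [A [a [b [C [a0 ab [mA _] mC ->]]]]].
by apply: measurableX => //; exact: measurableX.
Qed.

Lemma walsh_approx (Phi : T * (R * R) -> R) (I : {RV P >-> R}) :
  walsh_integral eta Phi I -> exists phi : nat -> seq (elementary eta),
    (\int[PP]_z (simple_field (phi n) z - Phi z) ^+ 2) @[n --> \oo] --> 0 /\
    (\int[P]_w (simple_integral (phi n) w - I w) ^+ 2) @[n --> \oo] --> 0.
Proof.
move=> [_ [phi [h1 h2]]]; exists phi.
by split; [exact: (fine_cvg h1)|exact: (fine_cvg h2)].
Qed.

(** Squared distances that tend to 0 are eventually finite, so [Phi] and [I] each differ from a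
    square-integrable simple object by a square-integrable function. *)
Lemma walsh_square_integrable (Phi : T * (R * R) -> R) (I : {RV P >-> R}) :
  walsh_integral eta Phi I ->
  square_integrable PP Phi /\ square_integrable P I.
Proof.
move=> [/predictable_measurable mPhi [phi [h1 h2]]]; split.
- have /fine_cvgP[+ _] := h1.
  move=> [n _ /(_ n (leqnn _))/= fn].
  have s1 := simple_field_square_integrable (phi n).
  have s2 : square_integrable PP (fun z => simple_field (phi n) z - Phi z).
    apply: square_integrableP; first by apply: measurable_funB => //; case: s1.
    by rewrite -ge0_fin_numE// integral_ge0// => z _; rewrite lee_fin sqr_ge0.
  have := square_integrableB s1 s2; apply: eq_square_integrable => z.
  by rewrite subKr.
- have /fine_cvgP[+ _] := h2.
  move=> [n _ /(_ n (leqnn _))/= fn].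
  have s1 := simple_integral_square_integrable (phi n).
  have s2 : square_integrable P (fun z => simple_integral (phi n) z - I z).
    apply: square_integrableP; first by apply: measurable_funB => //; case: s1.
    by rewrite -ge0_fin_numE// integral_ge0// => z _; rewrite lee_fin sqr_ge0.
  have := square_integrableB s1 s2; apply: eq_square_integrable => z.
  by rewrite subKr.
Qed.

(** Both sides are limits of the same numbers, because the pairing is L2-continuous in both factors
    at once. *)
Lemma walsh_isometry (Phi Psi : T * (R * R) -> R) (I J : {RV P >-> R}) :
  walsh_integral eta Phi I -> walsh_integral eta Psi J ->
  \int[P]_w (I w * J w) = \int[PP]_z (Phi z * Psi z).
Proof.
move=> WI WJ; have [sPhi sI] := walsh_square_integrable WI.
have [sPsi sJ] := walsh_square_integrable WJ.
have [phi [h1 h2]] := walsh_approx WI.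
have [psi [k1 k2]] := walsh_approx WJ.
have c1 := cvg_Rintegral_sqr2 (fun n => simple_integral_square_integrable (phi n))
  sI (fun n => simple_integral_square_integrable (psi n)) sJ h2 k2.
have c2 := cvg_Rintegral_sqr2 (fun n => simple_field_square_integrable (phi n))
  sPhi (fun n => simple_field_square_integrable (psi n)) sPsi h1 k1.
have e : (fun n => \int[P]_w (simple_integral (phi n) w * simple_integral (psi n) w)) =
    (fun n => \int[PP]_z (simple_field (phi n) z * simple_field (psi n) z)).
  by apply/funext => n; exact: simple_isometry.
by rewrite e in c1; exact: cvg_unique c1 c2.
Qed.

(** The mean is the pairing with the constant 1, which is L2-continuous and vanishes on simple
    integrals. *)
Lemma walsh_mean (Phi : T * (R * R) -> R) (I : {RV P >-> R}) :
  walsh_integral eta Phi I -> \int[P]_w I w = 0.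
Proof.
move=> WI; have [sPhi sI] := walsh_square_integrable WI.
have [phi [_ h2]] := walsh_approx WI.
have := cvg_Rintegral_sqr (fun n => simple_integral_square_integrable (phi n))
  sI (square_integrable_cst P 1) h2.
have e : (fun n => \int[P]_w (simple_integral (phi n) w * cst 1 w)) = cst 0.
  apply/funext => n; rewrite -[RHS](simple_mean (phi n)).
  by apply: eq_Rintegral => w _; rewrite mulr1.
rewrite e => h.
have -> : \int[P]_w I w = \int[P]_w (I w * cst 1 w).
  by apply: eq_Rintegral => w _; rewrite mulr1.
by apply: cvg_unique h _ => //; exact: cvg_cst.
Qed.

End walsh_isometry.

(** * Brownian bridge densities and their window integrals *)

Section bridge.
Context {R : realType}.
Local Notation mu := (@lebesgue_measure R).
Implicit Types t x s z N : R.

(* Transition density of the Brownian bridge from [(0, 0)] to [(t, x)]. *)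
Definition bridge t x s z : R := heat_kernel (s * (t - s) / t) (z - s * x / t).

Lemma bridge_var_gt0 t s : 0 < s -> s < t -> 0 < s * (t - s) / t.
Proof. by move=> s0 st; rewrite divr_gt0 ?mulr_gt0//; lra. Qed.

Lemma bridge_ge0 t x s z : 0 <= bridge t x s z.
Proof. exact: heat_kernel_ge0. Qed.

Lemma bridge_ub t x s z : 0 < s -> s < t ->
  bridge t x s z <= (Num.sqrt (2 * pi * (s * (t - s) / t)))^-1.
Proof. by move=> s0 st; apply/heat_kernel_ub/ltW/bridge_var_gt0. Qed.

(** Two ways to write the joint density, at [z] and [x], of a Brownian motion from 0 at the times
    [s] and [t]: successive increments, or the endpoint and then the bridge to it. *)
Lemma bridgeE t x s z : 0 < s -> s < t ->
  heat_kernel (t - s) (x - z) * heat_kernel s z =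
  heat_kernel t x * bridge t x s z.
Proof.
move=> s0 st; rewrite /bridge /heat_kernel.
have pi0 := pi_gt0 R; have ts : 0 < t - s by lra.
rewrite mulrACA [RHS]mulrACA -!invfM -!sqrtrM; last 2 first.
- by rewrite !mulr_ge0 ?ltW//; lra.
- by rewrite !mulr_ge0 ?ltW//; lra.
rewrite -!expRD; congr ((Num.sqrt _)^-1 * expR _).
  by field; lra.
by field; lra.
Qed.

(** Read as a function of the endpoint [x], the bridge density is a Gaussian centred at [t z / s],
    but of total mass [t / s] instead of 1. *)
Lemma bridge_scale t x s z : 0 < s -> s < t ->
  bridge t x s z = t / s * heat_kernel (t * (t - s) / s) (x - t * z / s).
Proof.
move=> s0 st; rewrite /bridge /heat_kernel [RHS]mulrA.
have pi0 := pi_gt0 R; have ts : 0 < t - s by lra.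
have e : t / s = (Num.sqrt ((s / t) ^+ 2))^-1.
  by rewrite sqrtr_sqr ger0_norm ?divr_ge0 ?invf_div//; lra.
rewrite e -invfM -sqrtrM ?sqr_ge0//.
congr ((Num.sqrt _)^-1 * expR _); field; lra.
Qed.

Lemma measurable_bridge {d} {T : measurableType d} (f g : T -> R) t s :
  measurable_fun setT f -> measurable_fun setT g ->
  measurable_fun setT (fun w => bridge t (f w) s (g w)).
Proof.
move=> mf mg; apply: measurable_heat_kernel2 => //.
apply: measurable_funB => //; apply: measurable_funM => //.
exact: measurable_funM.
Qed.

Lemma integral_bridge t x s : 0 < s -> s < t ->
  (\int[mu]_z (bridge t x s z)%:E = 1)%E.
Proof.
move=> s0 st; rewrite -[RHS](integral_heat_kernel (s * x / t) (bridge_var_gt0 s0 st)).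
by apply: eq_integral => z _; rewrite /bridge -heat_kernelN opprB.
Qed.

Lemma integral_bridge_end t s z : 0 < s -> s < t ->
  (\int[mu]_x (bridge t x s z)%:E = (t / s)%:E)%E.
Proof.
move=> s0 st; have v0 : 0 < t * (t - s) / s by rewrite divr_gt0 ?mulr_gt0//; lra.
under eq_integral do rewrite bridge_scale// EFinM.
rewrite ge0_integralZl//; last 3 first.
- apply/measurable_EFinP; apply: measurable_heat_kernel2 => //.
  exact: measurable_funB.
- by move=> x _; rewrite lee_fin heat_kernel_ge0.
- by rewrite lee_fin divr_ge0//; lra.
have := integral_heat_kernel (t * z / s) v0.
under eq_integral do rewrite -heat_kernelN opprB.
by move=> ->; rewrite mule1.
Qed.

Definition window N t s z : \bar R :=
  (\int[mu]_x if (0 <= x <= N)%R then (bridge t x s z)%:E else 0)%E.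

(** The amount by which [window] falls short of its maximal value [t / s]; the lower bound consists
    in controlling it. *)
Definition window_compl N t s z : \bar R :=
  (\int[mu]_x if ~~ (0 <= x <= N)%R then (bridge t x s z)%:E else 0)%E.

Let mI N : measurable_fun [set: R] (fun x => (0 <= x <= N)%R).
Proof. by apply: measurable_and; exact: measurable_fun_ler. Qed.

Let measurable_integrand N t s z : measurable_fun [set: R]
  (fun x => if (0 <= x <= N)%R then (bridge t x s z)%:E else 0%E).
Proof.
apply: measurable_fun_ifT; [exact: mI| |exact: measurable_cst].
by apply/measurable_EFinP; exact: measurable_bridge.
Qed.

Let measurable_integrand_compl N t s z : measurable_fun [set: R]
  (fun x => if ~~ (0 <= x <= N)%R then (bridge t x s z)%:E else 0%E).
Proof.
apply: measurable_fun_ifT; [exact: measurable_neg (mI N)| |exact: measurable_cst].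
by apply/measurable_EFinP; exact: measurable_bridge.
Qed.

Lemma window_ge0 N t s z : (0 <= window N t s z)%E.
Proof.
by apply: integral_ge0 => x _; case: ifP => // _; rewrite lee_fin bridge_ge0.
Qed.

Lemma window_compl_ge0 N t s z : (0 <= window_compl N t s z)%E.
Proof.
by apply: integral_ge0 => x _; case: ifP => // _; rewrite lee_fin bridge_ge0.
Qed.

Lemma window_split N t s z : 0 < s -> s < t ->
  (window N t s z + window_compl N t s z = (t / s)%:E)%E.
Proof.
move=> s0 st; rewrite -(integral_bridge_end z s0 st) -ge0_integralD//.
- by apply: eq_integral => x _; case: ifP => _ /=; rewrite ?adde0 ?add0e.
- by move=> x _; case: ifP => // _; rewrite lee_fin bridge_ge0.
- exact: measurable_integrand.
- by move=> x _; case: ifP => // _; rewrite lee_fin bridge_ge0.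
- exact: measurable_integrand_compl.
Qed.

Lemma window_le N t s z : 0 < s -> s < t -> (window N t s z <= (t / s)%:E)%E.
Proof.
move=> s0 st; rewrite -(window_split N z s0 st).
by rewrite leeDl// window_compl_ge0.
Qed.

Lemma window_le_length N t s z : 0 <= N -> 0 < s -> s < t ->
  (window N t s z <=
    (N * (Num.sqrt (2 * pi * (s * (t - s) / t)))^-1)%:E)%E.
Proof.
move=> N0 s0 st; set c := (Num.sqrt _)^-1.
rewrite /window integral_if -set_itvcc.
apply: (@le_trans _ _ (\int[mu]_(x in `[0%R, N]) c%:E)%E).
  apply: ge0_le_integral => //.
  - by move=> x _; rewrite lee_fin bridge_ge0.
  - by apply/measurable_EFinP/measurable_funTS; exact: measurable_bridge.
  - by move=> x _; rewrite lee_fin bridge_ub.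
rewrite integral_cst//= lebesgue_measure_itv/= lte_fin; case: ifP => N1.
  by rewrite oppr0 adde0 -EFinM mulrC.
by rewrite mule0 lee_fin mulr_ge0// invr_ge0.
Qed.

Lemma measurable_window {d} {T : measurableType d} N t (f g : T -> R) :
  measurable_fun setT f -> measurable_fun setT g ->
  measurable_fun setT (fun w => window N t (f w) (g w)).
Proof.
move=> mf mg.
pose F (p : (R * R) * R) : \bar R :=
  if (0 <= p.2 <= N)%R then (bridge t p.2 p.1.1 p.1.2)%:E else 0%E.
have F0 p : (0 <= F p)%E.
  by rewrite /F; case: ifP => // _; rewrite lee_fin bridge_ge0.
have mF : measurable_fun setT F.
  apply: measurable_fun_ifT => //; first exact: (measurableT_comp (mI N)).
  apply/measurable_EFinP; apply: measurable_heat_kernel2.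
    apply: measurable_funM => //; apply: measurable_funM.
      exact: measurableT_comp.
    by apply: measurable_funB => //; exact: measurableT_comp.
  apply: measurable_funB; first exact: measurableT_comp.
  by do 2 apply: measurable_funM => //; exact: measurableT_comp.
have := @measurable_fun_fubini_tonelli_F _ _ _ _ _ mu F mF F0 => m1.
exact: (measurableT_comp m1 (measurable_fun_pair mf mg)).
Qed.

(** Integrated in [z] first, every bridge density has mass 1, which leaves the length of
    [[0, N]]. *)
Lemma integral_window N t s : 0 <= N -> 0 < s -> s < t ->
  (\int[mu]_z window N t s z = N%:E)%E.
Proof.
move=> N0 s0 st.
pose F (p : R * R) : \bar R :=
  if (0 <= p.2 <= N)%R then (bridge t p.2 s p.1)%:E else 0%E.
have F0 p : (0 <= F p)%E.
  by rewrite /F; case: ifP => // _; rewrite lee_fin bridge_ge0.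
have mF : measurable_fun setT F.
  apply: measurable_fun_ifT => //; first exact: (measurableT_comp (mI N)).
  by apply/measurable_EFinP; exact: measurable_bridge.
transitivity (\int[mu]_z \int[mu]_x F (z, x))%E.
  by apply: eq_integral.
rewrite (@fubini_tonelli _ _ _ _ _ mu mu F mF F0).
transitivity (\int[mu]_x (if (0 <= x <= N)%R then 1 else 0))%E.
  apply: eq_integral => x _; rewrite /F/=; case: ifP => _.
    exact: integral_bridge.
  by rewrite integral0.
rewrite integral_if -set_itvcc integral_cst//= mul1e lebesgue_measure_itv/= lte_fin.
case: ltP => N1; first by rewrite oppr0 adde0.
by congr EFin; lra.
Qed.

(** The supremum [t1 / s] of one window times the mass [N] of the other. *)
Lemma integral_window_mul_le N t1 t2 s : 0 <= N -> 0 < s -> s < t1 -> t1 <= t2 ->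
  (\int[mu]_z (window N t1 s z * window N t2 s z) <= (t1 * N / s)%:E)%E.
Proof.
move=> N0 s0 st1 t12; have st2 : s < t2 by lra.
have -> : (t1 * N / s)%:E = ((t1 / s)%:E * N%:E)%E.
  by rewrite -EFinM mulrAC.
rewrite -(integral_window N0 s0 st2) -ge0_integralZl//; last 3 first.
- exact: measurable_window.
- by move=> z _; exact: window_ge0.
- by rewrite lee_fin divr_ge0//; lra.
apply: ge0_le_integral => //.
- by move=> z _; rewrite mule_ge0// window_ge0.
- by apply: emeasurable_funM; exact: measurable_window.
- by apply: emeasurable_funM => //; exact: measurable_window.
- by move=> z _; rewrite lee_wpmul2r ?window_ge0// window_le.
Qed.

(** The bound by [t1 / s] is not integrable in time near 0. There the supremum is bounded instead by
    [N] times the maximum of the bridge density, of order [1 / sqrt s]. *)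
Lemma integral_window_mul_le_sqr N t1 t2 s :
  0 <= N -> 0 < s -> s < t1 -> t1 <= t2 ->
  (\int[mu]_z (window N t1 s z * window N t2 s z) <=
    (N ^+ 2 * (Num.sqrt (2 * pi * (s * (t1 - s) / t1)))^-1)%:E)%E.
Proof.
move=> N0 s0 st1 t12; have st2 : s < t2 by lra.
set c := (Num.sqrt _)^-1; have c0 : 0 <= c by rewrite invr_ge0.
have -> : (N ^+ 2 * c)%:E = ((N * c)%:E * N%:E)%E.
  by rewrite -EFinM; congr EFin; ring.
rewrite -[X in (_ <= _ * X)%E](integral_window N0 s0 st2) -ge0_integralZl//; last 3 first.
- exact: measurable_window.
- by move=> z _; exact: window_ge0.
- by rewrite lee_fin mulr_ge0.
apply: ge0_le_integral => //.
- by move=> z _; rewrite mule_ge0// window_ge0.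
- by apply: emeasurable_funM; exact: measurable_window.
- by apply: emeasurable_funM => //; exact: measurable_window.
- by move=> z _; rewrite lee_wpmul2r ?window_ge0// window_le_length.
Qed.

End bridge.

(** * Lower bound for the product of two windows *)

Section window_lower_bound.
Context {R : realType}.
Local Notation mu := (@lebesgue_measure R).
Implicit Types t x s z N : R.

Let mI (f : R * R -> R) (a b : R) : measurable_fun setT f ->
  measurable_fun setT (fun p => (a <= f p <= b)%R).
Proof. by move=> mf; apply: measurable_and; apply: measurable_fun_ler. Qed.

Let integral_itv_le (c a b : R) (f : R -> \bar R) : 0 <= c -> a <= b ->
  measurable_fun [set: R] f -> (forall x, 0 <= f x)%E ->
  (forall x, f x <= if (a <= x <= b)%R then c%:E else 0)%E ->
  (\int[mu]_x f x <= (c * (b - a))%:E)%E.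
Proof.
move=> c0 ab mf f0 fc.
have mg : measurable_fun [set: R] (fun x => if (a <= x <= b)%R then c%:E else 0%E).
  apply: measurable_fun_ifT; [|exact: measurable_cst|exact: measurable_cst].
  by apply: measurable_and; apply: measurable_fun_ler.
apply: (@le_trans _ _ (\int[mu]_x if (a <= x <= b)%R then c%:E else 0)%E).
  by apply: ge0_le_integral => //.
rewrite integral_if -set_itvcc integral_cst//= lebesgue_measure_itv/= lte_fin.
case: ltP => ab'; first by rewrite -EFinD -EFinM.
by rewrite mule0 lee_fin mulr_ge0// subr_ge0.
Qed.

(** Centring the Gaussian moves the dependence on [z] into the constraint, so that [z] can be
    integrated out before [y]. *)
Lemma window_compl_shift N t s z : 0 < s -> s < t ->
  window_compl N t s z = (\int[mu]_y
    if ~~ (0 <= y + t * z / s <= N)%R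
    then (t / s * heat_kernel (t * (t - s) / s) y)%:E else 0)%E.
Proof.
move=> s0 st; pose f (x : R) : \bar R :=
  if ~~ (0 <= x <= N)%R then (bridge t x s z)%:E else 0%E.
rewrite /window_compl -(@ge0_integral_shift _ f (t * z / s)).
- apply: eq_integral => y _; rewrite /f; case: ifP => // _.
  by rewrite bridge_scale// addrK.
- apply: measurable_fun_ifT; last exact: measurable_cst.
    by apply: measurable_neg; apply: measurable_and; apply: measurable_fun_ler.
  by apply/measurable_EFinP; exact: measurable_bridge.
- by move=> x; rewrite /f; case: ifP => // _; rewrite lee_fin bridge_ge0.
Qed.

(* With [z] in the range of the space points that the bridge sends into the
   window, [y + t z / s] leaves the window for [z] in an interval of length
   [s |y| / t]. *)
Lemma integral_window_compl N t t' s : 0 <= N -> 0 < s -> s < t -> t <= t' ->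
  (\int[mu]_(z in `[0%R, (s * N / t')%R]) window_compl N t s z <=
    (t / Num.sqrt s)%:E)%E.
Proof.
move=> N0 s0 st tt'; set L := s * N / t'; set v := t * (t - s) / s.
have t0 : 0 < t by lra.
have v0 : 0 < v by rewrite divr_gt0 ?mulr_gt0//; lra.
pose F (p : R * R) : \bar R :=
  if (0 <= p.1 <= L)%R && ~~ (0 <= p.2 + t * p.1 / s <= N)%R
  then (t / s * heat_kernel v p.2)%:E else 0%E.
have h0 y : 0 <= t / s * heat_kernel v y.
  by rewrite mulr_ge0 ?heat_kernel_ge0// divr_ge0//; lra.
have F0 p : (0 <= F p)%E by rewrite /F; case: ifP => // _; rewrite lee_fin.
have mF : measurable_fun setT F.
  apply: measurable_fun_ifT; last exact: measurable_cst.
    apply: measurable_and; first exact: mI.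
    apply: measurable_neg; apply: mI; apply: measurable_funD => //.
    by apply: measurable_funM => //; exact: measurable_funM.
  apply/measurable_EFinP; apply: measurable_funM => //.
  by apply: measurableT_comp => //; exact: measurable_heat_kernel.
have -> : (\int[mu]_(z in `[0%R, L]) window_compl N t s z =
    \int[mu]_z \int[mu]_y F (z, y))%E.
  rewrite integral_mkcond; apply: eq_integral => z _.
  rewrite patchE set_itvcc; case: ifPn => [/set_mem/= zL|].
    rewrite window_compl_shift//; apply: eq_integral => y _.
    by rewrite /F/= zL.
  rewrite notin_setE/= => /negP/negbTE zL.
  by apply/esym/integral0_eq => y _; rewrite /F/= zL.
rewrite (@fubini_tonelli _ _ _ _ _ mu mu F mF F0).
(* [L] is defined with the larger time [t'] so that one interval can serve two windows at once: the
   centre [t z / s] stays in [[0, N]] for every [z] up to [L]. *)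
have LN : t * L / s <= N.
  have -> : t * L / s = N * (t / t') by rewrite /L; field; lra.
  by rewrite ler_piMr// ler_pdivrMr; lra.
apply: (@le_trans _ _ (\int[mu]_y (`|y| * heat_kernel v y)%:E)%E).
  apply: ge0_le_integral => //.
  - by move=> y _; apply: integral_ge0.
  - exact: measurable_fun_fubini_tonelli_G.
  - apply/measurable_EFinP; apply: measurable_funM; first exact: normr_measurable.
    exact: measurable_heat_kernel.
  move=> y _.
  have mFy : measurable_fun [set: R] (fun z => F (z, y)).
    exact: (measurableT_comp mF (measurable_fun_pair (@measurable_id _ R setT)
      (measurable_cst (y : R)))).
  (* From a centre in [[0, N]], a positive [y] can only exit beyond [N] and a negative [y] only
     below 0. The length of the interval of such [z] cancels the mass factor [t / s]. *)
  have [y0|y0] := leP 0 y.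
    have -> : `|y| * heat_kernel v y = (t / s * heat_kernel v y) *
        (N * s / t - (N - y) * s / t) by rewrite ger0_norm//; field; lra.
    apply: integral_itv_le => //.
      rewrite -subr_ge0 (_ : _ - _ = y * s / t); last by field; lra.
      by rewrite divr_ge0 ?mulr_ge0//; lra.
    move=> z; rewrite /F/=; case: ifP => [/andP[/andP[z0 zL] zN]|_]; last first.
      by case: ifP => // _; rewrite lee_fin.
    have zN' : t * z / s <= N.
      apply: le_trans LN; rewrite ler_wpM2r ?invr_ge0//; [lra|].
      by rewrite ler_wpM2l//; lra.
    have tz0 : 0 <= t * z / s by rewrite divr_ge0 ?mulr_ge0//; lra.
    rewrite ler_pdivrMr// ler_pdivlMr//.
    have zt : z * t = s * (t * z / s) by field; lra.
    rewrite zt; case: ifP => // /negP[]; move: zN.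
    rewrite negb_and -!ltNge => /orP[h|h]; first by lra.
    by apply/andP; split; nra.
  have -> : `|y| * heat_kernel v y = (t / s * heat_kernel v y) *
      (- y * s / t - 0) by rewrite ltr0_norm//; field; lra.
  apply: integral_itv_le => //.
    by rewrite divr_ge0 ?mulr_ge0//; lra.
  move=> z; rewrite /F/=; case: ifP => [/andP[/andP[z0 zL] zN]|_]; last first.
    by case: ifP => // _; rewrite lee_fin.
  have zN' : t * z / s <= N.
    apply: le_trans LN; rewrite ler_wpM2r ?invr_ge0//; [lra|].
    by rewrite ler_wpM2l//; lra.
  rewrite ler_pdivlMr// z0/=.
  have zt : z * t = s * (t * z / s) by field; lra.
  rewrite zt; case: ifP => // /negP[]; move: zN.
  rewrite negb_and -!ltNge => /orP[h|h]; first by nra.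
  by lra.
apply: (le_trans (integral_normr_heat_kernel v0)).
rewrite lee_fin ler_pdivlMr ?sqrtr_gt0// -sqrtrM ?(ltW v0)//.
rewrite -[leRHS](ger0_norm (ltW t0)) -sqrtr_sqr ler_sqrt ?sqr_ge0//.
rewrite (_ : v * s = t * (t - s)); last by rewrite /v; field; lra.
by nra.
Qed.

Let window_fin N t s z : 0 < s -> s < t -> window N t s z \is a fin_num.
Proof.
move=> s0 st; rewrite ge0_fin_numE ?window_ge0//.
by apply: le_lt_trans (window_le N z s0 st) _; rewrite ltry.
Qed.

Let window_compl_fin N t s z : 0 < s -> s < t -> window_compl N t s z \is a fin_num.
Proof.
move=> s0 st; rewrite ge0_fin_numE ?window_compl_ge0//.
apply: (@le_lt_trans _ _ (t / s)%:E); last exact: ltry.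
by rewrite -(window_split N z s0 st) leeDr// window_ge0.
Qed.

(** On [[0, s N / t2]] write each window as its maximum minus its deficit. The product plus the two
    cross terms equals the product of the maxima plus the product of the deficits, and the latter is
    dropped. Each cross term pairs a deficit with the maximum of the other window and costs
    [t1 t2 / (s sqrt s)], whence the 2. The error stands on the right to avoid subtraction in
    [\bar R]. *)
Lemma integral_window_mul_ge N t1 t2 s : 0 <= N -> 0 < s -> s < t1 -> t1 <= t2 ->
  ((t1 * N / s)%:E <= \int[mu]_z (window N t1 s z * window N t2 s z) +
    (2 * t1 * t2 / (s * Num.sqrt s))%:E)%E.
Proof.
move=> N0 s0 st1 t12; have st2 : s < t2 by lra.
set L := s * N / t2; have L0 : 0 <= L by rewrite divr_ge0 ?mulr_ge0//; lra.
have mD t : measurable_fun [set: R] (fun z => window_compl N t s z).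
  pose F (p : R * R) : \bar R :=
    if ~~ (0 <= p.2 <= N)%R then (bridge t p.2 s p.1)%:E else 0%E.
  have F0 p : (0 <= F p)%E.
    by rewrite /F; case: ifP => // _; rewrite lee_fin bridge_ge0.
  have mF : measurable_fun setT F.
    apply: measurable_fun_ifT; last exact: measurable_cst.
      by apply: measurable_neg; exact: mI.
    by apply/measurable_EFinP; exact: measurable_bridge.
  exact: (@measurable_fun_fubini_tonelli_F _ _ _ _ _ mu F mF F0).
have mW t : measurable_fun [set: R] (fun z => window N t s z).
  exact: measurable_window.
have mWW : measurable_fun [set: R] (fun z => window N t1 s z * window N t2 s z)%E.
  exact: emeasurable_funM.
have WW0 z : (0 <= window N t1 s z * window N t2 s z)%E.
  by rewrite mule_ge0// window_ge0.
have a0 : 0 <= t1 / s by rewrite divr_ge0//; lra.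
have b0 : 0 <= t2 / s by rewrite divr_ge0//; lra.
pose G z : \bar R := (window N t1 s z * window N t2 s z +
  ((t2 / s)%:E * window_compl N t1 s z + (t1 / s)%:E * window_compl N t2 s z))%E.
have D0 := window_compl_ge0.
have mcD c t : measurable_fun [set: R] (fun z => c%:E * window_compl N t s z)%E.
  exact: measurable_funeM.
have mDD : measurable_fun [set: R] (fun z =>
    ((t2 / s)%:E * window_compl N t1 s z + (t1 / s)%:E * window_compl N t2 s z)%E).
  by apply: emeasurable_funD; exact: mcD.
have DD0 z : (0 <= (t2 / s)%:E * window_compl N t1 s z +
    (t1 / s)%:E * window_compl N t2 s z)%E.
  by rewrite adde_ge0// mule_ge0// ?lee_fin.
apply: (@le_trans _ _ (\int[mu]_(z in `[0%R, L]) G z)%E).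
  apply: (@le_trans _ _ (\int[mu]_(z in `[0%R, L]) (t1 / s * (t2 / s))%:E)%E).
    rewrite integral_cst//= lebesgue_measure_itv/= lte_fin; case: ltP => L1.
      rewrite oppr0 adde0 -EFinM lee_fin le_eqVlt; apply/orP; left; apply/eqP.
      by rewrite /L; field; lra.
    have -> : N = 0.
      have : L = 0 by lra.
      move/eqP; rewrite /L !mulf_eq0 invr_eq0.
      by move=> /orP[/orP[]|] /eqP ?; lra.
    by rewrite mulr0 mul0r mule0.
  apply: ge0_le_integral => //.
  - by move=> z _; rewrite lee_fin mulr_ge0.
  - exact: measurable_funTS (emeasurable_funD mWW mDD).
  move=> z _; rewrite /G.
  have := window_split N z s0 st1; have := window_split N z s0 st2.
  have := D0 _ N t1 s z; have := D0 _ N t2 s z.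
  rewrite -(fineK (window_fin N z s0 st1)) -(fineK (window_fin N z s0 st2)).
  rewrite -(fineK (window_compl_fin N z s0 st1)) -(fineK (window_compl_fin N z s0 st2)).
  move: (fine _) (fine _) (fine _) (fine _) => D2 D1 W2 W1.
  rewrite -!EFinM -!EFinD !lee_fin => d2 d1 [<-] [<-].
  by nra.
rewrite /G ge0_integralD//; last 2 first.
- exact: measurable_funTS.
- exact: measurable_funTS.
apply: leeD.
  exact: ge0_subset_integral.
rewrite ge0_integralD//; last 4 first.
- by move=> z _; rewrite mule_ge0// lee_fin.
- by apply: measurable_funTS; exact: mcD.
- by move=> z _; rewrite mule_ge0// lee_fin.
- by apply: measurable_funTS; exact: mcD.
rewrite !ge0_integralZl//; last 2 first.
- by apply: measurable_funTS; exact: mD.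
- by apply: measurable_funTS; exact: mD.
have h1 := integral_window_compl N0 s0 st1 t12.
have h2 := integral_window_compl N0 s0 st2 (lexx t2).
have -> : 2 * t1 * t2 / (s * Num.sqrt s) =
    t2 / s * (t1 / Num.sqrt s) + t1 / s * (t2 / Num.sqrt s).
  by have : 0 < Num.sqrt s by [rewrite sqrtr_gt0]; move=> ?; field; lra.
by rewrite EFinD !EFinM; apply: leeD; apply: lee_pmul => //;
  rewrite ?lee_fin//; apply: integral_ge0.
Qed.

End window_lower_bound.

(** * Time integrals with singularities at the ends *)

Section time_integrals.
Context {R : realType}.
Local Notation mu := (@lebesgue_measure R).

Lemma integral_derive_gt0 (f F : R -> R) (a b : R) : 0 < a -> a <= b ->
  (forall x : R, 0 < x -> is_derive x 1 F (f x)) ->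
  (forall x : R, 0 < x -> {for x, continuous f}) ->
  (\int[mu]_(x in `[a, b]) (f x)%:E = (F b - F a)%:E)%E.
Proof.
move=> a0; rewrite le_eqVlt => /orP[/eqP<- _ _|ab dF cf].
  by rewrite set_itv1 integral_set1 subrr.
have cF (x : R) : 0 < x -> {for x, continuous F}.
  move=> x0; apply/differentiable_continuous/derivable1_diffP.
  by case: (dF x x0).
rewrite (@continuous_FTC2 _ f F) ?EFinB//.
- apply: continuous_in_subspaceT => x /set_mem/=; rewrite in_itv/= => /andP[ax _].
  exact/cf/(lt_le_trans a0).
- split.
  + move=> x; rewrite in_itv/= => /andP[ax _].
    by case: (dF x (lt_trans a0 ax)).
  + exact/cvg_at_right_filter/cF.
  + exact/cvg_at_left_filter/cF/(lt_trans a0).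
- move=> x; rewrite in_itv/= => /andP[ax _]; rewrite derive1E.
  have dFx := dF x (lt_trans a0 ax); exact: derive_val.
Qed.

Lemma continuous_inv_sqrt (x : R) : 0 < x ->
  {for x, continuous (fun x : R => (Num.sqrt x)^-1)}.
Proof.
by move=> x0; apply: cvgV; [rewrite gt_eqF// sqrtr_gt0|exact: sqrt_continuous].
Qed.

Lemma integral_invr (a b : R) : 0 < a -> a <= b ->
  (\int[mu]_(x in `[a, b]) (x^-1)%:E = (ln b - ln a)%:E)%E.
Proof.
move=> a0 ab; apply: integral_derive_gt0 => // x x0.
by apply: cvgV; [rewrite gt_eqF|exact: cvg_id].
Qed.

Lemma integral_inv_sqrt_itv (a b : R) : 0 < a -> a <= b ->
  (\int[mu]_(x in `[a, b]) ((Num.sqrt x)^-1)%:E =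
   (2 * Num.sqrt b - 2 * Num.sqrt a)%:E)%E.
Proof.
move=> a0 ab; apply: (@integral_derive_gt0 _ (fun x => 2 * Num.sqrt x)) => // x x0.
- have h := is_derive1_sqrt x0.
  have -> : (fun x : R => 2 * Num.sqrt x) = 2 \*: (@Num.sqrt R) by apply/funext.
  apply: is_derive_eq; rewrite /GRing.scale/=; field.
  by rewrite gt_eqF// sqrtr_gt0.
- exact: continuous_inv_sqrt.
Qed.

Lemma integral_inv_sqrt3_itv (a b : R) : 0 < a -> a <= b ->
  (\int[mu]_(x in `[a, b]) ((x * Num.sqrt x)^-1)%:E <= (2 / Num.sqrt a)%:E)%E.
Proof.
move=> a0 ab.
have -> : (\int[mu]_(x in `[a, b]) ((x * Num.sqrt x)^-1)%:E =
    (- 2 * (Num.sqrt b)^-1 - (- 2 * (Num.sqrt a)^-1))%:E)%E.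
  apply: (@integral_derive_gt0 _ (fun x => - 2 * (Num.sqrt x)^-1)) => // x x0.
    have h := is_derive1_sqrt x0.
    have s0 : Num.sqrt x != 0 by rewrite gt_eqF// sqrtr_gt0.
    have h' := is_deriveV s0 h.
    have -> : (fun x : R => - 2 * (Num.sqrt x)^-1) =
      (- 2) \*: (fun x : R => (Num.sqrt x)^-1) by apply/funext.
    have e : x * Num.sqrt x = Num.sqrt x ^+ 3.
      by rewrite -{1}(sqr_sqrtr (ltW x0)) -exprSr.
    by apply: is_derive_eq; rewrite /GRing.scale/= e; field.
  apply: cvgV; first by rewrite gt_eqF// mulr_gt0// sqrtr_gt0.
  by apply: cvgM; [exact: cvg_id|exact: sqrt_continuous].
rewrite lee_fin mulNr mulNr opprK -[leRHS]add0r lerD2r.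
by rewrite oppr_le0 mulr_ge0// invr_ge0.
Qed.

Lemma measurable_inv_sqrt : measurable_fun [set: R] (fun x : R => ((Num.sqrt x)^-1)%:E).
Proof.
apply/measurable_EFinP/measurable_funV_real/measurable_fun_sqrt.
exact: measurable_id.
Qed.

(** The singularity at 0 is reached by monotone convergence along the intervals
    [[b / (n + 1), b]]. *)
Lemma integral_inv_sqrt (b : R) : 0 < b ->
  (\int[mu]_(x in [set x : R | (0 < x <= b)%R]) ((Num.sqrt x)^-1)%:E <=
   (2 * Num.sqrt b)%:E)%E.
Proof.
move=> b0; pose F n : set (measurableTypeR R) := `[b / n.+1%:R, b]%classic.
have Fb n : b / n.+1%:R <= b by rewrite ler_pdivrMr// ler_peMr ?ler1n// ltW.
have F0 n : 0 < b / n.+1%:R by rewrite divr_gt0.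
have -> : [set x : R | (0 < x <= b)%R] = \bigcup_n F n.
  apply/seteqP; split => x /=.
    move=> /andP[x0 xb].
    have [n xn] : exists n, b / x <= n.+1%:R.
      exists (Num.truncn (b / x)); apply/ltW; exact: truncnS_gt.
    exists n => //; rewrite /F/= in_itv/= xb andbT.
    by rewrite ler_pdivrMr// mulrC -ler_pdivrMr.
  move=> [n _]; rewrite /F/= in_itv/= => /andP[h ->]; rewrite andbT.
  exact: lt_le_trans h.
have ndF : nondecreasing_seq F.
  apply/nondecreasing_seqP => n; rewrite subsetEset => x.
  rewrite /F/= !in_itv/= => /andP[h ->]; rewrite andbT.
  apply: le_trans h; rewrite ler_pM2l// lef_pV2 ?posrE//.
  by rewrite ler_nat.
have mF n : measurable (F n) by exact: measurable_itv.
have mf n : measurable_fun (F n) (fun x => ((Num.sqrt x)^-1)%:E).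
  by apply: measurable_funTS; exact: measurable_inv_sqrt.
have f0 n x : F n x -> (0 <= ((Num.sqrt x)^-1)%:E)%E.
  by rewrite lee_fin invr_ge0.
have nd := @ge0_nondecreasing_set_nondecreasing_integral _ _ _ F _ mu ndF mF mf f0.
have := @ge0_nondecreasing_set_cvg_integral _ _ _ F _ mu ndF mF mf f0.
move=> /cvg_lim <-//; apply: lime_le; first exact: ereal_nondecreasing_is_cvgn.
near=> n; rewrite integral_inv_sqrt_itv// lee_fin gerBl.
by rewrite mulr_ge0.
Unshelve. all: end_near. Qed.

(* The density of the time integral of [bridge ^ 2], with the variance
   [s (t - s) / t] of the bridge: [1 / sqrt] of it splits because
   [t / (s (t - s)) = 1 / s + 1 / (t - s)]. *)
Lemma integral_inv_sqrt_bridge (t : R) : 0 < t ->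
  (\int[mu]_s (if (0 < s < t)%R
     then ((Num.sqrt (s * (t - s) / t))^-1)%:E else 0) <=
   (4 * Num.sqrt t)%:E)%E.
Proof.
move=> t0.
pose h (s : R) : \bar R := if (0 < s <= t)%R then ((Num.sqrt s)^-1)%:E else 0%E.
have h0 s : (0 <= h s)%E.
  by rewrite /h; case: ifP => // _; rewrite lee_fin invr_ge0.
have mh : measurable_fun [set: R] h.
  apply: measurable_fun_ifT; [|exact: measurable_inv_sqrt|exact: measurable_cst].
  by apply: measurable_and; [exact: measurable_fun_ltr|exact: measurable_fun_ler].
have mh' : measurable_fun [set: R] (fun s : R => h (t - s)%R).
  apply: (measurableT_comp mh); exact: measurable_funB.
have hi : (\int[mu]_s h s <= (2 * Num.sqrt t)%:E)%E.
  by rewrite /h integral_if; exact: integral_inv_sqrt.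
have hi' : (\int[mu]_s h (t - s)%R <= (2 * Num.sqrt t)%:E)%E.
  apply: le_trans hi; rewrite -(ge0_integralN mh h0).
  rewrite -(@ge0_integral_shift _ (fun s => h (- s)%R) (- t)).
  - by rewrite le_eqVlt; apply/orP; left; apply/eqP; apply: eq_integral => s _;
      rewrite opprD opprK addrC.
  - by apply: (measurableT_comp mh); exact: oppr_measurable.
  - by [].
apply: (@le_trans _ _ (\int[mu]_s (h s + h (t - s)%R))%E).
  apply: ge0_le_integral => //.
  - by move=> s _; case: ifP => // _; rewrite lee_fin invr_ge0.
  - apply: measurable_fun_ifT; [| |exact: measurable_cst].
      by apply: measurable_and; exact: measurable_fun_ltr.
    apply/measurable_EFinP/measurable_funV_real/measurable_fun_sqrt.
    by apply: measurable_funM => //; apply: measurable_funM => //; exact: measurable_funB.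
  - exact: emeasurable_funD.
  move=> s _; case: ifP => [/andP[s0 st]|_]; last by rewrite adde_ge0.
  rewrite /h s0 (ltW st)/= subr_gt0 st lerBlDr lerDl (ltW s0)/= -EFinD lee_fin.
  have ts : 0 < t - s by rewrite subr_gt0.
  set a := Num.sqrt s; set b := Num.sqrt (t - s).
  have a0 : 0 < a by rewrite sqrtr_gt0.
  have b0 : 0 < b by rewrite sqrtr_gt0.
  have ab : Num.sqrt (s * (t - s) / t) = a * b / Num.sqrt t.
    by rewrite sqrtrM ?mulr_ge0 ?ltW// sqrtrM ?ltW// sqrtrV ?ltW.
  rewrite ab invf_div.
  have st0 : 0 < Num.sqrt t by rewrite sqrtr_gt0.
  have -> : a^-1 + b^-1 = (a + b) / (a * b) by field; rewrite !gt_eqF.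
  rewrite ler_pM2r ?invr_gt0 ?mulr_gt0//.
  (* What remains is [sqrt t <= a + b], which holds because [a ^ 2 + b ^ 2 = t]. *)
  rewrite -(ler_pXn2r (_ : 0 < 2)%N) ?nnegrE ?addr_ge0 ?ltW//.
  rewrite sqr_sqrtr ?ltW// sqrrD !sqr_sqrtr ?ltW//.
  by have := mulr_gt0 a0 b0; rewrite -mulr_natr; lra.
rewrite ge0_integralD//.
by apply: (le_trans (leeD hi hi')); rewrite -EFinD lee_fin; lra.
Qed.

End time_integrals.

(** * Asymptotics of the double window integral *)

Section window_asymptotics.
Context {R : realType}.
Local Notation mu := (@lebesgue_measure R).
Implicit Types N s : R.
Variables (t1 t2 C : R) (g : R * R -> \bar R).
Hypotheses (t1_gt0 : 0 < t1) (t12 : t1 <= t2) (C0 : 0 <= C).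
Hypothesis mg : measurable_fun setT g.
Hypothesis g_ge1 : forall s z, 0 < s < t1 -> (1 <= g (s, z))%E.
Hypothesis g_le : forall s z, 0 < s < t1 -> (g (s, z) <= (1 + C * Num.sqrt s)%:E)%E.

(** Here [g] stands for the second moment of the solution relative to the square of the heat kernel,
    kept abstract behind its two-sided bound. *)
Let integrand N (p : R * R) : \bar R := if (0 < p.1 < t1)%R then
  (window N t1 p.1 p.2 * window N t2 p.1 p.2 * g p)%E else 0%E.

Let integrand_ge0 N p : (0 <= integrand N p)%E.
Proof.
rewrite /integrand; case: ifP => // p1.
rewrite !mule_ge0 ?window_ge0//; case: p p1 => s z /= p1.
by apply: le_trans (g_ge1 z p1); rewrite lee_fin.
Qed.

Let measurable_integrand N : measurable_fun setT (integrand N).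
Proof.
apply: measurable_fun_ifT; last exact: measurable_cst.
  by apply: measurable_and; exact: measurable_fun_ltr.
apply: emeasurable_funM => //.
by apply: emeasurable_funM; exact: measurable_window.
Qed.

Let slice N s : \bar R := (\int[mu]_z integrand N (s, z))%E.

Let slice_ge0 N s : (0 <= slice N s)%E.
Proof. by apply: integral_ge0 => z _. Qed.

Let measurable_slice N : measurable_fun [set: R] (slice N).
Proof.
exact: (@measurable_fun_fubini_tonelli_F _ _ _ _ _ mu (integrand N)
  (measurable_integrand N) (integrand_ge0 N)).
Qed.

Let slice0 N s : ~~ (0 < s < t1) -> slice N s = 0%E.
Proof. by move=> /negbTE h; rewrite /slice /integrand/= h integral0. Qed.

Let mW (N t s : R) : measurable_fun [set: R] (window N t s).
Proof. exact: measurable_window. Qed.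

Let mWW (N s : R) :
  measurable_fun [set: R] (fun z => (window N t1 s z * window N t2 s z)%E).
Proof. exact: emeasurable_funM. Qed.

Let WW0 (N s z : R) : (0 <= window N t1 s z * window N t2 s z)%E.
Proof. by rewrite mule_ge0// window_ge0. Qed.

Let m_slice N s : measurable_fun [set: R] (fun z => integrand N (s, z)).
Proof.
exact: (measurableT_comp (measurable_integrand N)
  (measurable_fun_pair (measurable_cst s) (@measurable_id _ R setT))).
Qed.

Let mcWW c N s : measurable_fun [set: R]
  (fun z => (c%:E * (window N t1 s z * window N t2 s z))%E).
Proof. exact: measurable_funeM. Qed.

Let slice_le N s : 0 < s < t1 ->
  (slice N s <= (1 + C * Num.sqrt s)%:E *
    \int[mu]_z (window N t1 s z * window N t2 s z))%E.
Proof.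
move=> s01; have c0 : (0 <= (1 + C * Num.sqrt s)%:E)%E.
  by rewrite lee_fin addr_ge0// mulr_ge0.
rewrite -ge0_integralZl//; last exact: mWW.
apply: ge0_le_integral => //.
- exact: m_slice.
- exact: mcWW.
- by move=> z _; rewrite /integrand/= s01 muleC lee_wpmul2r// g_le.
Qed.

Let slice_ge N s : 0 < s < t1 ->
  (\int[mu]_z (window N t1 s z * window N t2 s z) <= slice N s)%E.
Proof.
move=> s01; apply: ge0_le_integral => //.
- exact: mWW.
- exact: m_slice.
- by move=> z _; rewrite /integrand/= s01 lee_pemulr// g_ge1.
Qed.

(** [b1] bounds a time slice before the cut [N ^- 2] and [b2] after it; the second term of [b2] is
    the excess [C sqrt s] of [g] multiplied by [t1 N / s]. [b3] is the error of the lower bound. *)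
Let b1 N (s : R) : R := ((1 + C * Num.sqrt t1) * N ^+ 2) * (Num.sqrt s)^-1.
Let b2 N (s : R) : R := (t1 * N) * s^-1 + (C * t1 * N) * (Num.sqrt s)^-1.
Let b3 (s : R) : R := (2 * t1 * t2) * (s * Num.sqrt s)^-1.

Let b1_ge0 N s : 0 <= b1 N s.
Proof.
by rewrite /b1 mulr_ge0 ?invr_ge0// mulr_ge0 ?sqr_ge0// addr_ge0// mulr_ge0.
Qed.

Let b2_ge0 N s : 0 <= N -> 0 <= s -> 0 <= b2 N s.
Proof.
move=> N0 s0; have := ltW t1_gt0 => t10.
by rewrite /b2 addr_ge0// !mulr_ge0 ?invr_ge0.
Qed.

Let mif (lo hi : R) (f : R -> R) : measurable_fun setT f ->
  measurable_fun [set: R] (fun s => if (lo <= s <= hi)%R then (f s)%:E else 0%E).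
Proof.
move=> mf; apply: measurable_fun_ifT; last exact: measurable_cst.
  by apply: measurable_and; apply: measurable_fun_ler.
exact/measurable_EFinP.
Qed.

Let mif0 (hi : R) (f : R -> R) : measurable_fun setT f ->
  measurable_fun [set: R] (fun s => if (0 < s <= hi)%R then (f s)%:E else 0%E).
Proof.
move=> mf; apply: measurable_fun_ifT; last exact: measurable_cst.
  by apply: measurable_and; [exact: measurable_fun_ltr|exact: measurable_fun_ler].
exact/measurable_EFinP.
Qed.

Let m_sqrtV : measurable_fun setT (fun s : R => (Num.sqrt s)^-1).
Proof. by apply/measurable_EFinP; exact: measurable_inv_sqrt. Qed.

Let mb1 N : measurable_fun setT (b1 N).
Proof. exact: measurable_funM. Qed.

Let mb2 N : measurable_fun setT (b2 N).
Proof.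
apply: measurable_funD; apply: measurable_funM => //.
exact: measurable_funV_real.
Qed.

Let mb3 : measurable_fun setT b3.
Proof.
apply: measurable_funM => //; apply: measurable_funV_real.
by apply: measurable_funM => //; exact: measurable_fun_sqrt.
Qed.

Let cut_gt0 N : 1 <= N -> 0 < N ^- 2.
Proof. by move=> N1; rewrite invr_gt0 exprn_gt0//; lra. Qed.

Let cut_le N : 1 <= N -> 2 <= t1 * N ^+ 2 -> N ^- 2 <= t1 / 2.
Proof.
move=> N1 tN; have N20 : 0 < N ^+ 2 by rewrite exprn_gt0//; lra.
rewrite ler_pdivlMr// -(ler_pM2r N20).
by rewrite mulrAC mulVf ?mul1r// gt_eqF.
Qed.

Let slice_upper N s : 1 <= N -> 2 <= t1 * N ^+ 2 ->
  (slice N s <= (if (0 < s <= N ^- 2)%R then (b1 N s)%:E else 0) +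
    (if (N ^- 2 <= s <= t1)%R then (b2 N s)%:E else 0))%E.
Proof.
move=> N1 tN; have N0 : 0 <= N by lra.
have a0 := cut_gt0 N1; have at1 := cut_le N1 tN.
have [s01|sN] := boolP (0 < s < t1); last first.
  rewrite slice0// adde_ge0//; case: ifP => //; rewrite lee_fin ?b1_ge0//.
  by move=> /andP[/(lt_le_trans a0)/ltW ? _]; exact: b2_ge0.
have [s0 st1] := andP s01.
apply: (le_trans (slice_le N s01)).
have c0 : (0 <= (1 + C * Num.sqrt s)%:E)%E.
  by rewrite lee_fin addr_ge0// mulr_ge0.
have WWi0 : (0 <= \int[mu]_z (window N t1 s z * window N t2 s z))%E.
  by apply: integral_ge0 => z _; exact: WW0.
have ss1 : Num.sqrt s <= Num.sqrt t1 by rewrite ler_sqrt ltW.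
have ss0 : 0 < Num.sqrt s by rewrite sqrtr_gt0.
have [sa|/ltW sa] := leP s (N ^- 2).
  rewrite s0/= -[leLHS]adde0; apply: leeD; last first.
    by case: ifP => // _; rewrite lee_fin b2_ge0// ltW.
  have cc : ((1 + C * Num.sqrt s)%:E <= (1 + C * Num.sqrt t1)%:E)%E.
    by rewrite lee_fin lerD2l ler_wpM2l.
  apply: (le_trans (lee_pmul c0 WWi0 cc (integral_window_mul_le_sqr N0 s0 st1 t12))).
  rewrite -EFinM lee_fin /b1 [leLHS]mulrA ler_wpM2l//.
    by rewrite mulr_ge0 ?sqr_ge0// addr_ge0// mulr_ge0.
  (* The hypothesis [2 <= t1 * N ^+ 2] puts the cut below [t1 / 2], where the bridge variance is at
     least [s / 2]. *)
  have vs : s <= 2 * pi * (s * (t1 - s) / t1).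
    have -> : 2 * pi * (s * (t1 - s) / t1) = s * (pi * (2 * (t1 - s) / t1)).
      by field; lra.
    rewrite ler_peMr ?ltW//; have h := pi_ge2 R.
    have h' : 1 <= 2 * (t1 - s) / t1 by rewrite ler_pdivlMr//; lra.
    by nra.
  by rewrite lef_pV2 ?posrE ?sqrtr_gt0 ?ler_sqrt//; lra.
rewrite sa (ltW st1)/= -[leLHS]add0e; apply: leeD.
  by case: ifP => // _; rewrite lee_fin b1_ge0.
apply: (le_trans (lee_pmul c0 WWi0 (lexx _) (integral_window_mul_le N0 s0 st1 t12))).
rewrite -EFinM lee_fin /b2 le_eqVlt; apply/orP; left; apply/eqP.
have e : s^-1 = (Num.sqrt s) ^- 2 by rewrite sqr_sqrtr// ltW.
by rewrite e; field; rewrite gt_eqF.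
Qed.

(** Stopping at [t1 / 2] keeps [s] strictly below [t1] and only changes the logarithm by a
    constant. *)
Let slice_lower N s : 1 <= N -> 2 <= t1 * N ^+ 2 ->
  ((if (N ^- 2 <= s <= t1 / 2)%R then (t1 * N * s^-1)%:E else 0) <=
   slice N s + (if (N ^- 2 <= s <= t1 / 2)%R then (b3 s)%:E else 0))%E.
Proof.
move=> N1 tN; have a0 := cut_gt0 N1.
case: ifP => [/andP[s0 st]|_]; last by rewrite adde0.
have s0' : 0 < s by exact: lt_le_trans s0.
have st1 : s < t1 by lra.
apply: (le_trans (integral_window_mul_ge _ s0' st1 t12)); first by lra.
by apply: leeD => //; apply: slice_ge; rewrite s0'.
Qed.

Let sqrt_cut N : 1 <= N -> Num.sqrt (N ^- 2) = N^-1.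
Proof. by move=> N1; rewrite -exprVn sqrtr_sqr ger0_norm// invr_ge0; lra. Qed.

(** The factor 2 of the limit enters here. *)
Let ln_cut N : 1 <= N -> ln (N ^- 2) = - (2 * ln N).
Proof.
move=> N1; have N0 : 0 < N by lra.
by rewrite lnV ?posrE ?exprn_gt0// lnXn// mulr_natl.
Qed.

Let integral_b1 N : 1 <= N ->
  (\int[mu]_s (if (0 < s <= N ^- 2)%R then (b1 N s)%:E else 0) <=
   (2 * (1 + C * Num.sqrt t1) * N)%:E)%E.
Proof.
move=> N1; rewrite integral_if; have a0 := cut_gt0 N1.
have k0 : 0 <= (1 + C * Num.sqrt t1) * N ^+ 2.
  by rewrite mulr_ge0 ?sqr_ge0// addr_ge0// mulr_ge0.
have mS : measurable [set x : R | (0 < x <= N ^- 2)%R].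
  by rewrite (_ : [set x : R | _] = `]0, N ^- 2]%classic)// set_itvoc.
rewrite /b1; under eq_integral do rewrite EFinM.
rewrite ge0_integralZl//; last first.
  by apply: measurable_funTS; exact: measurable_inv_sqrt.
apply: (@le_trans _ _ (((1 + C * Num.sqrt t1) * N ^+ 2)%:E *
    (2 * Num.sqrt (N ^- 2))%:E)%E).
  by apply: lee_wpmul2l => //; exact: integral_inv_sqrt.
rewrite -EFinM lee_fin sqrt_cut// le_eqVlt; apply/orP; left; apply/eqP.
by field; lra.
Qed.

Let integral_b2 N : 1 <= N -> 2 <= t1 * N ^+ 2 ->
  (\int[mu]_s (if (N ^- 2 <= s <= t1)%R then (b2 N s)%:E else 0) <=
   (t1 * N * (ln t1 + 2 * ln N) + 2 * C * t1 * Num.sqrt t1 * N)%:E)%E.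
Proof.
move=> N1 tN; have N0 : 0 <= N by lra.
have a0 := cut_gt0 N1; have at1 := cut_le N1 tN.
have at1' : N ^- 2 <= t1 by lra.
rewrite integral_if -set_itvcc.
rewrite /b2; under eq_integral do rewrite EFinD (EFinM (t1 * N)) (EFinM (C * t1 * N)).
have m1 : measurable_fun [set: R] (fun s : R => (s^-1)%:E).
  by apply/measurable_EFinP; exact: measurable_funV_real.
have p1 s : s \in `[N ^- 2, t1] -> (0 <= (s^-1)%:E)%E.
  by rewrite in_itv/= => /andP[h _]; rewrite lee_fin invr_ge0 ltW// (lt_le_trans a0).
have t10 := ltW t1_gt0.
rewrite ge0_integralD//; last 4 first.
- by move=> s /= h; rewrite mule_ge0// ?p1// lee_fin mulr_ge0.
- by apply: measurable_funTS; exact: measurable_funeM.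
- by move=> s /= h; rewrite mule_ge0// lee_fin ?invr_ge0// !mulr_ge0.
- by apply: measurable_funTS; apply: measurable_funeM; exact: measurable_inv_sqrt.
rewrite ge0_integralZl//; last 2 first.
- exact: measurable_funTS.
- by rewrite lee_fin mulr_ge0.
rewrite ge0_integralZl//; last 2 first.
- by apply: measurable_funTS; exact: measurable_inv_sqrt.
- by rewrite lee_fin !mulr_ge0.
rewrite integral_invr// integral_inv_sqrt_itv// -!EFinM -EFinD lee_fin.
rewrite ln_cut// sqrt_cut// opprK lerD2l.
have : 0 <= N^-1 by rewrite invr_ge0.
have : 0 <= C * t1 * N by rewrite !mulr_ge0.
by move: (N^-1) => u; nra.
Qed.

Let integral_lower N : 1 <= N -> 2 <= t1 * N ^+ 2 ->
  (\int[mu]_s (if (N ^- 2 <= s <= t1 / 2)%R then (t1 * N * s^-1)%:E else 0) =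
   (t1 * N * (ln (t1 / 2) + 2 * ln N))%:E)%E.
Proof.
move=> N1 tN; have N0 : 0 <= N by lra.
have a0 := cut_gt0 N1; have at1 := cut_le N1 tN.
rewrite integral_if -set_itvcc; under eq_integral do rewrite EFinM.
have t10 := ltW t1_gt0.
rewrite ge0_integralZl//; last 3 first.
- by apply: measurable_funTS; apply/measurable_EFinP; exact: measurable_funV_real.
- move=> s /=; rewrite in_itv/= => /andP[h _].
  by rewrite lee_fin invr_ge0 ltW// (lt_le_trans a0).
- by rewrite lee_fin mulr_ge0.
by rewrite integral_invr// ln_cut// opprK -EFinM.
Qed.

Let integral_b3 N : 1 <= N -> 2 <= t1 * N ^+ 2 ->
  (\int[mu]_s (if (N ^- 2 <= s <= t1 / 2)%R then (b3 s)%:E else 0) <=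
   (4 * t1 * t2 * N)%:E)%E.
Proof.
move=> N1 tN; have N0 : 0 <= N by lra.
have a0 := cut_gt0 N1; have at1 := cut_le N1 tN.
have t20 : 0 <= t2 := ltW (lt_le_trans t1_gt0 t12).
have t10 := ltW t1_gt0.
rewrite integral_if -set_itvcc /b3; under eq_integral do rewrite EFinM.
rewrite ge0_integralZl//; last 3 first.
- apply: measurable_funTS; apply/measurable_EFinP; apply: measurable_funV_real.
  by apply: measurable_funM => //; exact: measurable_fun_sqrt.
- move=> s /=; rewrite in_itv/= => /andP[h _].
  by rewrite lee_fin invr_ge0 mulr_ge0// ltW// (lt_le_trans a0).
- by rewrite lee_fin !mulr_ge0.
apply: (@le_trans _ _ ((2 * t1 * t2)%:E * (2 / Num.sqrt (N ^- 2))%:E)%E).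
  by apply: lee_wpmul2l; [rewrite lee_fin !mulr_ge0|exact: integral_inv_sqrt3_itv].
rewrite -EFinM lee_fin sqrt_cut// invrK le_eqVlt; apply/orP; left; apply/eqP.
by ring.
Qed.

Lemma window_asymptotics : exists K : R, forall N, 1 <= N -> 2 <= t1 * N ^+ 2 ->
  let J := (\int[mu]_s \int[mu]_z if (0 < s < t1)%R then
    window N t1 s z * window N t2 s z * g (s, z) else 0)%E in
  (J <= (2 * t1 * N * ln N + K * N)%:E)%E /\
  ((2 * t1 * N * ln N)%:E <= J + (K * N)%:E)%E.
Proof.
(* [K1] collects the [O (N)] terms of the upper bound: times before the cut, the upper limit of the
   logarithm, and the excess of [g]. [K2] does so for the lower bound, with the window deficits and
   the logarithm at [t1 / 2]. *)
pose K1 := 2 * (1 + C * Num.sqrt t1) + t1 * `|ln t1| + 2 * C * t1 * Num.sqrt t1.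
pose K2 := 4 * t1 * t2 + t1 * `|ln (t1 / 2)|.
have t10 := ltW t1_gt0; have t20 : 0 <= t2 := ltW (lt_le_trans t1_gt0 t12).
have K10 : 0 <= K1 by rewrite /K1 !addr_ge0// !mulr_ge0// addr_ge0// mulr_ge0.
have K20 : 0 <= K2 by rewrite /K2 !addr_ge0// !mulr_ge0.
exists (K1 + K2) => N N1 tN J; have N0 : 0 <= N by lra.
have -> : J = (\int[mu]_s slice N s)%E by [].
have a0 := cut_gt0 N1.
split.
  apply: (@le_trans _ _ (\int[mu]_s (
      (if (0 < s <= N ^- 2)%R then (b1 N s)%:E else 0) +
      (if (N ^- 2 <= s <= t1)%R then (b2 N s)%:E else 0)))%E).
    apply: ge0_le_integral => //.
    - exact: measurable_slice.
    - by apply: emeasurable_funD; [exact: mif0|exact: mif].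
    - by move=> s _; exact: slice_upper.
  rewrite ge0_integralD//; last 4 first.
  - by move=> s _; case: ifP => // _; rewrite lee_fin b1_ge0.
  - exact: mif0.
  - move=> s _; case: ifP => // /andP[h _].
    by rewrite lee_fin b2_ge0// ltW// (lt_le_trans a0).
  - exact: mif.
  apply: (le_trans (leeD (integral_b1 N1) (integral_b2 N1 tN))).
  rewrite -EFinD lee_fin.
  have h1 : t1 * N * ln t1 <= t1 * `|ln t1| * N.
    by rewrite mulrAC ler_wpM2r// ler_wpM2l// ler_norm.
  have h2 : 0 <= K2 * N by rewrite mulr_ge0.
  by rewrite mulrDl {1}/K1; nra.
have lo : (\int[mu]_s (if (N ^- 2 <= s <= t1 / 2)%R then (t1 * N * s^-1)%:E else 0) <=
    \int[mu]_s slice N s + (4 * t1 * t2 * N)%:E)%E.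
  apply: (@le_trans _ _ (\int[mu]_s (slice N s +
      (if (N ^- 2 <= s <= t1 / 2)%R then (b3 s)%:E else 0)))%E).
    apply: ge0_le_integral => //.
    - move=> s _; case: ifP => // /andP[h _].
      by rewrite lee_fin !mulr_ge0// invr_ge0 ltW// (lt_le_trans a0).
    - by apply: mif; apply: measurable_funM => //; exact: measurable_funV_real.
    - by apply: emeasurable_funD; [exact: measurable_slice|exact: mif].
    - by move=> s _; exact: slice_lower.
  rewrite ge0_integralD//; last 3 first.
  - exact: measurable_slice.
  - move=> s _; case: ifP => // /andP[h _].
    rewrite lee_fin /b3 mulr_ge0 ?mulr_ge0// invr_ge0 mulr_ge0//.
    by rewrite ltW// (lt_le_trans a0).
  - exact: mif.
  by apply: leeD => //; exact: integral_b3.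
rewrite integral_lower// in lo.
apply: (@le_trans _ _ ((t1 * N * (ln (t1 / 2) + 2 * ln N))%:E +
    (t1 * `|ln (t1 / 2)| * N)%:E)%E).
  rewrite -EFinD lee_fin.
  have : - (t1 * N * `|ln (t1 / 2)|) <= t1 * N * ln (t1 / 2).
    by rewrite -mulrN ler_wpM2l ?mulr_ge0// lerNl ler_normr lexx orbT.
  by nra.
apply: (le_trans (leeD lo (lexx _))).
rewrite -addeA leeD2l// -EFinD lee_fin.
have h1 : 0 <= K1 * N by rewrite mulr_ge0.
by rewrite mulrDl {1}/K2; nra.
Qed.

End window_asymptotics.

(** * Covariance and relative variance of the solution *)

Section pam_moments.
Context {R : realType} {d : measure_display} {T : measurableType d}.
Variable P : probability T R.
Variable eta : set (R * R) -> {RV P >-> R}.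
Hypothesis heta : white_noise eta.
Variable u : R -> R -> T -> R.
Hypothesis hu : pam_solution eta u.
Local Notation mu := (@lebesgue_measure R).
Local Notation PP := (P \x @plane_measure R)%E.
Implicit Types s t x y : R.

Lemma Lnorm2_le (X : T -> R) (k : R) :
  ('N[P]_2%:E[EFin \o X] <= k%:E)%E ->
  (\int[P]_w (X w ^+ 2)%:E <= (k ^+ 2)%:E)%E.
Proof.
move=> h.
have k0 : 0 <= k by rewrite -lee_fin; apply: le_trans h; exact: Lnorm_ge0.
move: h; rewrite unlock.
have -> : (\int[P]_x `|(EFin \o X) x| `^ 2 = \int[P]_w (X w ^+ 2)%:E)%E.
  apply: eq_integral => w _ /=.
  by rewrite powR_mulrn// real_normK ?num_real.
set I := (\int[P]_w _)%E => h.
have I0 : (0 <= I)%E by apply: integral_ge0 => w _; rewrite lee_fin sqr_ge0.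
have -> : I = ((I `^ 2^-1) `^ 2)%E by rewrite -poweRrM mulVf// poweRe1.
apply: (@le_trans _ _ (k%:E `^ 2)%E); last by rewrite /= powR_mulrn.
apply: gt0_ler_poweR => //; rewrite in_itv/= leey andbT//.
exact: poweR_ge0.
Qed.

Lemma pam_measurable t x : 0 < t -> measurable_fun setT (u t x).
Proof.
case: hu => adap _ _ _ t0.
exact: adapted_measurable (noise_measurable_adapted (adap t x t0)).
Qed.

Definition second_moment (z : R * R) : \bar R :=
  (\int[P]_w (u z.1 z.2 w ^+ 2)%:E)%E.

Definition propagator t x (z : R * R) : R :=
  if (0 < z.1) && (z.1 < t) then heat_kernel (t - z.1) (x - z.2) else 0.

Definition pam_integrand t x (z : T * (R * R)) : R :=
  propagator t x z.2 * u z.2.1 z.2.2 z.1.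

Lemma propagator_ge0 t x z : 0 <= propagator t x z.
Proof. by rewrite /propagator; case: ifP => // _; exact: heat_kernel_ge0. Qed.

Lemma measurable_propagator t x : measurable_fun setT (propagator t x).
Proof.
apply: measurable_fun_ifT; last exact: measurable_cst.
  by apply: measurable_and; exact: measurable_fun_ltr.
by apply: measurable_heat_kernel2; exact: measurable_funB.
Qed.

Lemma pam_walsh t x : 0 < t -> exists2 I : {RV P >-> R},
  walsh_integral eta (pam_integrand t x) I &
  {ae P, forall w, u t x w = heat_kernel t x + I w}.
Proof.
case: hu => _ _ eqn _ t0; have [I WI aeI] := eqn t x t0; exists I => //.
rewrite (_ : pam_integrand t x = fun z => let: (w, (s, y)) := z in
  if (0 < s) && (s < t) then heat_kernel (t - s) (x - y) * u s y w else 0)//.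
apply/funext => -[w [s y]]; rewrite /pam_integrand /propagator/=.
by case: ifP => _ //; rewrite mul0r.
Qed.

Lemma measurable_pam_integrand t x : 0 < t ->
  measurable_fun setT (pam_integrand t x).
Proof.
by move=> t0; have [I [/predictable_measurable]] := pam_walsh x t0.
Qed.

Lemma pam_centered_square_integrable t x : 0 < t ->
  square_integrable P (fun w => u t x w - heat_kernel t x).
Proof.
move=> t0; have [I WI aeI] := pam_walsh x t0.
have [_ [mI iI]] := walsh_square_integrable heta WI.
have mu' : measurable_fun setT (fun w => u t x w - heat_kernel t x).
  by apply: measurable_funB => //; exact: pam_measurable.
apply: square_integrableP => //.
have -> : (\int[P]_w ((u t x w - heat_kernel t x) ^+ 2)%:E =
    \int[P]_w (I w ^+ 2)%:E)%E.
  apply: ae_eq_integral => //.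
  - by apply/measurable_EFinP; exact: measurable_funX.
  - by apply/measurable_EFinP; exact: measurable_funX.
  - by apply: filterS aeI => w -> _; rewrite addrAC subrr add0r.
by have := integrable_fin_num measurableT iI; rewrite ge0_fin_numE//;
  apply: integral_ge0 => w _; rewrite lee_fin sqr_ge0.
Qed.

Lemma pam_centered_mean t x : 0 < t ->
  \int[P]_w (u t x w - heat_kernel t x) = 0.
Proof.
move=> t0; have [I WI aeI] := pam_walsh x t0.
rewrite -(walsh_mean heta WI); congr fine; apply: ae_eq_integral => //.
- by apply/measurable_EFinP; apply: measurable_funB => //; exact: pam_measurable.
- exact/measurable_EFinP.
- by apply: filterS aeI => w -> _; rewrite addrAC subrr add0r.
Qed.

Lemma pam_integrand_mulE t x t' x' z :
  pam_integrand t x z * pam_integrand t' x' z =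
  propagator t x z.2 * propagator t' x' z.2 * u z.2.1 z.2.2 z.1 ^+ 2.
Proof. by rewrite /pam_integrand; ring. Qed.

Lemma pam_integrand_mul_ge0 t x t' x' z :
  0 <= pam_integrand t x z * pam_integrand t' x' z.
Proof.
rewrite pam_integrand_mulE mulr_ge0 ?sqr_ge0// mulr_ge0//; exact: propagator_ge0.
Qed.

Lemma pam_integrand_mul_mean t x t' x' z :
  (\int[P]_w (pam_integrand t x (w, z) * pam_integrand t' x' (w, z))%:E =
   (propagator t x z * propagator t' x' z)%:E * second_moment z)%E.
Proof.
case: z => s y; under eq_integral do rewrite pam_integrand_mulE/= EFinM.
have [s0|s0] := ltP 0 s; last first.
  have -> : propagator t x (s, y) = 0 by rewrite /propagator/= ltNge s0.
  by rewrite mul0r mul0e; apply: integral0_eq => w _; rewrite mul0e.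
rewrite ge0_integralZl//.
- by apply/measurable_EFinP; apply: measurable_funX; exact: pam_measurable.
- by move=> w _; rewrite lee_fin sqr_ge0.
- by rewrite lee_fin mulr_ge0 ?propagator_ge0.
Qed.

(** Both Walsh integrands contain the same [u s y], so their product is two nonnegative kernels
    times a square, and Tonelli applies to the isometry. *)
Lemma pam_covariance t x t' x' : 0 < t -> 0 < t' ->
  ((\int[P]_w ((u t x w - heat_kernel t x) * (u t' x' w - heat_kernel t' x')))%:E =
   \int[@plane_measure R]_z ((propagator t x z * propagator t' x' z)%:E *
     second_moment z))%E.
Proof.
move=> t0 t'0; have [I WI aeI] := pam_walsh x t0.
have [J WJ aeJ] := pam_walsh x' t'0.
have -> : \int[P]_w ((u t x w - heat_kernel t x) * (u t' x' w - heat_kernel t' x')) =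
    \int[P]_w (I w * J w).
  congr fine; apply: ae_eq_integral => //.
  - apply/measurable_EFinP; apply: measurable_funM;
      by apply: measurable_funB => //; exact: pam_measurable.
  - by apply/measurable_EFinP; exact: measurable_funM.
  - apply: filterS2 aeI aeJ => w -> -> _.
    by rewrite [_ + I w]addrC addrK [_ + J w]addrC addrK.
rewrite (walsh_isometry heta WI WJ).
have [sI _] := walsh_square_integrable heta WI.
have [sJ _] := walsh_square_integrable heta WJ.
rewrite -(Rintegral_EFin (integrableM_sqr sI sJ)).
have mF : measurable_fun setT (fun z : T * (R * R) =>
    (pam_integrand t x z * pam_integrand t' x' z)%:E).
  by apply/measurable_EFinP; apply: measurable_funM; [case: sI|case: sJ].
rewrite (@fubini_tonelli2 _ _ _ _ _ P (@plane_measure R) _ mF); last first.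
  by move=> z; rewrite lee_fin pam_integrand_mul_ge0.
by apply: eq_integral => z _; exact: pam_integrand_mul_mean.
Qed.

(** The predictable integrands are jointly measurable, so the mean of their product is measurable in
    space-time. This yields the second moment multiplied by two propagators, hence the form of the
    statement. *)
Lemma measurable_propagator_moment t x t' x' : 0 < t -> 0 < t' ->
  measurable_fun setT (fun z =>
    (propagator t x z * propagator t' x' z)%:E * second_moment z)%E.
Proof.
move=> t0 t'0.
have mF : measurable_fun setT (fun z : T * (R * R) =>
    (pam_integrand t x z * pam_integrand t' x' z)%:E).
  by apply/measurable_EFinP; apply: measurable_funM; exact: measurable_pam_integrand.
have F0 (z : T * (R * R)) : (0 <= (pam_integrand t x z * pam_integrand t' x' z)%:E)%E.
  by rewrite lee_fin pam_integrand_mul_ge0.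
have := @measurable_fun_fubini_tonelli_G _ _ _ _ _ P _ mF F0.
congr (measurable_fun _ _); apply/funext => z.
exact: pam_integrand_mul_mean.
Qed.

Lemma second_moment_ge0 z : (0 <= second_moment z)%E.
Proof. by apply: integral_ge0 => w _; rewrite lee_fin sqr_ge0. Qed.

Lemma second_moment_decomp t x : 0 < t -> second_moment (t, x) =
  (heat_kernel t x ^+ 2 +
   \int[P]_w ((u t x w - heat_kernel t x) ^+ 2))%:E.
Proof.
move=> t0; set p := heat_kernel t x.
have sU := pam_centered_square_integrable x t0; have [mU iU] := sU.
have iU1 := square_integrable_integrable sU.
have icst (k : R) : P.-integrable setT (EFin \o cst k).
  exact/square_integrable_integrable/square_integrable_cst.
have i2 : P.-integrable setT (EFin \o (fun w => (2 * p) * (u t x w - p))).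
  have := integrableZl measurableT (2 * p) iU1.
  by apply: eq_integrable => // w _; rewrite /= EFinM.
have i3 : P.-integrable setT (EFin \o (fun w => (u t x w - p) ^+ 2 +
    (2 * p) * (u t x w - p))).
  have := integrableD measurableT iU i2.
  by apply: eq_integrable => // w _; rewrite /= EFinD.
have i4 : P.-integrable setT (EFin \o (fun w => (u t x w - p) ^+ 2 +
    (2 * p) * (u t x w - p) + cst (p ^+ 2) w)).
  have := integrableD measurableT i3 (icst (p ^+ 2)).
  by apply: eq_integrable => // w _; rewrite /= EFinD.
have e w : u t x w ^+ 2 = (u t x w - p) ^+ 2 + (2 * p) * (u t x w - p) +
    cst (p ^+ 2) w by rewrite /=; ring.
rewrite /second_moment/=; under eq_integral do rewrite e.
rewrite (Rintegral_EFin i4) (RintegralD measurableT i3 (icst _)).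
rewrite (RintegralD measurableT iU i2) (RintegralZl _ measurableT iU1).
rewrite pam_centered_mean// mulr0 addr0 addrC; congr (_ + _)%:E.
apply: etrans (Rintegral_cst P measurableT (p ^+ 2)) _.
apply: etrans (mulr1 _); apply: (congr1 (fun k => p ^+ 2 * k)).
exact: (congr1 fine (probability_setT P)).
Qed.

Lemma second_moment_ge t x : 0 < t ->
  ((heat_kernel t x ^+ 2)%:E <= second_moment (t, x))%E.
Proof.
move=> t0; rewrite second_moment_decomp// lee_fin lerDl.
by apply: Rintegral_ge0 => w _; exact: sqr_ge0.
Qed.

(** The a priori bound on the second moment goes once into the covariance formula. By [bridgeE] the
    squared kernel at [(t, x)] factors out and leaves a squared bridge density: one factor is
    bounded by its maximum, the other has mass 1 in space. The maxima integrate in time to at most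
    [4 sqrt t], hence the constant [4 * c ^+ 2]. *)
Lemma pam_variance_le t0 : 0 < t0 -> exists2 C : R, 0 <= C &
  forall t x, 0 < t -> t <= t0 ->
  \int[P]_w ((u t x w - heat_kernel t x) ^+ 2) <=
    C * Num.sqrt t * heat_kernel t x ^+ 2.
Proof.
move=> t00; have [_ + _ _] := hu => /(_ _ t00)[c hc].
exists (4 * c ^+ 2); first by rewrite mulr_ge0 ?sqr_ge0.
move=> t x tgt0 tt0; set p := heat_kernel t x.
have M_le s y : 0 < s -> s <= t0 ->
    (second_moment (s, y) <= ((c * heat_kernel s y) ^+ 2)%:E)%E.
  by move=> s0 st; apply: Lnorm2_le; exact: hc.
rewrite -lee_fin; under eq_Rintegral do rewrite expr2.
rewrite pam_covariance//.
pose h s : \bar R := if (0 < s < t)%R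
  then ((Num.sqrt (s * (t - s) / t))^-1)%:E else 0%E.
have mh : measurable_fun [set: R] h.
  apply: measurable_fun_ifT; [| |exact: measurable_cst].
    by apply: measurable_and; exact: measurable_fun_ltr.
  apply/measurable_EFinP/measurable_funV_real/measurable_fun_sqrt.
  by apply: measurable_funM => //; apply: measurable_funM => //; exact: measurable_funB.
have h0 s : (0 <= h s)%E.
  by rewrite /h; case: ifP => // _; rewrite lee_fin invr_ge0.
pose F (z : R * R) : \bar R := ((c ^+ 2 * p ^+ 2)%:E *
  (h z.1 * (bridge t x z.1 z.2)%:E))%E.
have F0 z : (0 <= F z)%E.
  by rewrite /F !mule_ge0// lee_fin ?bridge_ge0// mulr_ge0 ?sqr_ge0.
have mF : measurable_fun setT F.
  apply: measurable_funeM; apply: emeasurable_funM; first exact: (measurableT_comp mh).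
  apply/measurable_EFinP; apply: measurable_heat_kernel2.
    by apply: measurable_funM => //; apply: measurable_funM => //; exact: measurable_funB.
  by apply: measurable_funB => //; apply: measurable_funM => //; exact: measurable_funM.
apply: (@le_trans _ _ (\int[@plane_measure R]_z F z)%E).
  apply: ge0_le_integral => //.
  - by move=> z _; rewrite mule_ge0 ?second_moment_ge0// lee_fin mulr_ge0 ?propagator_ge0.
  - exact: measurable_propagator_moment.
  move=> [s y] _; rewrite /F /h /propagator/=.
  case: ifP => [/andP[s0 st]|_]; last by rewrite mul0r !mul0e mule0.
  apply: (le_trans (lee_wpmul2l _ (M_le s y s0 (le_trans (ltW st) tt0)))).
    by rewrite lee_fin mulr_ge0 ?heat_kernel_ge0.
  rewrite -!EFinM lee_fin.
  have e := bridgeE x y s0 st.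
  have -> : heat_kernel (t - s) (x - y) * heat_kernel (t - s) (x - y) *
      (c * heat_kernel s y) ^+ 2 =
      c ^+ 2 * (heat_kernel (t - s) (x - y) * heat_kernel s y) ^+ 2 by ring.
  rewrite e -/p exprMn [leLHS]mulrA ler_wpM2l//.
    by apply: mulr_ge0; exact: sqr_ge0.
  rewrite expr2 ler_wpM2r ?bridge_ge0//.
  apply: (le_trans (bridge_ub x y s0 st)).
  have := bridge_var_gt0 s0 st; have pi2 := pi_ge2 R.
  move: (s * (t - s) / t) => v v0; have pv0 : 0 < 2 * pi * v by nra.
  by rewrite lef_pV2 ?posrE ?sqrtr_gt0// ler_sqrt; nra.
rewrite fubini_tonelli1//= /fubini_F/=.
have k0 : (0 <= (c ^+ 2 * p ^+ 2)%:E)%E by rewrite lee_fin mulr_ge0 ?sqr_ge0.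
have -> : (\int[mu]_s \int[mu]_y F (s, y) =
    \int[mu]_s ((c ^+ 2 * p ^+ 2)%:E * h s))%E.
  apply: eq_integral => s _; rewrite /F/=.
  have [s01|s01] := boolP (0 < s < t); last first.
    rewrite /h (negbTE s01) mule0; apply: integral0_eq => y _.
    by rewrite mul0e mule0.
  have [s0 st] := andP s01.
  under eq_integral do rewrite muleA.
  rewrite ge0_integralZl//.
  - by rewrite integral_bridge// mule1.
  - by apply/measurable_EFinP; exact: measurable_bridge.
  - by move=> y _; rewrite lee_fin bridge_ge0.
  - by rewrite mule_ge0.
rewrite ge0_integralZl//.
apply: (le_trans (lee_wpmul2l k0 (integral_inv_sqrt_bridge tgt0))).
by rewrite -EFinM lee_fin le_eqVlt; apply/orP; left; apply/eqP; ring.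
Qed.

End pam_moments.

(** * Fubini for spatial averages of random fields *)

Section product_average.
Context {d1 d2} {T1 : measurableType d1} {T2 : measurableType d2} {R : realType}.
Variables (m1 : {sigma_finite_measure set T1 -> \bar R})
  (m2 : {sigma_finite_measure set T2 -> \bar R}).

Lemma Rintegral_prod_mul (f : T1 -> R) (g : T2 -> R) :
  m1.-integrable setT (EFin \o f) -> m2.-integrable setT (EFin \o g) ->
  (m1 \x m2)%E.-integrable setT (EFin \o (fun z => f z.1 * g z.2)) /\
  \int[(m1 \x m2)%E]_z (f z.1 * g z.2) = (\int[m1]_x f x) * (\int[m2]_y g y).
Proof.
move=> fi gi.
have mf : measurable_fun setT f by apply/measurable_EFinP; case/integrableP : fi.
have mg : measurable_fun setT g by apply/measurable_EFinP; case/integrableP : gi.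
have mabs (d : measure_display) (T : measurableType d) (h : T -> R) :
    measurable_fun setT h -> measurable_fun setT (fun x => `|h x|%:E).
  by move=> mh; apply/measurable_EFinP; exact: measurableT_comp.
have gfin : (\int[m2]_y `|g y|%:E)%E \is a fin_num.
  exact: integrable_fin_num (integrable_norm gi).
have ffin : (\int[m1]_y `|f y|%:E)%E \is a fin_num.
  exact: integrable_fin_num (integrable_norm fi).
have i : (m1 \x m2)%E.-integrable setT (EFin \o (fun z => f z.1 * g z.2)).
  apply/integrable12ltyP.
    apply/measurable_EFinP; apply: measurable_funM; exact: measurableT_comp.
  under eq_integral => x _.
    under eq_integral do rewrite /= normrM EFinM.
    rewrite ge0_integralZl//; last exact: mabs.
    over.
  rewrite ge0_integralZr//; last 2 first.
  - exact: mabs.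
  - by apply: integral_ge0.
  by rewrite -(fineK ffin) -(fineK gfin) -EFinM ltry.
split => //; rewrite /Rintegral -integral12_prod_meas1//= /fubini_F/=.
under eq_integral => x _.
  under eq_integral do rewrite EFinM.
  rewrite integralZl//; over.
have gfin' := integrable_fin_num measurableT gi.
rewrite -(fineK gfin') integralZr// fineM//.
exact: integrable_fin_num.
Qed.

End product_average.

Section average.
Context {d} {T : measurableType d} {R : realType}.
Variable P : probability T R.
Local Notation mu := (@lebesgue_measure R).
Variables (D : set R) (V : R).
Hypotheses (mD : measurable D) (Doo : (mu D < +oo)%E).

Let V_ge0 (f : T * R -> R) :
  (forall x, (\int[P]_w (f (w, x) ^+ 2)%:E <= V%:E)%E) -> 0 <= V.
Proof.
move=> fV; rewrite -lee_fin; apply: le_trans (fV 0); apply: integral_ge0 => w _.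
by rewrite lee_fin sqr_ge0.
Qed.

Let Dfin : mu D \is a fin_num. Proof. by rewrite ge0_fin_numE. Qed.

Let integral_D : (\int[mu]_x (\1_D x)%:E = (fine (mu D))%:E)%E.
Proof. by rewrite fineK// integral_indic// setIT. Qed.

(** The indicator replaces the restricted domain, so that Fubini is applied on the full product
    space. *)
Let cut (f : T * R -> R) (z : T * R) : R := f z * \1_D z.2.

Let measurable_cut (f : T * R -> R) : measurable_fun setT f -> measurable_fun setT (cut f).
Proof.
move=> mf; apply: measurable_funM => //.
by apply: measurableT_comp => //; exact: measurable_indic.
Qed.

Let measurable_slice (f : T * R -> R) (x : R) : measurable_fun setT f ->
  measurable_fun setT (fun w => f (w, x) : R).
Proof.
move=> mf; apply: (measurableT_comp mf).
exact: (measurable_fun_pair (@measurable_id _ T setT) (measurable_cst x)).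
Qed.

Let integrable_cut (f : T * R -> R) : measurable_fun setT f ->
  (forall x, (\int[P]_w (f (w, x) ^+ 2)%:E <= V%:E)%E) ->
  (P \x mu)%E.-integrable setT (EFin \o cut f).
Proof.
move=> mf fV; have V0 := V_ge0 fV; apply/integrable21ltyP; first by apply/measurable_EFinP; exact: measurable_cut.
apply: (@le_lt_trans _ _ (\int[mu]_x ((1 + V)%:E * (\1_D x)%:E))%E).
  apply: ge0_le_integral => //.
  - by move=> x _; apply: integral_ge0.
  - apply: (@measurable_fun_fubini_tonelli_G _ _ _ _ _ P
      (fun z : T * R => `|(EFin \o cut f) z|%E)) => //.
    apply: measurableT_comp => //; apply/measurable_EFinP; exact: measurable_cut.
  - by apply: measurable_funeM; apply/measurable_EFinP; exact: measurable_indic.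
  move=> x _; have [xD|xD] := boolP (x \in D); last first.
    rewrite /cut/= indicE (negbTE xD) mulr0n.
    under eq_integral do rewrite mulr0 normr0.
    by rewrite integral0 mule0.
  rewrite indicE xD mulr1n mule1 /cut/=.
  apply: (@le_trans _ _ (\int[P]_w (1 + (f (w, x) ^+ 2)%:E))%E).
    apply: ge0_le_integral => //.
    - apply/measurable_EFinP; apply: measurableT_comp => //.
      by apply: measurable_funM => //; exact: measurable_slice.
    - apply: emeasurable_funD => //; apply/measurable_EFinP.
      by apply: measurable_funX; exact: measurable_slice.
    move=> w _; rewrite indicE xD mulr1 -EFinD lee_fin.
    have := sqr_ge0 (`|f (w, x)| - 1); have := normr_ge0 (f (w, x)).
    by rewrite -(real_normK (num_real (f (w, x)))); nra.
  rewrite ge0_integralD//; last 2 first.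
  - by move=> w _; rewrite lee_fin sqr_ge0.
  - by apply/measurable_EFinP; apply: measurable_funX; exact: measurable_slice.
  rewrite EFinD; apply: leeD => //.
  have := integral_cst P measurableT 1%:E; rewrite mul1e => /= ->.
  by rewrite probability_setT.
rewrite ge0_integralZl//.
- by rewrite integral_D -EFinM ltry.
- by apply/measurable_EFinP; exact: measurable_indic.
- by rewrite lee_fin addr_ge0.
Qed.

Let avg (f : T * R -> R) (w : T) : R := \int[mu]_(x in D) f (w, x).

(** The real integral is the [fine] of the extended one, so an infinite value is read as 0. For an
    integrable [cut f] the slices are integrable for almost every [w], so this affects only a null
    set. *)
Let avgE f w : avg f w = fine (fubini_F mu (EFin \o cut f) w).
Proof.
rewrite /avg /fubini_F /Rintegral integral_mkcond; congr fine.
apply: eq_integral => x _; rewrite patchE /cut/= indicE.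
by case: ifP => _; rewrite ?mulr1 ?mulr0.
Qed.

Lemma average_integrable (f : T * R -> R) : measurable_fun setT f ->
  (forall x, (\int[P]_w (f (w, x) ^+ 2)%:E <= V%:E)%E) ->
  measurable_fun setT (fun w => \int[mu]_(x in D) f (w, x)) /\
  P.-integrable setT (EFin \o (fun w => \int[mu]_(x in D) f (w, x))).
Proof.
move=> mf fV; have i := integrable_cut mf fV.
have iF := integrable_fubini_F i.
have mA : measurable_fun setT (fun w => \int[mu]_(x in D) f (w, x)).
  rewrite (_ : (fun w => _) = fine \o fubini_F mu (EFin \o cut f)).
    by apply: measurableT_comp; [exact: fine_measurable|exact: measurable_fubini_F i].
  by apply/funext => w; exact: avgE.
split => //; apply: le_integrable iF => //; first exact/measurable_EFinP.
move=> w _ /=; rewrite -/(avg f w) avgE.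
by case: (fubini_F _ _ w) => [r| |] //=; rewrite normr0 leey.
Qed.

Lemma average_mean (f : T * R -> R) : measurable_fun setT f ->
  (forall x, (\int[P]_w (f (w, x) ^+ 2)%:E <= V%:E)%E) ->
  (forall x, \int[P]_w f (w, x) = 0) ->
  \int[P]_w \int[mu]_(x in D) f (w, x) = 0.
Proof.
move=> mf fV f0; have i := integrable_cut mf fV.
have [mA _] := average_integrable mf fV.
transitivity (fine (\int[P]_w fubini_F mu (EFin \o cut f) w)%E).
  congr fine; apply: ae_eq_integral => //.
  - exact/measurable_EFinP.
  - exact: measurable_fubini_F i.
  apply: filterS (ae_integrable1 i) => w iw _.
  rewrite -/(avg f w) avgE fineK//.
  exact: (integrable_fin_num measurableT iw).
rewrite integral12_prod_meas1// -integral21_prod_meas1//.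
rewrite (_ : (\int[mu]_x _)%E = 0%E)//.
apply: integral0_eq => x _; rewrite /fubini_G/= /cut/=.
have ix : P.-integrable setT (EFin \o (fun w => f (w, x))).
  apply: square_integrable_integrable; apply: square_integrableP.
    exact: measurable_slice.
  by apply: le_lt_trans (fV x) _; rewrite ltry.
under eq_integral do rewrite EFinM.
rewrite integralZr// (Rintegral_EFin ix) f0 mul0e//.
Qed.

(** For almost every [w] both slices are integrable, and the product of the averages is one integral
    over the plane. The exchange with [P] is allowed since [|f1 f2| <= f1 ^ 2 + f2 ^ 2] has mean at
    most [V + V] and the square of [D] has finite measure. *)
Lemma average_mul (f1 f2 : T * R -> R) :
  measurable_fun setT f1 -> measurable_fun setT f2 ->
  (forall x, (\int[P]_w (f1 (w, x) ^+ 2)%:E <= V%:E)%E) ->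
  (forall x, (\int[P]_w (f2 (w, x) ^+ 2)%:E <= V%:E)%E) ->
  P.-integrable setT (EFin \o (fun w =>
    (\int[mu]_(x in D) f1 (w, x)) * (\int[mu]_(x in D) f2 (w, x)))) /\
  (\int[P]_w ((\int[mu]_(x in D) f1 (w, x)) *
     (\int[mu]_(x in D) f2 (w, x)))%:E =
   \int[@plane_measure R]_z
     ((\int[P]_w (f1 (w, z.1) * f2 (w, z.2))) * (\1_D z.1 * \1_D z.2))%:E)%E.
Proof.
move=> mf1 mf2 V1 V2; have V0 := V_ge0 V1.
pose h (p : T * (R * R)) : R := cut f1 (p.1, p.2.1) * cut f2 (p.1, p.2.2).
have s1 x : square_integrable P (fun w => f1 (w, x)).
  apply: square_integrableP; first exact: measurable_slice.
  by apply: le_lt_trans (V1 x) _; rewrite ltry.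
have s2 x : square_integrable P (fun w => f2 (w, x)).
  apply: square_integrableP; first exact: measurable_slice.
  by apply: le_lt_trans (V2 x) _; rewrite ltry.
have mh : measurable_fun setT h.
  apply: measurable_funM.
    apply: (measurableT_comp (measurable_cut mf1)).
    apply: measurable_fun_pair => //; exact: measurableT_comp.
  apply: (measurableT_comp (measurable_cut mf2)).
  apply: measurable_fun_pair => //; exact: measurableT_comp.
have hE w x y : h (w, (x, y)) = (f1 (w, x) * f2 (w, y)) * (\1_D x * \1_D y).
  by rewrite /h /cut/=; ring.
have DD0 x y : 0 <= \1_D x * \1_D y :> R by rewrite mulr_ge0.
have mDD : measurable_fun setT (fun z : R * R => (\1_D z.1 * \1_D z.2 : R)%:E).
  apply/measurable_EFinP; apply: measurable_funM;
    by apply: measurableT_comp => //; exact: measurable_indic.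
have hi : (P \x @plane_measure R)%E.-integrable setT (EFin \o h).
  apply/integrable21ltyP; first exact/measurable_EFinP.
  apply: (@le_lt_trans _ _ (\int[@plane_measure R]_z
      ((V + V)%:E * (\1_D z.1 * \1_D z.2)%:E))%E).
    apply: ge0_le_integral => //.
    - by move=> x _; apply: integral_ge0.
    - apply: (@measurable_fun_fubini_tonelli_G _ _ _ _ _ P
        (fun z : T * (R * R) => `|(EFin \o h) z|%E)) => //.
      by apply: measurableT_comp => //; exact/measurable_EFinP.
    - exact: measurable_funeM.
    move=> [x y] _ /=; have [[mx ix] [my iy]] := (s1 x, s2 y).
    under eq_integral do rewrite hE normrM (ger0_norm (DD0 _ _)) EFinM.
    rewrite ge0_integralZr//; last first.
      apply/measurable_EFinP; apply: measurableT_comp => //.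
      exact: measurable_funM.
    rewrite lee_wpmul2r//.
    apply: (@le_trans _ _ (\int[P]_w ((f1 (w, x) ^+ 2)%:E + (f2 (w, y) ^+ 2)%:E))%E).
      apply: ge0_le_integral => //.
      - apply/measurable_EFinP; apply: measurableT_comp => //.
        exact: measurable_funM.
      - by apply: emeasurable_funD; apply/measurable_EFinP; exact: measurable_funX.
      move=> w _; rewrite -EFinD lee_fin normrM.
      rewrite -(real_normK (num_real (f1 (w, x)))) -(real_normK (num_real (f2 (w, y)))).
      have := sqr_ge0 (`|f1 (w, x)| - `|f2 (w, y)|); have := normr_ge0 (f1 (w, x)).
      by have := normr_ge0 (f2 (w, y)); nra.
    rewrite ge0_integralD//; last 4 first.
    - by move=> w _; rewrite lee_fin sqr_ge0.
    - by apply/measurable_EFinP; exact: measurable_funX.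
    - by move=> w _; rewrite lee_fin sqr_ge0.
    - by apply/measurable_EFinP; exact: measurable_funX.
    by rewrite EFinD; exact: leeD.
  rewrite ge0_integralZl//; last by rewrite lee_fin addr_ge0.
  have iD : mu.-integrable setT (EFin \o (\1_D : R -> R)).
    apply/integrableP; split; first by apply/measurable_EFinP; exact: measurable_indic.
    under eq_integral do rewrite /= ger0_norm//.
    by rewrite integral_D ltry.
  have [iDD _] := Rintegral_prod_mul iD iD.
  have := integrable_fin_num measurableT iDD => /fineK <-.
  by rewrite -EFinM ltry.
have [mA1 iA1] := average_integrable mf1 V1.
have [mA2 iA2] := average_integrable mf2 V2.
have mA12 : measurable_fun setT (fun w =>
    (\int[mu]_(x in D) f1 (w, x)) * (\int[mu]_(x in D) f2 (w, x))).
  exact: measurable_funM.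
have aeF : ae_eq P setT (fun w => ((\int[mu]_(x in D) f1 (w, x)) *
    (\int[mu]_(x in D) f2 (w, x)))%:E)
    (fubini_F (@plane_measure R) (EFin \o h)).
  apply: filterS2 (ae_integrable1 (integrable_cut mf1 V1))
    (ae_integrable1 (integrable_cut mf2 V2)) => w i1 i2 _.
  have [i12 E12] := Rintegral_prod_mul i1 i2.
  rewrite -/(avg f1 w) -/(avg f2 w) !avgE /fubini_F.
  apply: etrans (esym (Rintegral_EFin i12)).
  by rewrite E12.
have iF := integrable_fubini_F hi.
have mF := measurable_fubini_F hi.
split.
  apply/integrableP; split; first exact/measurable_EFinP.
  move/integrableP : iF => [_]; apply: le_lt_trans.
  rewrite le_eqVlt; apply/orP; left; apply/eqP.
  apply: ae_eq_integral => //.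
  - by apply: measurableT_comp => //; exact/measurable_EFinP.
  - exact: measurableT_comp.
  - by apply: filterS aeF => w h1 _ /=; rewrite -h1.
transitivity (\int[P]_w fubini_F (@plane_measure R) (EFin \o h) w)%E.
  by apply: ae_eq_integral => //; exact/measurable_EFinP.
rewrite integral12_prod_meas1// -integral21_prod_meas1//.
apply: eq_integral => -[x y] _; rewrite /fubini_G/=.
under eq_integral do rewrite hE EFinM.
have ixy := integrableM_sqr (s1 x) (s2 y).
by rewrite integralZr// (Rintegral_EFin ixy) -EFinM.
Qed.

End average.

(** * Covariance of the normalised field *)

Section normalized_field.
Context {R : realType} {d : measure_display} {T : measurableType d}.
Variable P : probability T R.
Variable eta : set (R * R) -> {RV P >-> R}.
Hypothesis heta : white_noise eta.
Variable u : R -> R -> T -> R.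
Hypothesis hu : pam_solution eta u.
Local Notation mu := (@lebesgue_measure R).
Implicit Types s t x y : R.

Definition fluctuation t (z : T * R) : R := normalized_field u t z.2 z.1 - 1.

(** The Walsh integrand for the later point [(t + 1, 0)] is jointly measurable. Restricted to the
    time slice [t], it is [u] times a positive kernel that can be divided out. *)
Lemma measurable_fluctuation t : 0 < t -> measurable_fun setT (fluctuation t).
Proof.
move=> t0; pose k (z : T * R) : T * (R * R) := (z.1, (t, z.2)).
have mk : measurable_fun setT k.
  by apply: measurable_fun_pair => //; exact: measurable_fun_pair.
have -> : fluctuation t = fun z => pam_integrand u (t + 1) 0 (k z) *
    (propagator (t + 1) 0 (t, z.2))^-1 * (heat_kernel t z.2)^-1 - 1.
  apply/funext => z; rewrite /fluctuation /normalized_field /pam_integrand/=.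
  have k0 : propagator (t + 1) 0 (t, z.2) != 0.
    rewrite /propagator/= t0 ltrDl ltr01/= gt_eqF// heat_kernel_gt0//.
    by rewrite addrAC subrr add0r.
  by congr (_ * _ - _); rewrite mulrAC mulfV// mul1r.
have m2 : measurable_fun setT (fun z : T * R => z.2) by exact: measurable_snd.
apply: measurable_funB => //; apply: measurable_funM; last first.
  by apply: measurable_funV_real; exact: measurable_heat_kernel2.
apply: measurable_funM.
  apply: (measurableT_comp _ mk); apply: (measurable_pam_integrand hu).
  by rewrite addr_gt0.
apply: measurable_funV_real; apply: (measurableT_comp (measurable_propagator _ _)).
exact: measurable_fun_pair.
Qed.

Let fluctuationE t x w : 0 < t ->
  fluctuation t (w, x) = (heat_kernel t x)^-1 * (u t x w - heat_kernel t x).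
Proof.
move=> t0; rewrite /fluctuation /normalized_field/= mulrBr mulVf 1?mulrC//.
by rewrite gt_eqF// heat_kernel_gt0.
Qed.

Lemma fluctuation_mean t x : 0 < t -> \int[P]_w fluctuation t (w, x) = 0.
Proof.
move=> t0; under eq_Rintegral do rewrite fluctuationE//.
rewrite RintegralZl// ?(pam_centered_mean heta hu)// ?mulr0//.
exact/square_integrable_integrable/(pam_centered_square_integrable heta hu).
Qed.

Lemma fluctuation_variance t : 0 < t -> exists V : R, forall x,
  (\int[P]_w (fluctuation t (w, x) ^+ 2)%:E <= V%:E)%E.
Proof.
move=> t0; have [C C0 hC] := pam_variance_le heta hu t0.
exists (C * Num.sqrt t) => x.
have [mU iU] := pam_centered_square_integrable heta hu x t0.
have p0 := heat_kernel_gt0 x t0.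
under eq_integral do rewrite fluctuationE// exprMn EFinM.
rewrite integralZl// (Rintegral_EFin iU) -EFinM lee_fin exprVn.
by rewrite mulrC ler_pdivrMr ?exprn_gt0// hC.
Qed.

(** The value 1 outside [0 < z.1 < t] is a default that keeps the function measurable and
    nonnegative; the integrals below restrict to that time range. *)
Definition relative_moment t (z : R * R) : \bar R := if (0 < z.1 < t)%R then
  (second_moment P u z * (heat_kernel z.1 z.2 ^- 2)%:E)%E else 1%E.

(** Measurability is available for the second moment times two propagators, so it is multiplied and
    divided by [q ^ 2], with [q] the propagator to [(t, 0)], positive in the time range. *)
Lemma measurable_relative_moment t : 0 < t -> measurable_fun setT (relative_moment t).
Proof.
move=> t0; pose q (z : R * R) := propagator t 0 z.
have -> : relative_moment t = fun z => if (0 < z.1 < t)%R then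
    (((q z * q z)%:E * second_moment P u z) *
     ((q z * heat_kernel z.1 z.2) ^- 2)%:E)%E else 1%E.
  apply/funext => -[s y]; rewrite /relative_moment/=; case: ifP => // s01.
  have [s0 st] := andP s01.
  have q0 : q (s, y) != 0.
    by rewrite /q /propagator/= s01 gt_eqF// heat_kernel_gt0//; lra.
  have h0 : heat_kernel s y != 0 by rewrite gt_eqF// heat_kernel_gt0.
  rewrite [RHS]muleAC -EFinM muleC; congr (_%:E * _)%E.
  by field; apply/andP.
have mq : measurable_fun setT q by exact: measurable_propagator.
apply: measurable_fun_ifT; last exact: measurable_cst.
  by apply: measurable_and; exact: measurable_fun_ltr.
apply: emeasurable_funM; first exact: (measurable_propagator_moment hu 0 0 t0 t0).
apply/measurable_EFinP/measurable_funV_real/measurable_funX.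
by apply: measurable_funM => //; exact: measurable_heat_kernel2.
Qed.

Lemma relative_moment_ge1 t s y : 0 < s < t -> (1 <= relative_moment t (s, y))%E.
Proof.
move=> s01; have [s0 st] := andP s01; rewrite /relative_moment/= s01.
have p0 := heat_kernel_gt0 y s0.
have := second_moment_ge heta hu y s0.
rewrite (second_moment_decomp heta hu)// !lee_fin => h.
by rewrite ler_pdivlMr ?exprn_gt0// mul1r.
Qed.

Lemma relative_moment_le t : 0 < t -> exists2 C : R, 0 <= C &
  forall s y, 0 < s < t ->
  (relative_moment t (s, y) <= (1 + C * Num.sqrt s)%:E)%E.
Proof.
move=> t0; have [C C0 hC] := pam_variance_le heta hu t0.
exists C => // s y s01; have [s0 st] := andP s01.
rewrite /relative_moment/= s01 (second_moment_decomp heta hu)//.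
have p0 := heat_kernel_gt0 y s0.
rewrite -EFinM lee_fin ler_pdivrMr ?exprn_gt0// mulrDl mul1r lerD2l.
by apply: hC => //; exact: ltW.
Qed.

Lemma relative_moment_ge0 t z : (0 <= relative_moment t z)%E.
Proof.
rewrite /relative_moment; case: ifP => // _.
by rewrite mule_ge0 ?second_moment_ge0// lee_fin invr_ge0 sqr_ge0.
Qed.

(** Each use of [bridgeE] consumes one factor [heat_kernel s z]; these two factors are the square by
    which [relative_moment] divides. *)
Lemma fluctuation_covariance t1 t2 x y : 0 < t1 -> t1 <= t2 ->
  ((\int[P]_w (fluctuation t1 (w, x) * fluctuation t2 (w, y)))%:E =
   \int[@plane_measure R]_z if (0 < z.1 < t1)%R then
     (bridge t1 x z.1 z.2 * bridge t2 y z.1 z.2)%:E * relative_moment t1 z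
   else 0)%E.
Proof.
move=> t10 t12; have t20 : 0 < t2 by lra.
have p10 := heat_kernel_gt0 x t10; have p20 := heat_kernel_gt0 y t20.
under eq_Rintegral do rewrite !fluctuationE// mulrACA.
rewrite RintegralZl//; last first.
  by apply: integrableM_sqr; exact: (pam_centered_square_integrable heta hu).
rewrite EFinM (pam_covariance heta hu x y t10 t20) -ge0_integralZl//; last 3 first.
- exact: (measurable_propagator_moment hu x y t10 t20).
- move=> z _; rewrite mule_ge0 ?second_moment_ge0// lee_fin.
  by rewrite mulr_ge0 ?propagator_ge0.
- by rewrite lee_fin mulr_ge0// invr_ge0 ltW.
apply: eq_integral => -[s z] _; rewrite /relative_moment/=.
case: ifP => s01; last first.
  by rewrite /propagator/= s01 !mul0r mul0e mule0.
have [s0 st] := andP s01; have st2 : s < t2 by lra.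
rewrite /propagator/= s01 s0 st2/= muleA -EFinM muleA muleAC -EFinM.
congr (_%:E * _)%E.
have h0 := heat_kernel_gt0 z s0.
have e1 := bridgeE x z s0 st; have e2 := bridgeE y z s0 st2.
have -> : bridge t1 x s z = heat_kernel (t1 - s) (x - z) * heat_kernel s z /
    heat_kernel t1 x by rewrite e1 mulrAC mulfV ?mul1r// gt_eqF.
have -> : bridge t2 y s z = heat_kernel (t2 - s) (y - z) * heat_kernel s z /
    heat_kernel t2 y by rewrite e2 mulrAC mulfV ?mul1r// gt_eqF.
by field; rewrite !gt_eqF.
Qed.

(** Tonelli brings the integrals over the endpoints inside. At a fixed space-time point the
    integrand splits into a function of [x] and one of [y], and each integrates to a window. *)
Lemma fluctuation_covariance_window t1 t2 N : 0 < t1 -> t1 <= t2 ->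
  (\int[@plane_measure R]_z
     ((\int[P]_w (fluctuation t1 (w, z.1) * fluctuation t2 (w, z.2))) *
      (\1_(`[0%R, N]%classic) z.1 * \1_(`[0%R, N]%classic) z.2))%:E =
   \int[mu]_s \int[mu]_z if (0 < s < t1)%R then
     window N t1 s z * window N t2 s z * relative_moment t1 (s, z) else 0)%E.
Proof.
move=> t10 t12; set D : set R := `[0%R, N]%classic.
have mD : measurable D by exact: measurable_itv.
have mg := measurable_relative_moment t10; have g0 := relative_moment_ge0.
pose b t (p : (R * R) * R) : \bar R := (bridge t p.2 p.1.1 p.1.2 * \1_D p.2)%:E.
have b0 t p : (0 <= b t p)%E by rewrite lee_fin mulr_ge0// bridge_ge0.
have mb t : measurable_fun setT (b t).
  apply/measurable_EFinP; apply: measurable_funM; last first.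
    by apply: measurableT_comp => //; exact: measurable_indic.
  have m11 : measurable_fun setT (fun p : (R * R) * R => p.1.1).
    by apply: measurableT_comp.
  have m12 : measurable_fun setT (fun p : (R * R) * R => p.1.2).
    by apply: measurableT_comp.
  apply: measurable_heat_kernel2.
    by apply: measurable_funM => //; apply: measurable_funM => //; exact: measurable_funB.
  by apply: measurable_funB => //; apply: measurable_funM => //; exact: measurable_funM.
have wE t (z : R * R) : (\int[mu]_x b t (z, x) = window N t z.1 z.2)%E.
  apply: eq_integral => x _; rewrite /b /D indicE mem_setE/= in_itv/=.
  by case: ifP => _; rewrite ?mulr1 ?mulr0.
pose H (p : (R * R) * (R * R)) : \bar R := if (0 < p.2.1 < t1)%R then
  (b t1 (p.2, p.1.1) * b t2 (p.2, p.1.2) * relative_moment t1 p.2)%E else 0%E.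
have H0 p : (0 <= H p)%E by rewrite /H; case: ifP => // _; rewrite !mule_ge0.
have mH : measurable_fun setT H.
  have m1 : measurable_fun setT (fun p : (R * R) * (R * R) => p.1.1).
    by apply: measurableT_comp.
  have m2 : measurable_fun setT (fun p : (R * R) * (R * R) => p.1.2).
    by apply: measurableT_comp.
  have m21 : measurable_fun setT (fun p : (R * R) * (R * R) => p.2.1).
    by apply: measurableT_comp.
  apply: measurable_fun_ifT; last exact: measurable_cst.
    by apply: measurable_and; exact: measurable_fun_ltr.
  apply: emeasurable_funM; last exact: (measurableT_comp mg).
  by apply: emeasurable_funM; apply: (measurableT_comp (mb _));
    exact: measurable_fun_pair.
transitivity (\int[@plane_measure R]_p \int[@plane_measure R]_z H (p, z))%E.
  apply: eq_integral => -[x y] _.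
  have mI : measurable_fun setT (fun z : R * R => if (0 < z.1 < t1)%R then
      ((bridge t1 x z.1 z.2 * bridge t2 y z.1 z.2)%:E * relative_moment t1 z)%E
      else 0%E).
    apply: measurable_fun_ifT; last exact: measurable_cst.
      by apply: measurable_and; exact: measurable_fun_ltr.
    apply: emeasurable_funM => //; apply/measurable_EFinP.
    have mbr t c : measurable_fun setT (fun z : R * R => bridge t c z.1 z.2).
      apply: measurable_heat_kernel2.
        by apply: measurable_funM => //; apply: measurable_funM => //;
          exact: measurable_funB.
      by apply: measurable_funB => //; apply: measurable_funM => //;
        exact: measurable_funM.
    exact: measurable_funM.
  rewrite EFinM fluctuation_covariance// -ge0_integralZr//; last first.
    by move=> z _; case: ifP => // _; rewrite mule_ge0// lee_fin mulr_ge0 ?bridge_ge0.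
  apply: eq_integral => -[s z] _; rewrite /H/= /b/=.
  case: ifP => _; last by rewrite mul0e.
  by rewrite muleAC -!EFinM; congr (_%:E * _)%E; ring.
rewrite (@fubini_tonelli _ _ _ _ _ (@plane_measure R) (@plane_measure R) H mH H0).
pose G (z : R * R) : \bar R := if (0 < z.1 < t1)%R then
  (window N t1 z.1 z.2 * window N t2 z.1 z.2 * relative_moment t1 z)%E else 0%E.
have mG : measurable_fun setT G.
  apply: measurable_fun_ifT; last exact: measurable_cst.
    by apply: measurable_and; exact: measurable_fun_ltr.
  apply: emeasurable_funM => //.
  by apply: emeasurable_funM; exact: measurable_window.
have G0 z : (0 <= G z)%E.
  by rewrite /G; case: ifP => // _; rewrite !mule_ge0// window_ge0.
transitivity (\int[@plane_measure R]_z G z)%E; last first.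
  exact: (@fubini_tonelli1 _ _ _ _ _ mu mu G mG G0).
apply: eq_integral => z _; rewrite /H /G/=.
case: ifP => _; last by rewrite integral0.
have mbz t : measurable_fun [set: R] (fun x => b t (z, x)).
  apply: (measurableT_comp (mb t)).
  exact: (measurable_fun_pair (measurable_cst z) (@measurable_id _ R setT)).
pose B (p : R * R) : \bar R := (b t1 (z, p.1) * b t2 (z, p.2))%E.
have mB : measurable_fun setT B.
  by apply: emeasurable_funM; apply: (measurableT_comp (mbz _)).
have B0 p : (0 <= B p)%E by rewrite mule_ge0.
rewrite ge0_integralZr//; last by move=> p _; exact: B0.
congr (_ * _)%E.
transitivity (\int[(mu \x mu)%E]_p B p)%E; first by [].
rewrite (@fubini_tonelli1 _ _ _ _ _ mu mu B mB B0).
transitivity (\int[mu]_x (b t1 (z, x) * window N t2 z.1 z.2))%E.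
  apply: eq_integral => x _; rewrite -(wE t2 z) -ge0_integralZl//.
  exact: mbz.
rewrite ge0_integralZr//; last 2 first.
- exact: mbz.
- exact: window_ge0.
by rewrite wE.
Qed.

End normalized_field.

(** * Convergence of the rescaled covariance *)

Section covariance_asymptotics.
Context {R : realType} {d : measure_display} {T : measurableType d}.
Variable P : probability T R.

Lemma covariance_scale_centered (c : R) (A B : T -> R) :
  P.-integrable setT (EFin \o A) -> P.-integrable setT (EFin \o B) ->
  P.-integrable setT (EFin \o (fun w => A w * B w)) ->
  \int[P]_w A w = 0 -> \int[P]_w B w = 0 ->
  covariance P (fun w => c * A w) (fun w => c * B w) =
  (c ^+ 2 * \int[P]_w (A w * B w))%:E.
Proof.
move=> Ai Bi ABi A0 B0.
have E0 (X : T -> R) : P.-integrable setT (EFin \o X) -> \int[P]_w X w = 0 ->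
    expectation P (fun w => c * X w) = 0%E.
  move=> Xi X0; rewrite unlock; under eq_integral do rewrite EFinM.
  by rewrite integralZl// (Rintegral_EFin Xi) X0 mule0.
rewrite covariance.unlock E0// E0// expectation.unlock.
transitivity (\int[P]_w ((c ^+ 2)%:E * (A w * B w)%:E))%E.
  apply: eq_integral => w _; rewrite -EFinM; congr EFin.
  by change ((c * A w - 0) * (c * B w - 0) = c ^+ 2 * (A w * B w)); ring.
by rewrite integralZl// (Rintegral_EFin ABi) -EFinM.
Qed.

Variable eta : set (R * R) -> {RV P >-> R}.
Hypothesis heta : white_noise eta.
Variable u : R -> R -> T -> R.
Hypothesis hu : pam_solution eta u.
Local Notation mu := (@lebesgue_measure R).

(** The square of the prefactor [sqrt (N / ln N) / N] is [1 / (N ln N)], which turns the error [K N]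
    of [window_asymptotics] into [K / ln N]. *)
Lemma covariance_spatial_average (t1 t2 : R) : 0 < t1 -> t1 <= t2 ->
  exists K : R, forall N, 1 < N -> 2 <= t1 * N ^+ 2 -> exists2 r : R,
  covariance P (fun w => Num.sqrt (N / ln N) * spatial_average u N t1 w)
    (fun w => Num.sqrt (N / ln N) * spatial_average u N t2 w) = r%:E &
  `|2 * t1 - r| <= K / ln N.
Proof.
move=> t10 t12; have t20 : 0 < t2 by lra.
have [C C0 gC] := relative_moment_le heta hu t10.
have [K HK] := window_asymptotics t10 t12 C0 (measurable_relative_moment hu t10)
  (fun s z h => relative_moment_ge1 heta hu z h) gC.
exists K => N N1 tN; have N0 : 0 < N by lra.
have lnN : 0 < ln N by rewrite ln_gt0.
set D : set R := `[0%R, N]%classic.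
have mD : measurable D by exact: measurable_itv.
have Doo : (mu D < +oo)%E.
  by rewrite /D lebesgue_measure_itv/= lte_fin; case: ifP; rewrite ?ltry// -EFinD ltry.
have [V1 hV1] := fluctuation_variance heta hu t10.
have [V2 hV2] := fluctuation_variance heta hu t20.
pose V := Num.max V1 V2.
have hV1' x : (\int[P]_w (fluctuation u t1 (w, x) ^+ 2)%:E <= V%:E)%E.
  by apply: le_trans (hV1 x) _; rewrite lee_fin le_max lexx.
have hV2' x : (\int[P]_w (fluctuation u t2 (w, x) ^+ 2)%:E <= V%:E)%E.
  by apply: le_trans (hV2 x) _; rewrite lee_fin le_max lexx orbT.
have m1 := measurable_fluctuation hu t10; have m2 := measurable_fluctuation hu t20.
pose A t w := \int[mu]_(x in D) fluctuation u t (w, x).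
have [_ A1i] := average_integrable mD Doo m1 hV1'.
have [_ A2i] := average_integrable mD Doo m2 hV2'.
have A10 := average_mean mD Doo m1 hV1' (fun x => fluctuation_mean heta hu x t10).
have A20 := average_mean mD Doo m2 hV2' (fun x => fluctuation_mean heta hu x t20).
have [A12i A12E] := average_mul mD Doo m1 m2 hV1' hV2'.
rewrite (Rintegral_EFin A12i) (fluctuation_covariance_window heta hu) // in A12E.
have [up lo] := HK N (ltW N1) tN.
rewrite -A12E -EFinD !lee_fin in up lo.
pose c := Num.sqrt (N / ln N) * N^-1.
have cE : c ^+ 2 = (N * ln N)^-1.
  rewrite /c exprMn sqr_sqrtr; last by rewrite divr_ge0// ltW.
  by field; rewrite !gt_eqF.
exists (c ^+ 2 * \int[P]_w (A t1 w * A t2 w)).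
  rewrite -(covariance_scale_centered c A1i A2i A12i A10 A20).
  congr (covariance P _ _); apply/funext => w;
    by rewrite /spatial_average mulrA.
rewrite cE; set j := \int[P]_w _ in up lo *.
have NlnN : 0 < N * ln N by rewrite mulr_gt0.
have -> : 2 * t1 - (N * ln N)^-1 * j = (2 * t1 * N * ln N - j) / (N * ln N).
  by field; rewrite !gt_eqF.
rewrite normrM [X in _ * X]gtr0_norm ?invr_gt0// ler_pdivrMr//.
rewrite [N * ln N]mulrC mulrA divfK ?gt_eqF// ler_norml.
clear -up lo; apply/andP; split; lra.
Qed.

Lemma cvg_covariance_spatial_average (t1 t2 : R) : 0 < t1 -> t1 <= t2 ->
  covariance P (fun w => Num.sqrt (N / ln N) * spatial_average u N t1 w)
    (fun w => Num.sqrt (N / ln N) * spatial_average u N t2 w)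
  @[N --> +oo] --> (2 * t1)%:E.
Proof.
move=> t10 t12; have [K HK] := covariance_spatial_average t10 t12.
set F := fun N : R => covariance P _ _.
have Ffin N : 1 < N -> 2 <= t1 * N ^+ 2 -> F N = (fine (F N))%:E.
  by move=> N1 tN; have [r Fr _] := HK N N1 tN; rewrite /F Fr.
have large : \forall N \near +oo, 1 < N /\ 2 <= t1 * N ^+ 2.
  near=> N; have N1 : 1 < N by near: N; apply: nbhs_pinfty_gt; exact: num_real.
  have N2 : 2 / t1 <= N by near: N; apply: nbhs_pinfty_ge; exact: num_real.
  split => //; rewrite ler_pdivrMr// in N2.
  have : N <= N ^+ 2 by rewrite expr2; nra.
  by nra.
apply/fine_cvgP; split.
  by apply: filterS large => N [N1 tN]; rewrite (Ffin N N1 tN).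
apply/cvgrPdist_le => e e0; near=> N.
have [N1 tN] : 1 < N /\ 2 <= t1 * N ^+ 2 by near: N.
have [r Fr hr] := HK N N1 tN; rewrite (_ : (fine \o F) N = r); last by rewrite /= /F Fr.
have lnN : 0 < ln N by rewrite ln_gt0.
apply: (le_trans hr); rewrite ler_pdivrMr// -ler_pdivrMl//.
(* Beyond this threshold [ln N] is at least [K / e]. *)
have NK : expR (e^-1 * K) <= N by near: N; apply: nbhs_pinfty_ge; exact: num_real.
by rewrite -[leLHS]expRK ler_ln// posrE ?expR_gt0//; lra.
Unshelve. all: end_near. Qed.

End covariance_asymptotics.

Theorem proposition4p1 (R : realType) (d : measure_display)
  (T : measurableType d) (P : probability T R)
  (eta : set (R * R) -> {RV P >-> R}) (heta : white_noise eta)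
  (u : R -> R -> T -> R) (hu : pam_solution eta u)
  (t1 t2 : R) (ht1 : 0 < t1) (ht2 : 0 < t2) :
  covariance P
    (fun w => Num.sqrt (N / ln N) * spatial_average u N t1 w)
    (fun w => Num.sqrt (N / ln N) * spatial_average u N t2 w)
    @[N --> +oo] --> (2 * Num.min t1 t2)%:E.
Proof.
have [t12|/ltW t21] := leP t1 t2.
  exact: (cvg_covariance_spatial_average heta hu).
under eq_fun do rewrite covarianceC.
exact: (cvg_covariance_spatial_average heta hu).
Qed.
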